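(* Let $1<p\le\infty$, $\frac1p+\frac1{p'}=1$, $\beta\in\mathbb{R}$, $\psi\in B\cap\Theta_{p'}$, and suppose that either $\Delta^2(1/\psi(k))\ge0$ for all $k\in\mathbb{N}$, or $\Delta^2(1/\psi(k))\le0$ for all $k\in\mathbb{N}$. Then there exist positive quantities $K^{(3)}_{\psi,p}$, $K^{(4)}_{\psi,p}$, depending only on $\psi$ and $p$, such that for all $n\in\mathbb{N}$ $$K^{(4)}_{\psi,p}\,\psi(n)\,n^{1/p'}\le E_n\big(L^{\psi}_{\beta,1}\big)_{p}\le\mathcal{E}_n\big(L^{\psi}_{\beta,1}\big)_{p}\le K^{(3)}_{\psi,p}\,\psi(n)\,n^{1/p'}.$$
   Context: All functions are $2\pi$-periodic. $L_p$ ($1\le p\le\infty$) is the space of $2\pi$-periodic measurable functions with finite norm $\|f\|_p=\big(\int_0^{2\pi}|f|^p\big)^{1/p}$ for $p<\infty$ and $\|f\|_\infty=\operatorname{ess\,sup}|f|$. Let $\psi(t)>0$ be a continuous function of $t\ge1$; $\psi(k)$ denotes its values at positive integers, and $\Delta^2(1/\psi(k))=\frac1{\psi(k)}-\frac2{\psi(k+1)}+\frac1{\psi(k+2)}$. For $\beta\in\mathbb{R}$, $\Psi_\beta$ is the summable function with Fourier series $\sum_{k=1}^\infty\psi(k)\cos(kt-\beta\pi/2)$. $L^{\psi}_{\beta,1}$ is the class of all $f$ that for almost every $x$ satisfy $f(x)=\frac{a_0}{2}+\frac1\pi\int_{-\pi}^{\pi}\Psi_\beta(x-t)\varphi(t)\,dt$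 with $a_0\in\mathbb{R}$, $\int_{-\pi}^{\pi}\varphi=0$, $\|\varphi\|_1\le1$. $\mathcal{T}_{2n-1}$ is the space of trigonometric polynomials of degree at most $n-1$, $S_{n-1}(f)$ is the Fourier partial sum of order $n-1$, $\mathcal{E}_n(L^{\psi}_{\beta,1})_p=\sup_{f\in L^{\psi}_{\beta,1}}\|f-S_{n-1}(f)\|_p$, $E_n(L^{\psi}_{\beta,1})_p=\sup_{f\in L^{\psi}_{\beta,1}}\inf_{t\in\mathcal{T}_{2n-1}}\|f-t\|_p$. $B$ is the set of positive nonincreasing functions $\psi$ on $[1,\infty)$ with $\psi(t)/\psi(2t)\le K$ for some constant $K$ and all $t\ge1$. For $1\le q<\infty$, $\Theta_q$ is the set of nonincreasing functions $\psi$ on $[1,\infty)$ for which there exist $\alpha>1/q$ and $K>0$ with $t_1^\alpha\psi(t_1)\le K t_2^\alpha\psi(t_2)$ for all $t_1>t_2\ge1$. *)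

(* Defs.v *)
From HB Require Import structures.
From mathcomp Require Import all_boot all_order all_algebra.
From mathcomp Require Import all_classical all_reals all_analysis.
Set Implicit Arguments. Unset Strict Implicit. Unset Printing Implicit Defensive.
Import Order.TTheory GRing.Theory Num.Theory.
Import numFieldNormedType.Exports.
Local Open Scope classical_set_scope.
Local Open Scope ring_scope.

Section Defs.
Variable R : realType.
Local Notation mu := (@lebesgue_measure R).

Definition periodic2pi (f : R -> R) : Prop := forall x, f (x + 2 * pi) = f x.

(** The norm ||f||_p over a period [0, 2pi], p in [1, +oo]
    (extended-real valued; +oo when f is not in L_p). *)
Definition pnorm (p : \bar R) (f : R -> R) : \bar R :=
  match p with
  | r%:E => ((\int[mu]_(x in `[0%R, (2 * pi)%R]) ((`|f x| `^ r)%:E)) `^ r^-1)%E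
  | +oo%E => ereal_inf [set y : \bar R |
               {ae mu, forall x, x \in `[0%R, (2 * pi)%R] -> (`|f x|%:E <= y)%E}]
  | -oo%E => 0%E
  end.

Definition conj_exp (p : \bar R) : R :=
  match p with
  | r%:E => r / (r - 1)
  | _ => 1
  end.

Definition classB (psi : R -> R) : Prop :=
  (forall t, 1 <= t -> 0 < psi t) /\
  (forall t1 t2, 1 <= t1 -> t1 <= t2 -> psi t2 <= psi t1) /\
  (exists K : R, forall t, 1 <= t -> psi t / psi (2 * t) <= K).

Definition classTheta (q : R) (psi : R -> R) : Prop :=
  (forall t1 t2, 1 <= t1 -> t1 <= t2 -> psi t2 <= psi t1) /\
  (exists alpha K : R, q^-1 < alpha /\ 0 < K /\
     forall t1 t2, 1 <= t2 -> t2 < t1 ->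
       t1 `^ alpha * psi t1 <= K * (t2 `^ alpha * psi t2)).

Definition Delta2inv (psi : R -> R) (k : nat) : R :=
  (psi k%:R)^-1 - 2 * (psi k.+1%:R)^-1 + (psi k.+2%:R)^-1.

(** Psi_beta : a summable 2pi-periodic function whose Fourier series is
    sum_{k>=1} psi(k) cos(k t - beta pi / 2), i.e. with Fourier coefficients
    a_0 = 0, a_k = psi(k) cos(beta pi/2), b_k = psi(k) sin(beta pi/2) (k >= 1). *)
Definition is_Psi (psi : R -> R) (beta : R) (Psi : R -> R) : Prop :=
  periodic2pi Psi /\ measurable_fun setT Psi /\
  mu.-integrable `[(- pi)%R, pi%R] (EFin \o Psi) /\
  (forall k : nat,
     pi^-1 * Rintegral mu `[(- pi)%R, pi%R] (fun t => Psi t * cos (k%:R * t)) =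
       (if k == 0%N then 0 else psi k%:R * cos (beta * pi / 2))) /\
  (forall k : nat, (0 < k)%N ->
     pi^-1 * Rintegral mu `[(- pi)%R, pi%R] (fun t => Psi t * sin (k%:R * t)) =
       psi k%:R * sin (beta * pi / 2)).

Definition Lpsi1 (psi : R -> R) (beta : R) : set (R -> R) :=
  [set f | periodic2pi f /\ measurable_fun setT f /\
     exists Psi, is_Psi psi beta Psi /\
     exists (a0 : R) (phi : R -> R),
       periodic2pi phi /\ measurable_fun setT phi /\
       mu.-integrable `[(- pi)%R, pi%R] (EFin \o phi) /\
       Rintegral mu `[(- pi)%R, pi%R] phi = 0 /\
       (pnorm 1%E phi <= 1)%E /\
       {ae mu, forall x,
          (f x)%:E = ((a0 / 2)%:E + (pi^-1)%:E *
             \int[mu]_(t in `[(- pi)%R, pi%R]) (Psi (x - t) * phi t)%:E)%E}].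

Definition trig_pol (n : nat) : set (R -> R) :=
  [set t | exists a b : nat -> R, t = fun x =>
     \sum_(k < n) (a k * cos (k%:R * x) + b k * sin (k%:R * x))].

Definition fourier_a (f : R -> R) (k : nat) : R :=
  pi^-1 * Rintegral mu `[(- pi)%R, pi%R] (fun t => f t * cos (k%:R * t)).
Definition fourier_b (f : R -> R) (k : nat) : R :=
  pi^-1 * Rintegral mu `[(- pi)%R, pi%R] (fun t => f t * sin (k%:R * t)).
Definition fourier_sum (m : nat) (f : R -> R) : R -> R := fun x =>
  fourier_a f 0 / 2 +
  \sum_(1 <= k < m.+1) (fourier_a f k * cos (k%:R * x) +
                        fourier_b f k * sin (k%:R * x)).

Definition calE (n : nat) (psi : R -> R) (beta : R) (p : \bar R) : \bar R :=
  ereal_sup [set pnorm p (f \- fourier_sum n.-1 f) | f in Lpsi1 psi beta].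

Definition bestE (n : nat) (psi : R -> R) (beta : R) (p : \bar R) : \bar R :=
  ereal_sup [set ereal_inf [set pnorm p (f \- t) | t in trig_pol n]
            | f in Lpsi1 psi beta].

End Defs.

(* Main.v *)
(** Upper bound.  For [f] in the class, [f - S_(n-1) f] is the convolution of
    [phi] with the tail [sum_(k >= n) psi(k) cos(k x - beta pi / 2)] of the
    kernel, so by Young's inequality its [L_p] norm is at most the [L_p] norm of
    the tail.  Abel summation, together with the bound
    [psi(k) <= K psi(n) (n/k)^al] coming from [Theta], dominates the tail by
    [C psi(n)] times [n^al |x|^(al - 1)] for [|x| < 1/n] and [1/|x|] otherwise,
    which has [L_p] norm of order [n^(1/p')].  A function satisfying [is_Psi] is
    identified with the sum of its Fourier series by the uniqueness theorem for
    Fourier coefficients.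

    Lower bound.  Take for [phi] the Fejer kernel of order [n] modulated to the
    frequencies [n <= k < 3n].  The resulting [f] is a trigonometric polynomial
    with these frequencies; pairing [f - t] with the modulated Fejer kernel, of
    [L_(p')] norm at most of order [n^(1/p)], kills every [t] of degree below
    [n] and leaves a sum of order [psi(3n) n], comparable to [psi(n) n] because
    [psi] is in [B]. *)

Require Import Defs.
From HB Require Import structures.
From mathcomp Require Import all_boot all_order all_algebra.
From mathcomp Require Import all_classical all_reals all_analysis.
From mathcomp Require Import measurable_realfun zify ring lra.
Import Order.TTheory GRing.Theory Num.Theory.
Import numFieldNormedType.Exports.
Local Open Scope classical_set_scope.
Local Open Scope ring_scope.

(** * Integrals of periodic functions *)

(** The class allows every [Psi] with the prescribed coefficients, so the upper bound must hold for
    all of them, while the lower bound needs one to exist: [kernel_sum] is the witness, and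
    uniqueness of Fourier coefficients transfers its tail estimates to any other [Psi], almost
    everywhere. The majorant of the tails is an abstract [G] because two choices are made. For
    finite [p], cancellation enters through [envelope], whose [p]-th power is integrable at 0
    exactly when [al > 1/p']; the exponent is also lowered below 1, where the sum of [k^(-al)] up to
    [1/|x|] is governed by its upper end. For [p = +oo], [al > 1] makes the coefficients summable,
    and a constant [G] suffices. All block estimates are uniform in the phase [th], so the constants
    do not depend on [beta]. In the lower bound the dual function carries the same phase [th] as the
    extremal one, so every term of the pairing is nonnegative. The Fejer kernel serves twice: its
    integral normalises [phi], and its integral and sup bound interpolate to the [L_(p')] norm of
    the dual function. *)

Section reflection.
Context {R : realType}.
Local Notation mu := (@lebesgue_measure R).
Implicit Types (c a b : R) (A D : set R).

Lemma measurable_reflect c :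
  measurable_fun [set: measurableTypeR R] (fun t : measurableTypeR R => c - t : measurableTypeR R).
Proof. by apply: measurable_funB. Qed.

Lemma reflect_preimage_itv c a b (x y : bool) :
  (fun t => c - t) @^-1` [set` Interval (BSide x a) (BSide y b)] =
  [set` Interval (BSide (~~ y) (c - b)) (BSide (~~ x) (c - a))].
Proof.
apply/seteqP; split => t /=; rewrite !in_itv /=.
  by case: x y => -[] /= /andP[h1 h2]; apply/andP; split; lra.
by case: x y => -[] /= /andP[h1 h2]; apply/andP; split; lra.
Qed.

(** Lebesgue measure is determined by its values on half-open intervals; a reflection only exchanges
    the included endpoint and keeps the length. *)
Lemma lebesgue_measure_reflect c A : measurable A ->
  pushforward mu (fun t : measurableTypeR R => c - t : measurableTypeR R) A = mu A.
Proof.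
pose phi : {mfun (measurableTypeR R) >-> (measurableTypeR R)} :=
  HB.pack (fun t : measurableTypeR R => c - t : measurableTypeR R) (isMeasurableFun.Build _ _ _ _ _ (measurable_reflect c)).
move=> mA; apply/esym.
apply: (@lebesgue_measure_unique R (pushforward mu phi)) => //= _ [[a b]] _ <-.
rewrite /pushforward /phi /= reflect_preimage_itv !lebesgue_measure_itv/= !lte_fin ltrD2l ltrN2.
by case: ifP => // _; rewrite -!EFinB; congr EFin; ring.
Qed.

Lemma ge0_integral_reflect c D (f : R -> \bar R) : measurable D ->
  measurable_fun D f -> (forall t, D t -> 0 <= f t)%E ->
  (\int[mu]_(t in (fun t => (c - t)%R) @^-1` D) f (c - t)%R = \int[mu]_(t in D) f t)%E.
Proof.
move=> mD mf f0.
have f0' : {in D, forall y, 0 <= f y}%E by move=> y; rewrite inE; exact: f0.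
have /= <- := @ge0_integral_pushforward _ _ _ _ _ _ (measurable_reflect c) mu D f mD mf f0'.
apply: eq_measure_integral; first exact: measurable_reflect.
by move=> mphi A mA _; exact: lebesgue_measure_reflect.
Qed.

Lemma integral_reflect c D (f : R -> \bar R) : measurable D ->
  measurable_fun D f ->
  (\int[mu]_(t in (fun t => (c - t)%R) @^-1` D) f (c - t)%R = \int[mu]_(t in D) f t)%E.
Proof.
move=> mD mf; rewrite [RHS]integralE [LHS]integralE.
congr (_ - _)%E.
  rewrite -(ge0_integral_reflect c D _ mD (measurable_funepos mf) (fun t _ => funepos_ge0 f t)).
  by apply: eq_integral => t _; rewrite ?funeposE ?funenegE.
rewrite -(ge0_integral_reflect c D _ mD (measurable_funeneg mf) (fun t _ => funeneg_ge0 f t)).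
by apply: eq_integral => t _; rewrite ?funeposE ?funenegE.
Qed.

(** A translation is the composition of the reflections [t => - t] and [t => - c - t]. *)
Lemma integral_shift_itv c a b (f : R -> \bar R) : measurable_fun setT f ->
  (\int[mu]_(t in `[a, b]) f (t + c)%R = \int[mu]_(t in `[(a + c)%R, (b + c)%R]) f t)%E.
Proof.
move=> mf.
have mfN : measurable_fun setT (fun t : R => f (- t)%R).
  by apply: (measurableT_comp mf); exact: oppr_measurable.
have := integral_reflect 0 `[(a + c)%R, (b + c)%R] f (measurable_itv _) (measurable_funTS mf).
rewrite reflect_preimage_itv /= => <-.
have := integral_reflect (- c)%R `[(0 - (b + c))%R, (0 - (a + c))%R] (fun t => f (- t)%R)
  (measurable_itv _) (measurable_funTS mfN).
rewrite reflect_preimage_itv /=.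
have -> : (- c - (0 - (a + c)) = a)%R by ring.
have -> : (- c - (0 - (b + c)) = b)%R by ring.
move=> E; transitivity (\int[mu]_(t in `[a, b]) f (- (- c - t))%R)%E.
  by apply: eq_integral => t _; congr f; ring.
by rewrite E; apply: eq_integral => t _; rewrite sub0r.
Qed.

End reflection.

(** * Invariance of integrals over a full period *)

Section periodic.
Context {R : realType}.
Local Notation mu := (@lebesgue_measure R).

Lemma integral_itv_split (a b c : R) (f : R -> \bar R) : measurable_fun setT f ->
  (forall t, 0 <= f t)%E -> a <= b -> b <= c ->
  (\int[mu]_(t in `[a, c]) f t = \int[mu]_(t in `[a, b]) f t + \int[mu]_(t in `[b, c]) f t)%E.
Proof.
move=> mf f0 ab bc.
have mfD D : measurable_fun D f by exact: measurable_funTS.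
rewrite -(@integral_itv_obnd_cbnd _ b (BRight c)) //.
have -> : `[a, c]%classic = `[a, b]%classic `|` `]b, c]%classic.
  by apply: itv_bndbnd_setU; rewrite bnd_simp.
rewrite ge0_integral_setU //; first exact: mfD.
apply/disj_setPS => x; rewrite /= !in_itv /= => -[/andP[_ xb] /andP[bx _]].
by move: (le_lt_trans xb bx); rewrite ltxx.
Qed.

Lemma periodic_shiftn {T : Type} (f : R -> T) (w : R) : (forall x, f (x + w) = f x) ->
  forall (k : nat) x, f (x + k%:R * w) = f x.
Proof.
move=> fw; elim=> [|k IH] x; first by rewrite mul0r addr0.
by rewrite -natr1 mulrDl mul1r addrA fw.
Qed.

Lemma periodic_shiftz {T : Type} (f : R -> T) (w : R) : (forall x, f (x + w) = f x) ->
  forall (k : int) x, f (x + k%:~R * w) = f x.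
Proof.
move=> fw [k|k] x; first by rewrite -pmulrn; exact: periodic_shiftn.
by rewrite NegzE mulrNz -(periodic_shiftn f w fw k.+1) mulNr subrK.
Qed.

(** A whole number of periods brings the left endpoint to some [b] in [[-pi, pi]]; the part of
    [[b, b + 2 pi]] beyond [pi] is then moved back by one period to fill [[-pi, b]]. *)
Lemma ge0_integral_period (f : R -> \bar R) a : measurable_fun setT f ->
  (forall x, f (x + 2 * pi) = f x) -> (forall t, 0 <= f t)%E ->
  (\int[mu]_(t in `[a, (a + 2 * pi)%R]) f t = \int[mu]_(t in `[(- pi)%R, pi]) f t)%E.
Proof.
move=> mf fw f0; set w := 2 * pi in fw *.
have w0 : 0 < w by rewrite mulr_gt0 // pi_gt0.
pose Q a := (\int[mu]_(t in `[a, (a + w)%R]) f t)%E.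
have Qw b : Q (b + w) = Q b.
  by rewrite /Q -integral_shift_itv //; apply: eq_integral => t _; rewrite fw.
have -> : (\int[mu]_(t in `[(- pi)%R, pi]) f t)%E = Q (- pi).
  by rewrite /Q /w mulr_natl mulr2n addKr.
rewrite -/(Q a).
pose k := Num.floor ((a + pi) / w).
have /andP[k1 k2] : k%:~R <= (a + pi) / w < k%:~R + 1.
  have := floor_itv ((a + pi) / w); rewrite -/k intrD /= => /andP[-> H].
  exact: H.
set b := a - k%:~R * w.
have -> : Q a = Q b by rewrite -(periodic_shiftz Q w Qw k b) /b subrK.
have b1 : - pi <= b.
  by rewrite lerBrDr addrC -lerBrDr opprK -ler_pdivlMr.
have b2 : b <= - pi + w.
  rewrite lerBlDr -lerBlDl opprD opprK.
  move: k2; rewrite ltr_pdivrMr // => /ltW; rewrite /w; lra.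
rewrite /Q (integral_itv_split b (- pi + w)) //; last by rewrite lerD2r.
rewrite (integral_itv_split (- pi) b (- pi + w)) // addeC; congr (_ + _)%E.
rewrite -integral_shift_itv //.
by apply: eq_integral => t _; rewrite fw.
Qed.

Lemma integral_period (f : R -> \bar R) a : measurable_fun setT f ->
  (forall x, f (x + 2 * pi) = f x) ->
  (\int[mu]_(t in `[a, (a + 2 * pi)%R]) f t = \int[mu]_(t in `[(- pi)%R, pi]) f t)%E.
Proof.
move=> mf fw; rewrite [LHS]integralE [RHS]integralE.
by congr (_ - _)%E; apply: ge0_integral_period => //;
  [exact: measurable_funepos|move=> x; rewrite !funeposE fw|exact: measurable_funeneg|move=> x; rewrite !funenegE fw].
Qed.

Lemma integral_period_reflect (f : R -> \bar R) x : measurable_fun setT f ->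
  (forall x, f (x + 2 * pi) = f x) ->
  (\int[mu]_(t in `[(- pi)%R, pi]) f (x - t)%R = \int[mu]_(t in `[(- pi)%R, pi]) f t)%E.
Proof.
move=> mf fw.
have := integral_reflect x `[(x - pi)%R, (x + pi)%R] f (measurable_itv _) (measurable_funTS mf).
rewrite reflect_preimage_itv /=.
have -> : x - (x + pi) = - pi by ring.
have -> : x - (x - pi) = pi by ring.
move=> ->; rewrite -(integral_period f (x - pi)) //.
by have -> : x - pi + 2 * pi = x + pi by ring.
Qed.

Lemma integral_period_shift (f : R -> \bar R) x a : measurable_fun setT f ->
  (forall x, f (x + 2 * pi) = f x) ->
  (\int[mu]_(t in `[a, (a + 2 * pi)%R]) f (t + x)%R = \int[mu]_(t in `[(- pi)%R, pi]) f t)%E.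
Proof.
move=> mf fw; rewrite integral_shift_itv // -(integral_period f (a + x)) //.
by rewrite addrAC.
Qed.

End periodic.

(** * Integrals of trigonometric functions and almost-everywhere reasoning *)

Section trig_integrals.
Context {R : realType}.
Local Notation mu := (@lebesgue_measure R).
Local Notation I := (`[(- pi)%R, pi%R]%classic : set R).

Lemma Npi_lt_pi : - pi < pi :> R.
Proof. by rewrite gtrN // pi_gt0. Qed.

Lemma ae_imp (P Q : R -> Prop) : {ae mu, forall x, P x} -> (forall x, P x -> Q x) ->
  {ae mu, forall x, Q x}.
Proof.
by move=> aeP PQ; apply: negligibleS aeP => x /= nQ Px; apply: nQ; exact: PQ.
Qed.

Lemma ae_imp2 (P Q S : R -> Prop) : {ae mu, forall x, P x} -> {ae mu, forall x, Q x} ->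
  (forall x, P x -> Q x -> S x) -> {ae mu, forall x, S x}.
Proof.
move=> aeP aeQ PQS; have := negligibleU aeP aeQ; apply: negligibleS => x /= nS.
by apply: contrapT => /not_orP[/contrapT Px /contrapT Qx]; apply: nS; exact: PQS.
Qed.

Lemma measure_period : mu I = (2 * pi)%:E.
Proof.
rewrite lebesgue_measure_itv /= lte_fin Npi_lt_pi -EFinB; congr EFin; ring.
Qed.

Lemma continuous_integrable_itv (f : R -> R) a b : continuous f ->
  mu.-integrable `[a, b] (EFin \o f).
Proof.
move=> cf; apply: continuous_compact_integrable; first exact: segment_compact.
exact: continuous_subspaceT.
Qed.

Lemma integral_derive (f F : R -> R) (a b : R) : a < b -> continuous f ->
  (forall x : R, is_derive x 1 F (f x)) ->
  (\int[mu]_(x in `[a, b]) (f x)%:E = (F b - F a)%:E)%E.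
Proof.
move=> ab cf dF; rewrite EFinB; apply: continuous_FTC2 => //.
- exact: continuous_subspaceT.
- have cF : continuous F.
    by move=> x; apply/differentiable_continuous/derivable1_diffP; have [] := dF x.
  split=> //.
  + exact/cvg_at_right_filter/cF.
  + exact/cvg_at_left_filter/cF.
- by move=> x _; rewrite derive1E; have [_ ->] := dF x.
Qed.

Lemma continuous_affine_cos (a c : R) : continuous (fun x => cos (a * x + c)).
Proof.
move=> x; apply: (@continuous_comp _ _ _ (fun x => a * x + c) cos); last exact: continuous_cos.
by apply: cvgD; [exact: mulrl_continuous|exact: cvg_cst].
Qed.

Lemma continuous_affine_sin (a c : R) : continuous (fun x => sin (a * x + c)).
Proof.
move=> x; apply: (@continuous_comp _ _ _ (fun x => a * x + c) sin); last exact: continuous_sin.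
by apply: cvgD; [exact: mulrl_continuous|exact: cvg_cst].
Qed.

Lemma cosDz (k : int) (x : R) : cos (x + k%:~R * (2 * pi)) = cos x.
Proof. by apply: periodic_shiftz => y; rewrite mulr_natl cosD2pi. Qed.

Lemma sinDz (k : int) (x : R) : sin (x + k%:~R * (2 * pi)) = sin x.
Proof. by apply: periodic_shiftz => y; rewrite mulr_natl sinD2pi. Qed.

Lemma cosDn2pi (k : nat) (x c : R) : cos (k%:R * (x + 2 * pi) + c) = cos (k%:R * x + c).
Proof. by rewrite -[RHS](cosDz k) -pmulrn; congr cos; ring. Qed.

(** The frequency is an integer because products of harmonics produce differences of frequencies. *)
Lemma Rintegral_cos (k : int) (c : R) :
  Rintegral mu I (fun x => cos (k%:~R * x + c)) = if k == 0 then 2 * pi * cos c else 0.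
Proof.
case: eqP => [->|/eqP k0].
  rewrite (_ : (fun x => _) = cst (cos c)); last by apply/funext => x; rewrite mul0r add0r.
  transitivity (fine (\int[mu]_(x in I) (cst (cos c)%:E) x)) => //.
  rewrite integral_cst; last exact: measurable_itv.
  transitivity (fine ((cos c)%:E * mu I)) => //; rewrite measure_period /=; ring.
have k0' : (k%:~R : R) != 0 by rewrite intr_eq0.
rewrite /Rintegral.
have dF (x : R) : is_derive x 1 (fun x => k%:~R^-1 * sin (k%:~R * x + c)) (cos (k%:~R * x + c)).
  have D : is_derive x 1 (fun x : R => k%:~R * x + c) k%:~R.
    by apply: is_derive_eq; rewrite /GRing.scale /= ?addr0 ?mulr1.
  have D2 := @is_derive1_comp _ sin (fun x : R => k%:~R * x + c) x _ _ (is_derive_sin _) D.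
  have D3 := is_deriveZ k%:~R^-1 D2.
  rewrite (_ : (fun x => _) = k%:~R^-1 \*: (sin \o (fun x : R => k%:~R * x + c))) //.
  rewrite (_ : cos (k%:~R * x + c) = k%:~R^-1 *: (cos (k%:~R * x + c) * k%:~R)) //.
  by rewrite /GRing.scale /=; field.
rewrite (integral_derive _ _ _ _ Npi_lt_pi (@continuous_affine_cos _ _) dF).
rewrite /= -mulrBr (_ : k%:~R * pi + c = k%:~R * - pi + c + k%:~R * (2 * pi)); last by ring.
by rewrite sinDz subrr mulr0.
Qed.

Lemma negligible_set1 (a : R) : mu.-negligible [set a].
Proof. by exists [set a]; split => //; exact: lebesgue_measure_set1. Qed.

End trig_integrals.

(** * Multiplication by bounded measurable functions *)

Section bounded_mul.
Context {R : realType}.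
Local Notation mu := (@lebesgue_measure R).

(** The multipliers that preserve integrability; the class is an algebra containing all
    trigonometric polynomials. *)
Definition bounded_measurable (q : R -> R) :=
  measurable_fun setT q /\ exists M, forall x, `|q x| <= M.

Lemma bounded_measurable_cst a : bounded_measurable (fun=> a).
Proof. by split; [exact: measurable_cst|exists `|a| => x]. Qed.

Lemma bounded_measurableD q r : bounded_measurable q -> bounded_measurable r ->
  bounded_measurable (fun x => q x + r x).
Proof.
move=> [mq [M hM]] [mr [N hN]]; split; first exact: measurable_funD.
by exists (M + N) => x; rewrite (le_trans (ler_normD _ _)) // lerD.
Qed.

Lemma bounded_measurableM q r : bounded_measurable q -> bounded_measurable r ->
  bounded_measurable (fun x => q x * r x).
Proof.
move=> [mq [M hM]] [mr [N hN]]; split; first exact: measurable_funM.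
by exists (M * N) => x; rewrite normrM ler_pM.
Qed.

Lemma bounded_measurable_sum {T : Type} (s : seq T) (P : pred T) (q : T -> R -> R) :
  (forall i, bounded_measurable (q i)) -> bounded_measurable (fun x => \sum_(i <- s | P i) q i x).
Proof.
move=> H; elim: s => [|i s IH].
  by under eq_fun do rewrite big_nil; exact: bounded_measurable_cst.
under eq_fun do rewrite big_cons.
by case: (P i) => //; exact: bounded_measurableD.
Qed.

Lemma bounded_measurable_cos a c : bounded_measurable (fun x => cos (a * x + c)).
Proof.
split; last by exists 1 => x; exact: cos_max.
by apply: continuous_measurable_fun; exact: continuous_affine_cos.
Qed.

Lemma bounded_measurable_sin a c : bounded_measurable (fun x => sin (a * x + c)).
Proof.
split; last by exists 1 => x; exact: sin_max.
by apply: continuous_measurable_fun; exact: continuous_affine_sin.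
Qed.

Lemma integrable_mul_bounded (D : set R) (g q : R -> R) : measurable D ->
  mu.-integrable D (EFin \o g) ->
  bounded_measurable q -> mu.-integrable D (fun x => (g x * q x)%:E).
Proof.
move=> mD ig [mq [M hM]].
have : mu.-integrable D ((EFin \o g) \* (EFin \o q))%E.
  apply: integrableMl => //; first exact: measurable_funTS.
  exists M; split; first exact: num_real.
  by move=> N MN x _ /=; rewrite (le_trans (hM x)) // ltW.
by [].
Qed.

Lemma integrable_scale (D : set R) (f : R -> R) a : measurable D ->
  mu.-integrable D (EFin \o f) -> mu.-integrable D (EFin \o (fun x => a * f x)).
Proof.
move=> mD H0; have H := @integrableZl _ _ _ mu D mD a _ H0.
by rewrite (_ : _ \o _ = (fun x => a%:E * (EFin \o f) x)%E) //; apply/funext => x /=; rewrite EFinM.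
Qed.

Lemma bounded_integrable_itv a b (q : R -> R) : bounded_measurable q ->
  mu.-integrable `[a, b] (EFin \o q).
Proof.
move=> bq; have := @integrable_mul_bounded `[a, b] (cst 1) q (measurable_itv _).
move=> /(_ _ bq) H; rewrite (_ : EFin \o q = (fun x => (1 * q x)%:E)); last first.
  by apply/funext => x /=; rewrite mul1r.
by apply: H; apply: continuous_integrable_itv; exact: cst_continuous.
Qed.

End bounded_mul.

(** * Uniqueness of Fourier coefficients *)

Section uniqueness.
Context {R : realType}.
Local Notation mu := (@lebesgue_measure R).
Local Notation I := (`[(- pi)%R, pi%R]%classic : set R).
Variable g : R -> R.
Hypothesis mg : measurable_fun setT g.
Hypothesis ig : mu.-integrable I (EFin \o g).

(** Asking for orthogonality of [g] to [q] times every harmonic, rather than to [q] alone, makes the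
    class stable under multiplication by [cos] and [sin], hence by polynomials in [cos (x - c)]. *)
Definition annihilates_trig (q : R -> R) := bounded_measurable q /\
  forall k : nat, Rintegral mu I (fun x => g x * (q x * cos (k%:R * x))) = 0 /\
                  Rintegral mu I (fun x => g x * (q x * sin (k%:R * x))) = 0.

Let bcos (k : R) : bounded_measurable (fun x => cos (k * x)).
Proof. by have := bounded_measurable_cos k 0; under eq_fun do rewrite addr0. Qed.

Let bsin (k : R) : bounded_measurable (fun x => sin (k * x)).
Proof. by have := bounded_measurable_sin k 0; under eq_fun do rewrite addr0. Qed.

Let igM q : bounded_measurable q -> mu.-integrable I (fun x => (g x * q x)%:E).
Proof. by move=> bq; apply: integrable_mul_bounded. Qed.

Let comb2 (a b : R) q r : bounded_measurable q -> bounded_measurable r ->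
  Rintegral mu I (fun x => g x * q x) = 0 -> Rintegral mu I (fun x => g x * r x) = 0 ->
  Rintegral mu I (fun x => g x * (a * q x + b * r x)) = 0.
Proof.
move=> bq br q0 r0.
transitivity (Rintegral mu I (fun x => a * (g x * q x) + b * (g x * r x))).
  by congr Rintegral; apply/funext => x; ring.
rewrite RintegralD //.
- by rewrite !RintegralZl ?q0 ?r0 ?mulr0 ?addr0 //; exact: igM.
- exact: integrable_scale (igM _ bq).
- exact: integrable_scale (igM _ br).
Qed.

Lemma annihilates_comb a b q r : annihilates_trig q -> annihilates_trig r ->
  annihilates_trig (fun x => a * q x + b * r x).
Proof.
move=> [bq hq] [br hr]; split.
  by apply: bounded_measurableD; apply: bounded_measurableM => //; exact: bounded_measurable_cst.
move=> k; have [q1 q2] := hq k; have [r1 r2] := hr k; split.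
- transitivity (Rintegral mu I (fun x => g x * (a * (q x * cos (k%:R * x)) + b * (r x * cos (k%:R * x))))).
    by congr Rintegral; apply/funext => x; ring.
  by apply: comb2 => //; exact: bounded_measurableM.
- transitivity (Rintegral mu I (fun x => g x * (a * (q x * sin (k%:R * x)) + b * (r x * sin (k%:R * x))))).
    by congr Rintegral; apply/funext => x; ring.
  by apply: comb2 => //; exact: bounded_measurableM.
Qed.

Lemma annihilates_cos q : annihilates_trig q -> annihilates_trig (fun x => q x * cos x).
Proof.
move=> [bq hq]; have b1 : bounded_measurable (@cos R).
  by have := bcos 1; under eq_fun do rewrite mul1r.
split; first exact: bounded_measurableM.
(* Frequency 0 is separate: the product-to-sum formula used for [k.+1] involves [k] and [k.+2], and
   would give frequency -1 here. *)
case=> [|k].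
- split.
    transitivity (Rintegral mu I (fun x => g x * (q x * cos (1%:R * x)))); last by have [] := hq 1%N.
    by congr Rintegral; apply/funext => x; rewrite mul0r cos0 mulr1 mul1r.
  transitivity (Rintegral mu I (fun x => g x * (q x * sin (0%:R * x)))); last by have [] := hq 0%N.
  by congr Rintegral; apply/funext => x; rewrite mul0r sin0 !mulr0.
- have [q1 q2] := hq k; have [r1 r2] := hq k.+2; split.
  + transitivity (Rintegral mu I (fun x => g x * (2^-1 * (q x * cos (k.+2%:R * x)) + 2^-1 * (q x * cos (k%:R * x))))).
      congr Rintegral; apply/funext => x.
      have -> : k.+2%:R * x = k.+1%:R * x + x by rewrite -[k.+2%:R]natr1; ring.
      have -> : k%:R * x = k.+1%:R * x - x by rewrite -[k.+1%:R]natr1; ring.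
      by rewrite cosB cosD; field.
    by apply: comb2 => //; exact: bounded_measurableM.
  + transitivity (Rintegral mu I (fun x => g x * (2^-1 * (q x * sin (k.+2%:R * x)) + 2^-1 * (q x * sin (k%:R * x))))).
      congr Rintegral; apply/funext => x.
      have -> : k.+2%:R * x = k.+1%:R * x + x by rewrite -[k.+2%:R]natr1; ring.
      have -> : k%:R * x = k.+1%:R * x - x by rewrite -[k.+1%:R]natr1; ring.
      by rewrite sinB sinD; field.
    by apply: comb2 => //; exact: bounded_measurableM.
Qed.

Lemma annihilates_sin q : annihilates_trig q -> annihilates_trig (fun x => q x * sin x).
Proof.
move=> [bq hq]; have b1 : bounded_measurable (@sin R).
  by have := bsin 1; under eq_fun do rewrite mul1r.
split; first exact: bounded_measurableM.
case=> [|k].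
- split.
    transitivity (Rintegral mu I (fun x => g x * (q x * sin (1%:R * x)))); last by have [] := hq 1%N.
    by congr Rintegral; apply/funext => x; rewrite mul0r cos0 mulr1 mul1r.
  transitivity (Rintegral mu I (fun x => g x * (q x * sin (0%:R * x)))); last by have [] := hq 0%N.
  by congr Rintegral; apply/funext => x; rewrite mul0r sin0 !mulr0.
- have [q1 q2] := hq k; have [r1 r2] := hq k.+2; split.
  + transitivity (Rintegral mu I (fun x => g x * (2^-1 * (q x * sin (k.+2%:R * x)) + (- 2^-1) * (q x * sin (k%:R * x))))).
      congr Rintegral; apply/funext => x.
      have -> : k.+2%:R * x = k.+1%:R * x + x by rewrite -[k.+2%:R]natr1; ring.
      have -> : k%:R * x = k.+1%:R * x - x by rewrite -[k.+1%:R]natr1; ring.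
      by rewrite sinB sinD; field.
    by apply: comb2 => //; exact: bounded_measurableM.
  + transitivity (Rintegral mu I (fun x => g x * (2^-1 * (q x * cos (k%:R * x)) + (- 2^-1) * (q x * cos (k.+2%:R * x))))).
      congr Rintegral; apply/funext => x.
      have -> : k.+2%:R * x = k.+1%:R * x + x by rewrite -[k.+2%:R]natr1; ring.
      have -> : k%:R * x = k.+1%:R * x - x by rewrite -[k.+1%:R]natr1; ring.
      by rewrite cosB cosD; field.
    by apply: comb2 => //; exact: bounded_measurableM.
Qed.

Lemma annihilates_affine_cos q a b c : annihilates_trig q ->
  annihilates_trig (fun x => q x * (a + b * cos (x - c))).
Proof.
move=> hq.
have H1 := annihilates_comb (b * cos c) (b * sin c) _ _ (annihilates_cos _ hq) (annihilates_sin _ hq).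
have H2 := annihilates_comb a 1 _ _ hq H1.
suff -> : (fun x => q x * (a + b * cos (x - c))) =
  (fun x => a * q x + 1 * (b * cos c * (q x * cos x) + b * sin c * (q x * sin x))) by [].
by apply/funext => x; rewrite cosB; ring.
Qed.

Lemma annihilates_affine_cosX q a b c n : annihilates_trig q ->
  annihilates_trig (fun x => q x * (a + b * cos (x - c)) ^+ n).
Proof.
move=> hq; elim: n => [|n IH].
  by under eq_fun do rewrite expr0 mulr1.
under eq_fun do rewrite exprSr mulrA.
exact: annihilates_affine_cos.
Qed.

Lemma annihilates_kuhn q a b c n N : annihilates_trig q ->
  annihilates_trig (fun x => q x * (1 - (a + b * cos (x - c)) ^+ n) ^+ N).
Proof.
move=> hq; elim: N => [|N IH].
  by under eq_fun do rewrite expr0 mulr1.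
have := annihilates_comb 1 (-1) _ _ IH (annihilates_affine_cosX _ a b c n IH).
suff -> : (fun x => q x * (1 - (a + b * cos (x - c)) ^+ n) ^+ N.+1) =
 (fun x => 1 * (q x * (1 - (a + b * cos (x - c)) ^+ n) ^+ N) +
   -1 * (q x * (1 - (a + b * cos (x - c)) ^+ n) ^+ N * (a + b * cos (x - c)) ^+ n)) by [].
by apply/funext => x; rewrite exprSr; ring.
Qed.

Hypothesis g_cos : forall k : nat, Rintegral mu I (fun x => g x * cos (k%:R * x)) = 0.
Hypothesis g_sin : forall k : nat, Rintegral mu I (fun x => g x * sin (k%:R * x)) = 0.

Lemma annihilates_one : annihilates_trig (fun=> 1).
Proof.
split; first exact: bounded_measurable_cst.
move=> k; split.
  by rewrite -[RHS](g_cos k); congr Rintegral; apply/funext => x; rewrite mul1r.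
by rewrite -[RHS](g_sin k); congr Rintegral; apply/funext => x; rewrite mul1r.
Qed.

(* Kuhn polynomials approximate the indicator of [0, 1/2[ on [0, 1]. *)
Definition kuhn (y : R) (n : nat) := (1 - y ^+ n) ^+ (2 ^ n).

Lemma kuhn_bound y n : 0 <= y <= 1 -> `|kuhn y n| <= 1.
Proof.
move=> /andP[y0 y1]; rewrite /kuhn normrX exprn_ile1 // ger0_norm ?subr_ge0 ?exprn_ile1 //.
by rewrite gerBl exprn_ge0.
Qed.

(** Bernoulli's inequality with exponent [2 ^ n] gives the lower bound [1 - (2 y) ^ n]. *)
Lemma kuhn_lt y : 0 <= y -> y < 2^-1 -> kuhn y n @[n --> \oo] --> (1 : R).
Proof.
move=> y0 y1.
have y2 : `|2 * y| < 1 by rewrite ger0_norm; lra.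
apply: (@squeeze_cvgr _ _ _ _ (fun n => 1 - (2 * y) ^+ n) (fun=> 1)); last 2 first.
- by rewrite -[X in _ --> X]subr0; apply: cvgB; [exact: cvg_cst|exact: cvg_expr].
- exact: cvg_cst.
apply: nearW => n; rewrite /kuhn.
have yn : 0 <= y ^+ n <= 1 by rewrite exprn_ge0 //= exprn_ile1 //; lra.
apply/andP; split; last by apply: exprn_ile1; lra.
rewrite exprMn -natrX.
elim: (2 ^ n)%N => [|N IH]; first by rewrite expr0; lra.
rewrite exprSr -natr1; have N0 : 0 <= N%:R :> R by [].
have Ny : 0 <= N%:R * y ^+ n * y ^+ n by rewrite !mulr_ge0 //; lra.
apply: (@le_trans _ _ ((1 - N%:R * y ^+ n) * (1 - y ^+ n))); first by lra.
by apply: ler_wpM2r => //; lra.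
Qed.

(** With [N = 2 ^ n], the product of [(1 - y^n)^N] and [(1 + y^n)^N] is at most 1, while the second
    factor is at least [N y^n = (2 y)^n], which tends to infinity. *)
Lemma kuhn_gt y : y <= 1 -> 2^-1 < y -> kuhn y n @[n --> \oo] --> (0 : R).
Proof.
move=> y1 y2.
have y3 : `|(2 * y)^-1| < 1.
  by rewrite ger0_norm ?invr_ge0; [rewrite invf_lt1; lra|lra].
apply: (@squeeze_cvgr _ _ _ _ (fun=> 0) (fun n => ((2 * y)^-1) ^+ n)); last 2 first.
- exact: cvg_cst.
- exact: cvg_expr.
apply: nearW => n; rewrite /kuhn.
have yn : 0 <= y ^+ n <= 1 by rewrite exprn_ge0 ?exprn_ile1 //; lra.
apply/andP; split; first by apply: exprn_ge0; lra.
have y4 : 0 < (2 * y) ^+ n by rewrite exprn_gt0 //; lra.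
rewrite exprVn -[leRHS]mul1r ler_pdivlMr //.
apply: (@le_trans _ _ ((1 - y ^+ n) ^+ (2 ^ n) * (1 + y ^+ n) ^+ (2 ^ n))).
  apply: ler_wpM2l; first by apply: exprn_ge0; lra.
  rewrite exprMn -natrX.
  elim: (2 ^ n)%N => [|N IH]; first by rewrite expr0; lra.
  rewrite exprSr -natr1.
  have : 1 <= (1 + y ^+ n) ^+ N by apply: exprn_ege1; lra.
  have : 0 <= y ^+ n by lra.
  nra.
by rewrite -exprMn; apply: exprn_ile1; nra.
Qed.

(* The threshold set of the Kuhn polynomials in cos (x - c), with c = (b - pi) / 2, is the interval ]-pi, b[. *)
Lemma integral_initial_interval (b : R) : - pi < b < pi -> Rintegral mu `[- pi, b] g = 0.
Proof.
move=> /andP[b1 b2].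
pose c := (b - pi) / 2; pose h := (b + pi) / 2.
have pi0 : 0 < pi :> R by exact: pi_gt0.
(* [c] and [h] are the midpoint and half-length of []-pi, b[]. As
   [y x - 1/2 = (cos h - cos (x - c)) / 4], [y] falls below 1/2 exactly when [x - c] is closer to 0
   than [h] modulo the period; the factor 1/4 keeps [y] in [[0, 1]]. *)
pose y x := (2^-1 + cos h / 4) + (- 4^-1) * cos (x - c).
have lcos (u v : R) : 0 <= u -> v <= pi -> u < v -> cos v < cos u.
  by move=> u0 vp uv; rewrite ltr_cos // in_itv /=; lra.
have y01 x : 0 <= y x <= 1.
  by rewrite /y; have := cos_max h; have := cos_max (x - c); rewrite !ler_norml; lra.
have y_lt (x : R) : - pi < x -> x < b -> y x < 2^-1.
  move=> x1 x2; suff : cos h < cos (x - c) by rewrite /y; lra.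
  rewrite -[cos (x - c)]cos_norm; apply: lcos; first exact: normr_ge0.
    by rewrite /h; lra.
  by rewrite ltr_norml /c /h; lra.
have y_gt (x : R) : b < x -> x < pi -> 2^-1 < y x.
  move=> x1 x2; suff : cos (x - c) < cos h by rewrite /y; lra.
  (* Since [c < 0], [x - c] may exceed [pi]; then [2 pi - (x - c)] is used instead, and it exceeds
     [h] because [x < pi]. *)
  have [xc|xc] := leP (x - c) pi.
    by apply: lcos => //; rewrite /c /h; lra.
  rewrite -(cosN (x - c)) -(cosDz 1) mul1r; apply: lcos; first by rewrite /h; lra.
    by move: xc; rewrite /c; lra.
  by rewrite /c /h; lra.
have my : measurable_fun setT y.
  apply: measurable_funD; first exact: measurable_cst.
  apply: measurable_funM; first exact: measurable_cst.
  by have [] := bounded_measurable_cos 1 (- c); under eq_fun do rewrite mul1r.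
pose f_ n x := (g x * kuhn (y x) n)%:E.
have mk n : measurable_fun setT (fun x => kuhn (y x) n).
  apply: measurable_funX; apply: measurable_funB; first exact: measurable_cst.
  exact: measurable_funX.
pose f x := (g x * (x < b)%R%:R)%:E.
have mf_ n : measurable_fun I (f_ n).
  by apply: measurable_funTS; apply/measurable_EFinP; exact: measurable_funM.
have mlt : measurable_fun setT (fun x : R => (x < b)%R%:R : R).
  have := @measurable_indic _ R R setT `]-oo, b[%classic (measurable_itv _).
  rewrite /indic (_ : (fun x => _) = (fun x : R => (x < b)%R%:R : R)) //.
  by apply/funext => x; rewrite mem_setE in_itv.
have mf : measurable_fun I f.
  by apply: measurable_funTS; apply/measurable_EFinP; exact: measurable_funM.
have ig' : mu.-integrable I (EFin \o (fun x => `|g x|)) by exact: integrable_norm.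
have cvf : {ae mu, forall x, I x -> f_ ^~ x @ \oo --> f x}.
  (* At these three points [y] equals 1/2, where the Kuhn polynomials tend neither to 0 nor to 1. *)
  have : mu.-negligible [set - pi; b; pi].
    by do 2 (apply: negligibleU; last exact: negligible_set1); exact: negligible_set1.
  apply: negligibleS => x /= H.
  apply: contrapT => /not_orP [/not_orP [/eqP xpi /eqP xb] /eqP xpi2].
  apply: H; rewrite in_itv /= => /andP[x1 x2].
  have {}x1 : - pi < x by rewrite lt_neqAle eq_sym xpi.
  have {}x2 : x < pi by rewrite lt_neqAle xpi2.
  rewrite /f_ /f; apply: cvg_EFin; first exact: nearW.
  apply: cvgM; first exact: cvg_cst.
  have [xb'|xb'] := ltP x b; first by apply: kuhn_lt; [have /andP[] := y01 x|exact: y_lt].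
  by apply: kuhn_gt; [have /andP[] := y01 x|apply: y_gt => //; rewrite lt_neqAle eq_sym xb].
have dom : {ae mu, forall x n, I x -> `|f_ n x| <= (`|g x|%R)%:E}%E.
  apply: aeW => x n _ /=; rewrite lee_fin normrM -[leRHS]mulr1 ler_wpM2l //.
  exact: kuhn_bound.
have [_ _ cvg_int] := @dominated_convergence _ _ _ mu I (measurable_itv _) _ _ _ mf_ mf cvf ig' dom.
have int0 n : (\int[mu]_(x in I) f_ n x = 0)%E.
  have [bq /(_ 0%N)[H _]] := annihilates_kuhn _ (2^-1 + cos h / 4) (- 4^-1) c n (2 ^ n) annihilates_one.
  have iq := igM _ bq.
  rewrite (_ : f_ n = fun x => (g x * (1 * (1 - (2^-1 + cos h / 4 + - 4^-1 * cos (x - c)) ^+ n) ^+ (2 ^ n)))%:E); last first.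
    by apply/funext => x; rewrite mul1r.
  rewrite -[LHS]fineK; last exact: (@integrable_fin_num _ _ _ mu I).
  congr EFin; rewrite -[RHS]H; congr fine; apply: eq_integral => x _.
  by rewrite mul0r cos0 mulr1.
have E : (\int[mu]_(x in I) f x = 0)%E.
  move: cvg_int; rewrite (_ : [sequence _]_n = cst 0%E); last by apply/funext => n; exact: int0.
  by move=> /cvg_lim <- //; rewrite lim_cst.
rewrite /Rintegral -[RHS](_ : fine 0%E = 0) // -E; congr fine.
have -> : (\int[mu]_(x in I) f x = \int[mu]_(x in I `&` `]-oo, b[) (g x)%:E)%E.
  rewrite integral_mkcondr; apply: eq_integral => x _; rewrite patchE mem_setE in_itv /= /f.
  by case: ifP => _; rewrite ?mulr1 ?mulr0.
rewrite -integral_itv_bndo_bndc; last by apply/measurable_EFinP; exact: measurable_funTS.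
congr integral; apply/seteqP; split => x /=; rewrite !in_itv /=; lra.
Qed.

(** Extended by 0 outside the period, [g] has an indefinite integral that vanishes identically; by
    Lebesgue's differentiation theorem the derivative of this integral is [g] almost everywhere. *)
Lemma fourier_uniqueness : {ae mu, forall x, I x -> g x = 0}.
Proof.
pose g' := g \_ I.
have mg' : measurable_fun setT g'.
  exact: (measurable_restrictT g (measurable_itv _)).1 (measurable_funTS mg).
have ig' : mu.-integrable setT (EFin \o g').
  have := (@integrable_mkcond _ _ _ mu I (EFin \o g) (measurable_itv _)).1 ig.
  by rewrite restrict_EFin.
have igy y : mu.-integrable `]-oo, y] (EFin \o g') by apply: integrableS ig'.
have lg : locally_integrable setT g' by exact: integrable_locally.
apply: (ae_imp _ _ (FTC1Ny igy lg)) => x [_ g'x] Ix.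
have <- : g' x = g x by rewrite /g' patchE mem_set.
rewrite -g'x.
rewrite derive1E.
have F0 y : Rintegral mu `]-oo, y] g' = 0.
  rewrite /g' -Rintegral_mkcondr.
  have [y1|y1] := leP y (- pi).
    rewrite /Rintegral (@integral_Sset1 _ _ _ (- pi)) // => z /=; rewrite !in_itv /=; lra.
  have [y2|y2] := ltP y pi.
    rewrite (_ : _ `&` _ = `[- pi, y]%classic); first by rewrite integral_initial_interval // y1.
    by apply/seteqP; split => z /=; rewrite !in_itv /=; lra.
  (* For [y >= pi] the integral runs over the whole period and is the zeroth cosine coefficient. *)
  rewrite (_ : _ `&` _ = I); last by apply/seteqP; split => z /=; rewrite !in_itv /=; lra.
  rewrite -[RHS](g_cos 0); congr Rintegral; apply/funext => z.
  by rewrite mul0r cos0 mulr1.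
rewrite (_ : (fun _ => _) = cst 0); last by apply/funext.
by rewrite derive_cst.
Qed.

End uniqueness.

(** * Estimates of the tails of the kernel *)

Section estimates.
Context {R : realType}.

(** The mean value theorem on [[0, z]], with [cos] decreasing on [[0, pi]]. *)
Lemma sin_ge_xcos (z : R) : 0 <= z -> z <= pi -> z * cos z <= sin z.
Proof.
move=> z0 zp.
have cs : {within `[0, z], continuous (@sin R)}.
  by apply: continuous_subspaceT; exact: continuous_sin.
have [c] := @MVT_segment R sin cos 0 z z0 (fun x _ => is_derive_sin x) cs.
rewrite in_itv /= sin0 !subr0 => /andP[c0 cz] ->.
rewrite mulrC ler_wpM2r //.
move: cz; rewrite le_eqVlt => /predU1P[-> //|cz].
by rewrite ltW // ltr_cos // in_itv /=; lra.
Qed.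

(** By the double angle, [sin y = 2 sin (y/2) cos (y/2) >= y cos^2 (y/2) = y (1 + cos y) / 2], and
    [cos y >= 0]. *)
Lemma sin_ge_half (y : R) : 0 <= y -> y <= pi / 2 -> y / 2 <= sin y.
Proof.
move=> y0 y1.
have yE : y = y / 2 + y / 2 by field.
have pi0 : 0 < pi :> R by exact: pi_gt0.
have H : y / 2 * cos (y / 2) <= sin (y / 2) by apply: sin_ge_xcos; lra.
have c0 : 0 <= cos (y / 2) by apply: cos_ge0_pihalf; lra.
have c1 : 0 <= cos y by apply: cos_ge0_pihalf; lra.
rewrite {2}yE sinD.
have c2 : cos y = 2 * cos (y / 2) ^+ 2 - 1.
  by rewrite {1}yE cosD; have := cos2Dsin2 (y / 2); lra.
have H2 : y / 2 * cos (y / 2) * cos (y / 2) <= sin (y / 2) * cos (y / 2) by exact: ler_wpM2r.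
have H3 : 0 <= y * cos y by exact: mulr_ge0.
by move: H2 H3; rewrite c2; lra.
Qed.

Lemma norm_sin_half_ge (x : R) : `|x| <= pi -> `|x| / 4 <= `|sin (x / 2)|.
Proof.
move=> xp.
have -> : `|sin (x / 2)| = `|sin (`|x| / 2)|.
  have [x0|x0] := leP 0 x; first by rewrite [`|x|]ger0_norm.
  by rewrite [`|x|]ltr0_norm // mulNr sinN normrN.
rewrite (le_trans _ (ler_norm _)) //.
have x0 := normr_ge0 x.
have -> : `|x| / 4 = `|x| / 2 / 2 by field.
by apply: sin_ge_half; lra.
Qed.

Lemma abel_bound (a s : nat -> R) (n m : nat) :
  (forall k, (n <= k)%N -> a k.+1 <= a k) -> (forall k, (n <= k)%N -> 0 <= a k) ->
  (forall k, `|s k| <= 1) -> (n <= m)%N ->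
  `|\sum_(n <= k < m) a k * (s k.+1 - s k)| <= 2 * a n.
Proof.
move=> adec a0 s1 nm.
(* The boundary term of the summation by parts belongs to the induction claim; each further step
   then costs [a k - a k.+1], which telescopes. *)
suff H j : `|\sum_(n <= k < n + j) a k * (s k.+1 - s k) - a (n + j)%N * s (n + j)%N| <= 2 * a n - a (n + j)%N.
  have := H (m - n)%N; rewrite subnKC // => {}H.
  have H2 : `|a m * s m| <= a m by rewrite normrM ger0_norm ?a0 // ler_piMr ?a0.
  set S := \sum_(n <= k < m) _ in H *.
  rewrite -(subrK (a m * s m) S) (le_trans (ler_normD _ _)) //; lra.
elim: j => [|j IH].
  rewrite addn0 big_geq // sub0r normrN normrM ger0_norm ?a0 //.
  have := s1 n; have := a0 n (leqnn n); nra.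
rewrite addnS big_nat_recr /=; last exact: leq_addr.
set S := \sum_(n <= k < n + j) _ in IH *.
have nj : (n <= n + j)%N by exact: leq_addr.
have -> : S + a (n + j)%N * (s (n + j).+1 - s (n + j)%N) - a (n + j).+1 * s (n + j).+1 =
  (S - a (n + j)%N * s (n + j)%N) + (a (n + j)%N - a (n + j).+1) * s (n + j).+1 by ring.
have H2 : `|(a (n + j)%N - a (n + j).+1) * s (n + j).+1| <= a (n + j)%N - a (n + j).+1.
  by rewrite normrM ger0_norm ?subr_ge0 ?adec // ler_piMr ?subr_ge0 ?adec.
by rewrite (le_trans (ler_normD _ _)) //; lra.
Qed.

Definition cos_block (a : nat -> R) (th : R) (n m : nat) (x : R) :=
  \sum_(n <= k < m) a k * cos (k%:R * x - th).

(** Multiplying by [2 sin (x/2)] turns [cos (k x - th)] into a difference of consecutive values of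
    [sin (k x - th - x/2)], to which [abel_bound] applies; [|sin (x/2)| >= |x|/4] then gives the
    factor 4. *)
Lemma cos_block_abel (a : nat -> R) (th : R) (n m : nat) (x : R) :
  (forall k, (n <= k)%N -> a k.+1 <= a k) -> (forall k, (n <= k)%N -> 0 <= a k) ->
  x != 0 -> `|x| <= pi -> `|cos_block a th n m x| <= 4 * a n / `|x|.
Proof.
move=> adec a0 x0 xp; rewrite -normr_gt0 in x0.
have [nm|mn] := leqP n m; last first.
  by rewrite /cos_block big_geq ?normr0; [rewrite divr_ge0 ?mulr_ge0 ?a0|exact: ltnW].
have := abel_bound a (fun k => sin (k%:R * x - th - x / 2)) n m adec a0 (fun k => sin_max _) nm.
rewrite (_ : \sum_(n <= k < m) _ = 2 * sin (x / 2) * cos_block a th n m x); last first.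
  rewrite /cos_block big_distrr /=; apply: eq_bigr => k _.
  have -> : k.+1%:R * x - th - x / 2 = (k%:R * x - th) + x / 2 by rewrite -natr1; field.
  by move: (k%:R * x - th) => A; rewrite sinD sinB; ring.
rewrite !normrM ger0_norm // ler_pdivlMr //.
have := norm_sin_half_ge x xp.
have := normr_ge0 (cos_block a th n m x).
set S := `|sin _|; set T := `|cos_block _ _ _ _ _|; nra.
Qed.

Lemma powR_add (x a b : R) : 0 < x -> x `^ (a + b) = x `^ a * x `^ b.
Proof. by move=> x0; rewrite /powR gt_eqF // mulrDl expRD. Qed.

Lemma ln_le_sub1 (y : R) : 0 < y -> ln y <= y - 1.
Proof.
move=> y0; rewrite -ler_expR lnK ?posrE //.
by rewrite (le_trans _ (expR_ge1Dx _)) //; lra.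
Qed.

Lemma powR_ge1D (y s : R) : 0 < y -> 1 + s * ln y <= y `^ s.
Proof. by move=> y0; rewrite /powR gt_eqF // expR_ge1Dx. Qed.

(** Each term is compared with the telescoping difference of [k^s]:
    [(1 + 1/k)^s - 1 >= s ln (1 + 1/k)], and [ln (1 + 1/k) >= 1/(k+1) >= 1/(2k)]. *)
Lemma sum_powR_lt1 (s : R) (n N : nat) : 0 < s -> (0 < n)%N -> (n <= N)%N ->
  \sum_(n <= k < N) k%:R `^ (s - 1) <= 2 / s * N%:R `^ s.
Proof.
move=> s0 n0 nN.
apply: (@le_trans _ _ (\sum_(n <= k < N) 2 / s * (k.+1%:R `^ s - k%:R `^ s))).
  rewrite !big_nat; apply: ler_sum => k /andP[nk kN].
  have k0 : 0 < k%:R :> R by rewrite ltr0n; exact: leq_trans nk.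
  have k1 : 1 <= k%:R :> R by rewrite ler1n -(ltr0n R).
  have E : k.+1%:R = k%:R * (1 + k%:R^-1) :> R by rewrite mulrDr mulr1 divff ?gt_eqF // natr1.
  have iv : 0 < k%:R^-1 :> R by rewrite invr_gt0.
  have P := powR_ge1D (1 + k%:R^-1) s ltac:(lra).
  have L : (2 * k%:R)^-1 <= ln (1 + k%:R^-1 : R).
    have H : 0 < (1 + k%:R^-1)^-1 :> R by rewrite invr_gt0; lra.
    have := ln_le_sub1 _ H; rewrite lnV ?posrE; last lra.
    have -> : (1 + k%:R^-1)^-1 = 1 - (k%:R + 1)^-1 :> R by field; lra.
    have : (2 * k%:R)^-1 <= (k%:R + 1)^-1 :> R by rewrite lef_pV2 ?posrE; lra.
    lra.
  rewrite E powRM; [|lra|lra].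
  have -> : k%:R `^ (s - 1) = k%:R `^ s / k%:R :> R.
    by rewrite powR_add // powR_inv1 // ltW.
  have ks : 0 <= k%:R `^ s :> R by exact: powR_ge0.
  have H : s * (2 * k%:R)^-1 <= s * ln (1 + k%:R^-1) by rewrite ler_wpM2l // ltW.
  have -> : k%:R `^ s / k%:R = 2 / s * (k%:R `^ s * (s * (2 * k%:R)^-1)) :> R by field; lra.
  rewrite ler_wpM2l ?divr_ge0 //; first exact: ltW.
  have : k%:R `^ s * (s * (2 * k%:R)^-1) <= k%:R `^ s * ((1 + k%:R^-1) `^ s - 1).
    by rewrite ler_wpM2l //; lra.
  lra.
rewrite -big_distrr /= telescope_sumr // ler_wpM2l ?divr_ge0 //; first exact: ltW.
by rewrite gerBl powR_ge0.
Qed.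

(** Comparison with the telescoping difference of [- k^(1 - al)], which controls [(k+1)^(-al)]; the
    factor [2^al] pays for passing from [k] to [k + 1], as [k + 1 <= 2 k]. *)
Lemma sum_powR_gt1 (al : R) (n m : nat) : 1 < al -> (0 < n)%N ->
  \sum_(n <= k < m) k%:R `^ (- al) <= 2 `^ al / (al - 1) * n%:R `^ (1 - al).
Proof.
move=> al1 n0.
have C0 : 0 <= 2 `^ al / (al - 1) by rewrite divr_ge0 ?powR_ge0 //; lra.
have [nm|mn] := leqP n m; last first.
  by rewrite big_geq; [rewrite mulr_ge0 ?powR_ge0|exact: ltnW].
apply: (@le_trans _ _ (\sum_(n <= k < m) 2 `^ al / (al - 1) * ((- k.+1%:R `^ (1 - al)) - (- k%:R `^ (1 - al))))).
  rewrite !big_nat; apply: ler_sum => k /andP[nk kN].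
  have k0 : 0 < k%:R :> R by rewrite ltr0n; exact: leq_trans nk.
  have k1 : 1 <= k%:R :> R by rewrite ler1n -(ltr0n R).
  set t := k.+1%:R.
  have tE : t = k%:R + 1 :> R by rewrite natr1.
  have t0 : 0 < t by lra.
  have kt : 0 < k%:R / t by rewrite divr_gt0.
  have P := powR_ge1D (k%:R / t) (1 - al) kt.
  have L := ln_le_sub1 _ kt.
  have E1 : k%:R / t - 1 = - t^-1 by rewrite tE; field; lra.
  have E2 : k%:R `^ (1 - al) = (k%:R / t) `^ (1 - al) * t `^ (1 - al).
    by rewrite -powRM ?divfK ?gt_eqF // ltW.
  have E3 : t `^ (1 - al) = t * t `^ (- al).
    by rewrite powR_add // powRr1 // ltW.
  have T0 : 0 < t `^ (- al) by rewrite powR_gt0.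
  have H : (al - 1) * t^-1 <= (1 - al) * ln (k%:R / t).
    rewrite -(opprB al 1) mulNr -mulrN ler_wpM2l ?subr_ge0 ?(ltW al1) //.
    by rewrite lerNr -E1.
  have H1 : k%:R `^ (- al) <= 2 `^ al * t `^ (- al).
    rewrite !powRN ler_pdivlMr ?powR_gt0 // mulrC ler_pdivrMr ?powR_gt0 //.
    by rewrite -powRM ?ge0_ler_powR ?nnegrE //; lra.
  rewrite (le_trans H1) // -mulrA ler_wpM2l ?powR_ge0 //.
  rewrite mulrC ler_pdivlMr; last by rewrite subr_gt0.
  rewrite E2 E3; set A := (k%:R / t) `^ _ in P *; set B := t `^ (- al) in T0 *.
  have H2 : 1 + (al - 1) * t^-1 <= A by rewrite (le_trans _ P) // lerD2l.
  move: A B T0 H2 {P H H1 E3} => A B T0 H2.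
  have H3 : (1 + (al - 1) * t^-1) * (t * B) <= A * (t * B).
    by rewrite ler_wpM2r // ltW // mulr_gt0.
  have E4 : (1 + (al - 1) * t^-1) * (t * B) = t * B + (al - 1) * B by field; lra.
  by move: H3; rewrite E4; lra.
rewrite -big_distrr /= telescope_sumr // ler_wpM2l //.
by rewrite opprK addrC gerBl powR_ge0.
Qed.

Lemma cos_block_abs (a : nat -> R) (th : R) (n m : nat) (x : R) :
  (forall k, (n <= k)%N -> 0 <= a k) -> `|cos_block a th n m x| <= \sum_(n <= k < m) a k.
Proof.
move=> a0; rewrite (le_trans (ler_norm_sum _ _ _)) // !big_nat.
apply: ler_sum => k /andP[nk _]; rewrite normrM ger0_norm ?a0 // ler_piMr ?a0 //.
exact: cos_max.
Qed.

Lemma cos_block_cat (a : nat -> R) (th : R) (n m N : nat) (x : R) : (n <= N)%N -> (N <= m)%N ->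
  cos_block a th n m x = cos_block a th n N x + cos_block a th N m x.
Proof. exact: big_cat_nat. Qed.

Definition envelope (al : R) (n : nat) (x : R) : R :=
  if n%:R * x < 1 then n%:R `^ al * x `^ (al - 1) else x `^ (- 1).

(* The frequencies below 1/|x| are estimated trivially, the ones above by Abel summation. *)
Lemma cos_block_envelope (a : nat -> R) (th al K : R) (n m : nat) (x : R) :
  0 < al -> al < 1 -> 1 <= K -> (0 < n)%N ->
  (forall k, (n <= k)%N -> a k.+1 <= a k) -> (forall k, (n <= k)%N -> 0 <= a k) ->
  (forall k, (n <= k)%N -> a k <= K * (n%:R `^ al * k%:R `^ (- al)) * a n) ->
  x != 0 -> `|x| <= pi ->
  `|cos_block a th n m x| <= K * (4 / (1 - al) + 4) * a n * envelope al n `|x|.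
Proof.
move=> al0 al1 K1 n0 adec a0 aK x0 xp.
have y0 : 0 < `|x| by rewrite normr_gt0.
have an := a0 n (leqnn n).
have C4 : 4 <= K * (4 / (1 - al) + 4).
  have : 0 <= 4 / (1 - al) by rewrite divr_ge0 //; lra.
  nra.
rewrite /envelope; case: ifPn => [nx|]; last first.
  move=> _; rewrite powR_inv1; last exact: ltW.
  rewrite (le_trans (cos_block_abel _ _ _ _ _ adec a0 x0 xp)) //.
  by rewrite ler_wpM2r ?invr_ge0 ?ler_wpM2r // ltW.
have xp' := xp; move Ey : `|x| => y; rewrite Ey in xp y0 nx.
set s := 1 - al; have s0 : 0 < s by rewrite /s; lra.
have al1E : al - 1 = - s by rewrite /s; ring.
have nr : 1 <= n%:R :> R by rewrite ler1n.
(* The cut-off frequency, the first integer above [1/|x|]. Since [1/|x| > n >= 1], it satisfies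
   [n <= N <= 2/|x|]. *)
pose N := (Num.trunc y^-1).+1.
have iy0 : 0 <= y^-1 by rewrite invr_ge0 ltW.
have /andP[N1 N2] : (Num.trunc y^-1)%:R <= y^-1 < N%:R by exact: truncn_itv.
have NE : N%:R = (Num.trunc y^-1)%:R + 1 :> R by rewrite /N -natr1.
have ny : n%:R < y^-1 by rewrite -[y^-1]div1r ltr_pdivlMr.
have nN : (n <= N)%N.
  by rewrite -(ler_nat R) ltW // (lt_trans ny).
have Ny : N%:R <= 2 * y^-1 by lra.
have head M : (n <= M <= N)%N -> \sum_(n <= k < M) a k <= K * (4 / s) * a n * (n%:R `^ al * y `^ (- s)).
  move=> /andP[nM MN].
  apply: (@le_trans _ _ (\sum_(n <= k < M) K * n%:R `^ al * a n * k%:R `^ (s - 1))).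
    rewrite !big_nat; apply: ler_sum => k /andP[nk _].
    rewrite (le_trans (aK k nk)) // le_eqVlt; apply/orP; left; apply/eqP.
    have -> : s - 1 = - al by rewrite /s; ring.
    ring.
  rewrite -big_distrr /=.
  have := sum_powR_lt1 s n M s0 n0 nM.
  have M1 : M%:R `^ s <= (2 * y^-1) `^ s.
    by apply: ge0_ler_powR; rewrite ?nnegrE ?(le_trans _ Ny) ?ler_nat // ltW.
  have M2 : (2 * y^-1) `^ s <= 2 * y `^ (- s).
    rewrite powRM // -powR_inv1; last exact: ltW.
    rewrite -powRrM mulN1r ler_wpM2r ?powR_ge0 //.
    by rewrite -[leRHS]powRr1 // ler_powR //; rewrite /s; lra.
  move=> H.
  have H2 : \sum_(n <= k < M) k%:R `^ (s - 1) <= 4 / s * y `^ (- s).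
    rewrite (le_trans H) // (_ : 4 / s * y `^ (- s) = 2 / s * (2 * y `^ (- s))); last by field; lra.
    by rewrite ler_wpM2l ?divr_ge0 ?(le_trans M1) // ltW.
  have H3 : 0 <= K * n%:R `^ al * a n by rewrite !mulr_ge0 ?powR_ge0 //; lra.
  rewrite (le_trans (ler_wpM2l H3 H2)) // le_eqVlt; apply/orP; left; apply/eqP; ring.
rewrite al1E.
have E0 : 0 <= K * 4 * a n * (n%:R `^ al * y `^ (- s)).
  by rewrite !mulr_ge0 ?powR_ge0 //; lra.
have -> : K * (4 / s + 4) * a n * (n%:R `^ al * y `^ (- s)) =
  K * (4 / s) * a n * (n%:R `^ al * y `^ (- s)) + K * 4 * a n * (n%:R `^ al * y `^ (- s)).
  by field; lra.
have [mN|Nm] := leqP m N.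
  rewrite (le_trans (cos_block_abs _ _ _ _ _ a0)) //.
  have [nm|mn] := leqP n m; last first.
    rewrite big_geq; last exact: ltnW.
    by rewrite addr_ge0 // !mulr_ge0 ?powR_ge0 ?invr_ge0 //; lra.
  by rewrite (le_trans (head m _)) ?nm //; rewrite lerDl.
rewrite (cos_block_cat _ _ _ _ N) //; last exact: ltnW.
rewrite (le_trans (ler_normD _ _)) // lerD //.
  by rewrite (le_trans (cos_block_abs _ _ _ _ _ a0)) // head // nN leqnn.
have adec' k : (N <= k)%N -> a k.+1 <= a k by move=> Nk; apply: adec; exact: leq_trans Nk.
have a0' k : (N <= k)%N -> 0 <= a k by move=> Nk; apply: a0; exact: leq_trans Nk.
rewrite (le_trans (cos_block_abel _ _ _ _ _ adec' a0' x0 xp')) // Ey.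
rewrite ler_pdivrMr //.
(* As [N > 1/|x|], the decay hypothesis bounds [a N] by [K n^al |x|^al a n]; the Abel bound
   [4 a N / |x|] then has the size of the first branch of the envelope. *)
have NN : N%:R `^ (- al) <= y `^ al.
  rewrite powRN -powR_inv1 ?powR_ge0 // -powRrM mulrC powRrM powR_inv1 //.
  apply: ge0_ler_powR; rewrite ?nnegrE ?invr_ge0 //; first exact: ltW.
    exact: ltW.
  by rewrite -[leRHS]invrK lef_pV2 ?posrE ?invr_gt0 // ?ltr0n // ltW.
have yE : y `^ al = y `^ (- s) * y.
  rewrite -[X in _ * X]powRr1; last exact: ltW.
  by rewrite -powR_add //; congr powR; rewrite /s; ring.
have H : a N <= K * (n%:R `^ al * (y `^ (- s) * y)) * a n.
  rewrite (le_trans (aK N nN)) // ler_wpM2r // ler_wpM2l //; first by lra.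
  by rewrite ler_wpM2l ?powR_ge0 // -yE.
have -> : K * 4 * a n * (n%:R `^ al * y `^ (- s)) * y = 4 * (K * (n%:R `^ al * (y `^ (- s) * y)) * a n) by ring.
by rewrite ler_wpM2l.
Qed.

End estimates.

(** * Integrals of powers and of the envelope *)

Section envelope_integral.
Context {R : realType}.
Local Notation mu := (@lebesgue_measure R).

Lemma integral_powR (s a b : R) : 0 < a -> a <= b -> s + 1 != 0 ->
  (\int[mu]_(x in `[a, b]) (x `^ s)%:E = ((b `^ (s + 1) - a `^ (s + 1)) / (s + 1))%:E)%E.
Proof.
move=> a0; rewrite le_eqVlt => /predU1P[<-|ab] s1.
  by rewrite set_itv1 integral_set1 subrr mul0r.
have dF (x : R) : 0 < x -> is_derive x 1 (fun x : R => x `^ (s + 1) / (s + 1)) (x `^ s).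
  move=> x0; have D := @is_derive1_powR R (s + 1) x x0.
  have D2 := is_deriveZ (s + 1)^-1 D.
  rewrite (_ : (fun x => _) = (s + 1)^-1 \*: (@powR R ^~ (s + 1))); last first.
    by apply/funext => z; rewrite /= mulrC.
  rewrite (_ : x `^ s = (s + 1)^-1 *: ((s + 1) * x `^ (s + 1 - 1))) //.
  by rewrite /GRing.scale /= mulrA mulVf // mul1r addrK.
have cF (x : R) : 0 < x -> {for x, continuous (fun x : R => x `^ (s + 1) / (s + 1))}.
  by move=> x0; apply/differentiable_continuous/derivable1_diffP; have [] := dF x x0.
rewrite (@continuous_FTC2 _ (fun x => x `^ s) (fun x => x `^ (s + 1) / (s + 1)) a b) //.
- by rewrite -EFinB -mulrBl.
- apply: derivable_within_continuous => x; rewrite in_itv /= => /andP[ax _].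
  by have [] := @is_derive1_powR R s x (lt_le_trans a0 ax).
- split => //.
  + move=> x; rewrite in_itv /= => /andP[ax _].
    by have [] := dF x (lt_trans a0 ax).
  + exact/cvg_at_right_filter/cF.
  + by apply/cvg_at_left_filter/cF; exact: lt_trans ab.
- move=> x; rewrite in_itv /= => /andP[ax _]; rewrite derive1E.
  by have [_ ->] := dF x (lt_trans a0 ax).
Qed.

Lemma integral_powR_tail_le (r b : R) (n : nat) : 1 < r -> 1 <= b -> (0 < n)%N ->
  (\int[mu]_(x in `[(n%:R^-1)%R, b]) (x `^ (- r))%:E <= ((r - 1)^-1 * n%:R `^ (r - 1))%:E)%E.
Proof.
move=> r1 b1 n0.
have nr0 : 0 < n%:R :> R by rewrite ltr0n.
have n1 : n%:R^-1 <= 1 :> R by rewrite invf_le1 // ler1n.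
have r1' : - r + 1 != 0 by rewrite lt_eqF //; lra.
have ni : 0 < n%:R^-1 :> R by rewrite invr_gt0.
rewrite (integral_powR (- r) _ _ ni (le_trans n1 b1) r1').
have p0 : 0 <= b `^ (- r + 1) by exact: powR_ge0.
have -> : n%:R^-1 `^ (- r + 1) = n%:R `^ (r - 1) :> R.
  rewrite -powR_inv1; last exact: ltW.
  by rewrite -powRrM; congr powR; ring.
rewrite lee_fin; move: (n%:R `^ _) (b `^ _) p0 => A B p0.
have -> : (B - A) / (- r + 1) = (A - B) / (r - 1).
  by rewrite (_ : - r + 1 = - (r - 1)); [rewrite -(opprB A B) invrN mulrNN|ring].
by rewrite mulrC ler_wpM2l ?invr_ge0; lra.
Qed.

Lemma measurable_powR_ereal (s : R) : measurable_fun setT (fun x : R => (x `^ s)%:E).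
Proof. by apply/measurable_EFinP; exact: measurable_powR. Qed.

(** The possible singularity at 0 is reached by monotone convergence along the intervals
    [[b/(i+1), b]], on each of which [integral_powR] applies. *)
Lemma integral_powR0_le (s b : R) : 0 < b -> 0 < s + 1 ->
  (\int[mu]_(x in `[0%R, b]) (x `^ s)%:E <= (b `^ (s + 1) / (s + 1))%:E)%E.
Proof.
move=> b0 s1.
have ms D : measurable_fun D (fun x : R => (x `^ s)%:E).
  by apply: measurable_funTS; exact: measurable_powR_ereal.
rewrite -(@integral_itv_obnd_cbnd _ 0 (BRight b)) //.
pose F (i : nat) : set R := `[b / i.+1%:R, b]%classic.
have FE : `]0, b]%classic = \bigcup_i F i.
  apply/seteqP; split => [x|x].
    rewrite /= in_itv /= => /andP[x0 xb]; exists (Num.trunc (b / x)) => //=.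
    rewrite /F /= in_itv /= xb andbT ler_pdivrMr // mulrC -ler_pdivrMr // ltW //.
    by have /andP[] := truncn_itv (divr_ge0 (ltW b0) (ltW x0)).
  case=> i _; rewrite /F /= !in_itv /= => /andP[bx ->]; rewrite andbT.
  by rewrite (lt_le_trans _ bx) // divr_gt0.
have cvg := @ge0_nondecreasing_set_cvg_integral _ (measurableTypeR R) R F (fun x : R => (x `^ s)%:E) mu.
have {}cvg : (\int[mu]_(x in F i) (x `^ s)%:E)%E @[i --> \oo] --> (\int[mu]_(x in `]0%R, b]) (x `^ s)%:E)%E.
  rewrite FE; apply: cvg.
  - move=> i j ij; apply/subsetPset => x; rewrite /F /= !in_itv /= => /andP[bx ->]; rewrite andbT.
    rewrite (le_trans _ bx) // ler_wpM2l ?(ltW b0) // lef_pV2 ?posrE // ler_nat ltnS //.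
  - by move=> i; exact: measurable_itv.
  - by move=> i; exact: ms.
  - by move=> i x _; rewrite lee_fin powR_ge0.
rewrite -(cvg_lim _ cvg) //; apply: lime_le; first by apply/cvg_ex; eexists; exact: cvg.
apply: nearW => i; rewrite /F integral_powR ?divr_gt0 ?gt_eqF //; last first.
  by rewrite ler_pdivrMr // ler_peMr ?(ltW b0) // ler1n.
by rewrite lee_fin ler_wpM2r ?invr_ge0 ?(ltW s1) // gerBl powR_ge0.
Qed.

Lemma measurable_envelope (al : R) (n : nat) : measurable_fun setT (envelope al n).
Proof.
apply: measurable_fun_ifT.
- apply: measurable_fun_ltr; last exact: measurable_cst.
  by apply: measurable_funM; first exact: measurable_cst.
- by apply: measurable_funM; [exact: measurable_cst|exact: measurable_powR].
- exact: measurable_powR.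
Qed.

Lemma envelope_ge0 (al : R) (n : nat) (x : R) : 0 <= envelope al n x.
Proof. by rewrite /envelope; case: ifP => _; rewrite ?mulr_ge0 ?powR_ge0. Qed.

Lemma integral_even (f : R -> R) (b : R) : 0 <= b -> measurable_fun setT f -> (forall x, 0 <= f x) ->
  (\int[mu]_(x in `[(- b)%R, b]) (f `|x|%R)%:E = 2%:E * \int[mu]_(x in `[0%R, b]) (f x)%:E)%E.
Proof.
move=> b0 mf f0.
have mfE : measurable_fun setT (fun x : R => (f `|x|%R)%:E).
  by apply/measurable_EFinP; apply: (measurableT_comp mf); exact: normr_measurable.
rewrite (integral_itv_split (- b) 0 b) ?oppr_le0 //; last by move=> x; rewrite lee_fin.
set J := (\int[mu]_(x in `[0%R, b]) (f x)%:E)%E.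
have E1 : (\int[mu]_(x in `[0%R, b]) (f `|x|%R)%:E = J)%E.
  apply: eq_integral => x; rewrite inE /= in_itv /= => /andP[x0 _].
  by rewrite ger0_norm.
have E2 : (\int[mu]_(x in `[(- b)%R, 0%R]) (f `|x|%R)%:E = J)%E.
  rewrite -E1.
  have := integral_reflect 0 `[0%R, b] _ (measurable_itv _) (measurable_funTS mfE).
  rewrite reflect_preimage_itv /= !sub0r oppr0 => <-.
  by apply: eq_integral => x _; rewrite sub0r normrN.
by rewrite [X in (X + _)%E](_ : _ = J) // [X in (_ + X)%E](_ : _ = J) // mule_natl mule2n.
Qed.

(** The condition [0 < (al - 1) * r + 1], that is [al > 1 - 1/r], is integrability at 0. Cutting at
    [1/n] balances the two pieces: both are of order [n^(r-1)], with the two inverses in the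
    constant coming from the two antiderivatives. *)
Lemma integral_envelope_le (al r : R) (n : nat) : 1 < r -> 0 < al -> al < 1 -> 0 < (al - 1) * r + 1 ->
  (0 < n)%N ->
  (\int[mu]_(x in `[(- pi)%R, pi]) ((envelope al n `|x|%R) `^ r)%:E <=
   (2 * (((al - 1) * r + 1)^-1 + (r - 1)^-1) * n%:R `^ (r - 1))%:E)%E.
Proof.
move=> r1 al0 al1 q0 n0.
have pi2 : 2 <= pi :> R by exact: pi_ge2.
have nr : 1 <= n%:R :> R by rewrite ler1n.
have nr0 : 0 < n%:R :> R by rewrite ltr0n.
have mE : measurable_fun setT (fun x => (envelope al n x) `^ r).
  by apply: (measurableT_comp (measurable_powR _)); exact: measurable_envelope.
rewrite (integral_even (fun x => (envelope al n x) `^ r)) //; [|lra|by move=> x; exact: powR_ge0].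
rewrite -mulrA EFinM lee_pmul2l //.
rewrite (integral_itv_split 0 (n%:R^-1) pi) ?invr_ge0 //; last 3 first.
- by apply/measurable_EFinP.
- by move=> x; rewrite lee_fin powR_ge0.
- by rewrite (le_trans (_ : _ <= 1)) ?invf_le1 //; lra.
rewrite mulrDl EFinD leeD //.
  have H1 : (\int[mu]_(x in `[0%R, (n%:R^-1)%R]) ((envelope al n x) `^ r)%:E <=
     \int[mu]_(x in `[0%R, (n%:R^-1)%R]) ((n%:R `^ (al * r))%:E * (x `^ ((al - 1) * r))%:E))%E.
    apply: ge0_le_integral => //.
    - by move=> x _; rewrite lee_fin powR_ge0.
    - by apply: measurable_funTS; apply/measurable_EFinP.
    - apply: measurable_funTS; apply: emeasurable_funM; first exact: measurable_cst.
      exact: measurable_powR_ereal.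
    move=> x /=; rewrite in_itv /= => /andP[x0 xn].
    rewrite -EFinM lee_fin /envelope; case: ifPn => [_|].
      by rewrite powRM ?powR_ge0 // -!powRrM.
    (* At the endpoint [x = 1/n] the second branch is selected; both branches have the value [n]
       there. *)
    rewrite -leNgt => nx.
    have -> : x = n%:R^-1.
      by apply/eqP; rewrite eq_le xn /= -div1r ler_pdivrMr // mulrC.
    rewrite -powR_inv1 ?(ltW nr0) // -!powRrM -powR_add //.
    by rewrite le_eqVlt; apply/orP; left; apply/eqP; congr powR; ring.
  rewrite (le_trans H1) // ge0_integralZl_EFin ?powR_ge0 //; last 2 first.
  - by move=> x _; rewrite lee_fin powR_ge0.
  - by apply: measurable_funTS; exact: measurable_powR_ereal.
  have H2 : (\int[mu]_(x in `[0%R, (n%:R^-1)%R]) (x `^ ((al - 1) * r))%:E <=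
      ((n%:R^-1) `^ ((al - 1) * r + 1) / ((al - 1) * r + 1))%:E)%E.
    by apply: integral_powR0_le; rewrite ?invr_gt0.
  have H3 := @lee_wpmul2l _ (n%:R `^ (al * r))%:E _ _ _ H2.
  rewrite (le_trans (H3 _)) ?lee_fin ?powR_ge0 //.
  rewrite -powR_inv1 ?(ltW nr0) // -powRrM mulrA -powR_add // mulrC.
  rewrite ler_wpM2l ?invr_ge0 ?(ltW q0) //.
  by rewrite le_eqVlt; apply/orP; left; apply/eqP; congr powR; ring.
have E : (\int[mu]_(x in `[(n%:R^-1)%R, pi]) ((envelope al n x) `^ r)%:E =
          \int[mu]_(x in `[(n%:R^-1)%R, pi]) (x `^ (- r))%:E)%E.
  apply: eq_integral => x; rewrite inE /= in_itv /= => /andP[nx _].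
  rewrite /envelope ifF; last first.
    by apply/negbTE; rewrite -leNgt mulrC -ler_pdivrMr // div1r.
  by rewrite -powRrM mulN1r.
by rewrite E integral_powR_tail_le //; lra.
Qed.

End envelope_integral.

(** * The kernel as the sum of its Fourier series *)

Section fourier_coefficients.
Context {R : realType}.
Local Notation mu := (@lebesgue_measure R).
Local Notation I := (`[(- pi)%R, pi%R]%classic : set R).

Lemma Rintegral_cos_cos (j k : nat) (th c : R) : (0 < j)%N ->
  Rintegral mu I (fun x => cos (j%:R * x - th) * cos (k%:R * x + c)) =
  if j == k then pi * cos (th + c) else 0.
Proof.
move=> j0.
have ib (l : int) (d : R) : mu.-integrable I (EFin \o (fun x => cos (l%:~R * x + d))).
  by apply: continuous_integrable_itv; exact: continuous_affine_cos.
transitivity (Rintegral mu I (fun x => 2^-1 * cos ((j%:Z - k%:Z)%:~R * x + (- th - c)) +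
                                  2^-1 * cos ((j%:Z + k%:Z)%:~R * x + (- th + c)))).
  congr Rintegral; apply/funext => x.
  have -> : (j%:Z - k%:Z)%:~R * x + (- th - c) = (j%:R * x - th) - (k%:R * x + c).
    by rewrite intrB -!pmulrn; ring.
  have -> : (j%:Z + k%:Z)%:~R * x + (- th + c) = (j%:R * x - th) + (k%:R * x + c).
    by rewrite intrD -!pmulrn; ring.
  by move: (j%:R * x - th) (k%:R * x + c) => A B; rewrite cosB cosD; field.
rewrite RintegralD //; [|exact: integrable_scale|exact: integrable_scale].
rewrite !RintegralZl // !Rintegral_cos.
have -> : (j%:Z + k%:Z == 0) = false by rewrite -PoszD; case: j j0.
rewrite mulr0 addr0 subr_eq0 eqz_nat; case: eqP => _; last by rewrite mulr0.
have -> : - th - c = - (th + c) by ring.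
by rewrite cosN; field.
Qed.

Lemma bounded_measurable_block (a : nat -> R) (th : R) (n m : nat) :
  bounded_measurable (cos_block a th n m).
Proof.
apply: bounded_measurable_sum => k; apply: bounded_measurableM.
  exact: bounded_measurable_cst.
exact: bounded_measurable_cos.
Qed.

Lemma Rintegral_sum {T : eqType} (s : seq T) (f : T -> R -> R) :
  (forall i, mu.-integrable I (EFin \o f i)) ->
  Rintegral mu I (fun x => \sum_(i <- s) f i x) = \sum_(i <- s) Rintegral mu I (f i).
Proof.
move=> fi; elim: s => [|i s IH].
  rewrite big_nil /Rintegral integral0_eq // => x _; by rewrite big_nil.
transitivity (Rintegral mu I (fun x => f i x + \sum_(j <- s) f j x)).
  by congr Rintegral; apply/funext => x; rewrite big_cons.
rewrite big_cons -IH RintegralD //.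
rewrite (_ : _ \o _ = (fun x => \sum_(j <- s) (EFin \o f j) x)%E); last first.
  by apply/funext => x /=; rewrite sumEFin.
by apply: integrable_sum.
Qed.

Lemma Rintegral_block (a : nat -> R) (th c : R) (n m k : nat) : (0 < n)%N ->
  Rintegral mu I (fun x => cos_block a th n m x * cos (k%:R * x + c)) =
  if (n <= k < m)%N then a k * (pi * cos (th + c)) else 0.
Proof.
move=> n0.
have ib (j : nat) : mu.-integrable I (EFin \o (fun x => cos (j%:R * x - th) * cos (k%:R * x + c))).
  apply: bounded_integrable_itv; apply: bounded_measurableM; exact: bounded_measurable_cos.
transitivity (Rintegral mu I (fun x => \sum_(j <- index_iota n m) a j * (cos (j%:R * x - th) * cos (k%:R * x + c)))).
  congr Rintegral; apply/funext => x; rewrite /cos_block big_distrl /=.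
  by apply: eq_bigr => j _; rewrite mulrA.
rewrite Rintegral_sum; last by move=> j; exact: integrable_scale.
transitivity (\sum_(n <= j < m | j == k) a j * (pi * cos (th + c))).
  rewrite [RHS]big_mkcond /= !big_nat; apply: eq_bigr => j /andP[nj _].
  rewrite RintegralZl // Rintegral_cos_cos ?(leq_trans n0) //.
  by case: ifP => _; rewrite ?mulr0.
by rewrite big_nat1_eq.
Qed.

End fourier_coefficients.

(** * Convergence and coefficients of the cosine series *)

Section kernel.
Context {R : realType}.
Local Notation mu := (@lebesgue_measure R).
Local Notation I := (`[(- pi)%R, pi%R]%classic : set R).
Variables (a : nat -> R) (th : R) (G : nat -> R -> R).
Hypothesis a_dec : forall k, (0 < k)%N -> a k.+1 <= a k.
Hypothesis a_ge0 : forall k, (0 < k)%N -> 0 <= a k.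
Hypothesis a_cvg0 : a @ \oo --> (0 : R).
Hypothesis block_le : forall n m (x : R), (0 < n)%N -> x != 0 -> `|x| <= pi ->
  `|cos_block a th n m x| <= G n x.
Hypothesis iG : mu.-integrable I (EFin \o G 1%N).

(* The upper limit makes measurability immediate; the series converges off
   [2 pi Z], see [cvg_block]. *)
Definition kernel_sum (x : R) : R :=
  fine (limn_esup (fun N => (cos_block a th 1 N x)%:E)).

Lemma block_periodic n m (x : R) : cos_block a th n m (x + 2 * pi) = cos_block a th n m x.
Proof. by apply: eq_bigr => k _; rewrite cosDn2pi. Qed.

Lemma kernel_sum_periodic (x : R) : kernel_sum (x + 2 * pi) = kernel_sum x.
Proof. by rewrite /kernel_sum; under eq_fun do rewrite block_periodic. Qed.

Lemma measurable_kernel_sum : measurable_fun setT kernel_sum.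
Proof.
apply: (measurableT_comp (fine_measurable measurableT)) => //.
apply: measurable_fun_limn_esup => N; apply/measurable_EFinP.
by have [] := bounded_measurable_block a th 1 N.
Qed.

(** Cauchy's criterion: blocks starting at [n] are at most [4 a n / |x|], and [a n] tends to 0. *)
Lemma cvg_block (x : R) : x != 0 -> `|x| <= pi ->
  cos_block a th 1 N x @[N --> \oo] --> kernel_sum x.
Proof.
move=> x0 xp.
have y0 : 0 < `|x| by rewrite normr_gt0.
have cv : cvgn (fun N => cos_block a th 1 N x).
  (* [series] starts at index 0 and the block at 1, and nothing is assumed on [a 0]; hence the zero
     term. *)
  pose u k := if k == 0%N then 0 else a k * cos (k%:R * x - th).
  have uE : (fun N => cos_block a th 1 N x) = series u.
    apply/funext => -[|N]; first by rewrite /cos_block /series /= !big_geq.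
    rewrite /cos_block /series /= [RHS]big_ltn // {1}/u eqxx add0r !big_nat.
    by apply: eq_bigr => k /andP[k0 _]; rewrite /u gtn_eqF.
  rewrite uE; apply/cauchy_cvgP/cauchy_seriesP => e e0.
  have : \forall n \near \oo, `|a n| < e * `|x| / 4.
    move/cvgrPdist_lt : a_cvg0 => /(_ (e * `|x| / 4)).
    rewrite divr_gt0 ?mulr_gt0 // => /(_ isT).
    by apply: filterS => n; rewrite sub0r normrN.
  move=> [n0 _ Hn0].
  exists ([set n | (n0 < n)%N], setT) => /=.
    by split; [exists n0.+1|exact: filterT].
  move=> [n m] /= [n0n _].
  have npos : (0 < n)%N by exact: leq_ltn_trans n0n.
  have -> : \sum_(n <= k < m) u k = cos_block a th n m x.
    by rewrite /cos_block !big_nat; apply: eq_bigr => k /andP[nk _]; rewrite /u gtn_eqF // (leq_trans npos).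
  have H := Hn0 n (ltnW n0n).
  rewrite (le_lt_trans (cos_block_abel a th n m x _ _ x0 xp)) //.
  - by move=> k nk; apply: a_dec; exact: leq_trans nk.
  - by move=> k nk; apply: a_ge0; exact: leq_trans nk.
  rewrite ltr_pdivrMr //; move: H => /= H.
  have := ler_norm (a n); lra.
have E : kernel_sum x = limn (fun N => cos_block a th 1 N x).
  rewrite /kernel_sum is_cvg_limn_esupE; last first.
    by apply/cvg_ex; exists (limn (fun N => cos_block a th 1 N x))%:E; apply: cvg_EFin => //; exact: nearW.
  by rewrite EFin_lim.
by rewrite E.
Qed.

Lemma kernel_tail_le n (x : R) : (0 < n)%N -> x != 0 -> `|x| <= pi ->
  `|kernel_sum x - cos_block a th 1 n x| <= G n x.
Proof.
move=> n0 x0 xp.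
have H : `|cos_block a th 1 N x - cos_block a th 1 n x| @[N --> \oo] --> `|kernel_sum x - cos_block a th 1 n x|.
  by apply: cvg_norm; apply: cvgB; [exact: cvg_block|exact: cvg_cst].
rewrite -(cvg_lim _ H) //; apply: limr_le; first by apply/cvg_ex; eexists; exact: H.
exists n => // N /= nN.
by rewrite (cos_block_cat a th 1 N n) // addrC addKr block_le.
Qed.

(** All partial sums start at frequency 1, so the single integrable majorant [G 1] permits termwise
    integration against [q]. *)
Lemma dominated_kernel (q : R -> R) : bounded_measurable q ->
  mu.-integrable I (fun x => (kernel_sum x * q x)%:E) /\
  (\int[mu]_(x in I) (cos_block a th 1 N x * q x)%:E @[N --> \oo] -->
   \int[mu]_(x in I) (kernel_sum x * q x)%:E)%E.
Proof.
move=> [mq [M qM]].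
have M0 : 0 <= M by exact: le_trans (normr_ge0 _) (qM 0).
pose f_ N x := (cos_block a th 1 N x * q x)%:E.
have mf_ N : measurable_fun I (f_ N).
  apply: measurable_funTS; apply/measurable_EFinP; apply: measurable_funM => //.
  by have [] := bounded_measurable_block a th 1 N.
have mf : measurable_fun I (fun x => (kernel_sum x * q x)%:E).
  apply: measurable_funTS; apply/measurable_EFinP; apply: measurable_funM => //.
  exact: measurable_kernel_sum.
have neg0 : {ae mu, forall x : R, x != 0}.
  apply: (negligibleS _ (negligible_set1 0)) => x /= /negP; rewrite negbK => /eqP //.
have cvf : {ae mu, forall x, I x -> f_ ^~ x @ \oo --> (kernel_sum x * q x)%:E}.
  apply: (ae_imp _ _ neg0) => x x0 /=; rewrite in_itv /= => /andP[x1 x2].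
  apply: cvg_EFin; first exact: nearW.
  apply: cvgM; last exact: cvg_cst.
  by apply: cvg_block => //; rewrite ler_norml x1.
have ig' : mu.-integrable I (EFin \o (fun x => M * G 1%N x)) by exact: integrable_scale.
have dom : {ae mu, forall x n, I x -> `|f_ n x| <= (M * G 1%N x)%:E}%E.
  apply: (ae_imp _ _ neg0) => x x0 n /=; rewrite in_itv /= => /andP[x1 x2].
  rewrite lee_fin normrM mulrC ler_pM //.
  by apply: block_le => //; rewrite ler_norml x1.
by have [? _ ?] := @dominated_convergence _ _ _ mu I (measurable_itv _) _ _ _ mf_ mf cvf ig' dom.
Qed.

Lemma integrable_kernel_sum : mu.-integrable I (EFin \o kernel_sum).
Proof.
have [H _] := dominated_kernel _ (bounded_measurable_cst 1).
by rewrite (_ : _ \o _ = (fun x => (kernel_sum x * 1)%:E)) //; apply/funext => x; rewrite mulr1.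
Qed.

(** By orthogonality the integrals of the partial sums are constant as soon as [N > k]. The free
    phase [c] covers cosine and sine coefficients at once. *)
Lemma kernel_sum_coef (k : nat) (c : R) :
  Rintegral mu I (fun x => kernel_sum x * cos (k%:R * x + c)) =
  if (0 < k)%N then a k * (pi * cos (th + c)) else 0.
Proof.
have bc := @bounded_measurable_cos R k%:R c.
have [ik cv] := dominated_kernel _ bc.
set L := RHS.
rewrite /Rintegral -[RHS]/(fine L%:E); congr fine.
apply: (cvg_unique _ cv) => //; apply: cvg_near_cst.
exists k.+1 => // N /= kN.
rewrite -[LHS]fineK; last first.
  apply: (@integrable_fin_num _ _ _ mu I) => //.
  apply: (bounded_integrable_itv _ _ (fun x => _)).
  by apply: bounded_measurableM => //; exact: bounded_measurable_block.
by congr EFin; have /= := Rintegral_block a th c 1 N k isT; rewrite /Rintegral kN andbT => ->.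
Qed.

End kernel.

(** * The series as an instance of [is_Psi], and its comparison with any other instance *)

Section psi_kernel.
Context {R : realType}.
Local Notation mu := (@lebesgue_measure R).
Local Notation I := (`[(- pi)%R, pi%R]%classic : set R).
Variables (psi : R -> R) (beta : R) (G : nat -> R -> R).
Let a (k : nat) := psi k%:R.
Let th := beta * pi / 2.
Hypothesis a_dec : forall k, (0 < k)%N -> a k.+1 <= a k.
Hypothesis a_ge0 : forall k, (0 < k)%N -> 0 <= a k.
Hypothesis a_cvg0 : a @ \oo --> (0 : R).
Hypothesis block_le : forall n m (x : R), (0 < n)%N -> x != 0 -> `|x| <= pi ->
  `|cos_block a th n m x| <= G n x.
Hypothesis iG : mu.-integrable I (EFin \o G 1%N).

Lemma sin_shift (y : R) : sin y = cos (y + - (pi / 2)).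
Proof. by rewrite -cosBpihalf. Qed.

(** This existence statement makes the class nonempty: the supremum in [bestE] over an empty class
    would be [-oo], so the lower bound rests on it. *)
Lemma is_Psi_kernel_sum : is_Psi psi beta (kernel_sum a th).
Proof.
have coef := kernel_sum_coef a th G a_dec a_ge0 a_cvg0 block_le iG.
have pi0 : (pi : R) != 0 by rewrite gt_eqF // pi_gt0.
split; first exact: kernel_sum_periodic.
split; first exact: measurable_kernel_sum.
split; first exact: (integrable_kernel_sum a th G).
split=> [k|k k0].
  have -> : (fun t => kernel_sum a th t * cos (k%:R * t)) = (fun t => kernel_sum a th t * cos (k%:R * t + 0)).
    by apply/funext => t; rewrite addr0.
  rewrite coef; case: k => [|k] /=; first by rewrite mulr0.
  by rewrite addr0 mulrCA mulKf.
have -> : (fun t => kernel_sum a th t * sin (k%:R * t)) = (fun t => kernel_sum a th t * cos (k%:R * t + - (pi / 2))).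
  by apply/funext => t; rewrite sin_shift.
by rewrite coef k0 -sin_shift mulrCA mulKf.
Qed.

Lemma is_Psi_coef (Psi : R -> R) (k : nat) (c : R) : is_Psi psi beta Psi ->
  Rintegral mu I (fun x => Psi x * cos (k%:R * x + c)) =
  if (0 < k)%N then a k * (pi * cos (th + c)) else 0.
Proof.
move=> [per [mPsi [iPsi [hc hs]]]].
have pi0 : (pi : R) != 0 by rewrite gt_eqF // pi_gt0.
have bc : bounded_measurable (fun x : R => cos (k%:R * x)).
  by have := @bounded_measurable_cos R k%:R 0; under eq_fun do rewrite addr0.
have bs : bounded_measurable (fun x : R => sin (k%:R * x)).
  by have := @bounded_measurable_sin R k%:R 0; under eq_fun do rewrite addr0.
have ic : mu.-integrable I (EFin \o (fun x => Psi x * cos (k%:R * x))) by exact: integrable_mul_bounded.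
have is_ : mu.-integrable I (EFin \o (fun x => Psi x * sin (k%:R * x))) by exact: integrable_mul_bounded.
transitivity (Rintegral mu I (fun x => cos c * (Psi x * cos (k%:R * x)) + (- sin c) * (Psi x * sin (k%:R * x)))).
  by congr Rintegral; apply/funext => x; rewrite cosD; ring.
rewrite RintegralD //; [|exact: integrable_scale|exact: integrable_scale].
rewrite !RintegralZl //.
have C : Rintegral mu I (fun x => Psi x * cos (k%:R * x)) = pi * (if k == 0%N then 0 else psi k%:R * cos (beta * pi / 2)).
  by rewrite -hc mulrA divff // mul1r.
have S : Rintegral mu I (fun x => Psi x * sin (k%:R * x)) = if (0 < k)%N then pi * (psi k%:R * sin (beta * pi / 2)) else 0.
  case: ifPn => [k0|]; first by rewrite -hs // mulrA divff // mul1r.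
  rewrite -eqn0Ngt => /eqP ->; rewrite /Rintegral integral0_eq // => x _.
  by rewrite mul0r sin0 mulr0.
rewrite C S; case: k {hc hs bc bs ic is_ C S} => [|k] /=; first by rewrite !mulr0 addr0.
by rewrite cosD /a /th; ring.
Qed.

(** [Psi - kernel_sum] has zero coefficients, hence vanishes almost everywhere. Coefficients see
    [Psi] only up to a null set, so the bound is an almost-everywhere one. *)
Lemma is_Psi_tail_le (Psi : R -> R) (n : nat) : is_Psi psi beta Psi -> (0 < n)%N ->
  {ae mu, forall x, I x -> `|Psi x - cos_block a th 1 n x| <= G n x}.
Proof.
move=> hPsi n0.
have hK := is_Psi_kernel_sum.
have [per [mPsi [iPsi _]]] := hPsi.
have [perK [mK [iK _]]] := hK.
pose g x := Psi x - kernel_sum a th x.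
have mg : measurable_fun setT g by exact: measurable_funB.
have ig : mu.-integrable I (EFin \o g).
  rewrite (_ : EFin \o g = (EFin \o Psi) \- (EFin \o kernel_sum a th))%E; last first.
    by apply/funext => x /=; rewrite EFinB.
  exact: integrableB.
have g0 k c : Rintegral mu I (fun x => g x * cos (k%:R * x + c)) = 0.
  have bc := @bounded_measurable_cos R k%:R c.
  transitivity (Rintegral mu I (fun x => Psi x * cos (k%:R * x + c) - kernel_sum a th x * cos (k%:R * x + c))).
    by congr Rintegral; apply/funext => x; rewrite /g mulrBl.
  rewrite RintegralB //; [|exact: integrable_mul_bounded|exact: integrable_mul_bounded].
  by rewrite !is_Psi_coef // subrr.
have gc k : Rintegral mu I (fun x => g x * cos (k%:R * x)) = 0.
  by rewrite -[RHS](g0 k 0); congr Rintegral; apply/funext => x; rewrite addr0.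
have gs k : Rintegral mu I (fun x => g x * sin (k%:R * x)) = 0.
  by rewrite -[RHS](g0 k (- (pi / 2))); congr Rintegral; apply/funext => x; rewrite sin_shift.
have neg0 : {ae mu, forall x : R, x != 0}.
  apply: (negligibleS _ (negligible_set1 0)) => x /= /negP; rewrite negbK => /eqP //.
apply: (ae_imp2 _ _ _ (fourier_uniqueness g mg ig gc gs) neg0) => x gx x0 Ix.
have -> : Psi x = kernel_sum a th x by apply/eqP; rewrite -subr_eq0; apply/eqP; exact: gx.
apply: kernel_tail_le => //.
by move: Ix => /=; rewrite in_itv /= ler_norml.
Qed.

End psi_kernel.

(** * Convolutions over a period *)

Section fubini_on.
Context {R : realType}.
Local Notation mu := (@lebesgue_measure R).
Local Notation T := (measurableTypeR R).
Variables (A B : set T) (f : T * T -> \bar R).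
Hypotheses (mA : measurable A) (mB : measurable B) (mf : measurable_fun setT f).

(** Extension by zero off the product reduces integrals over [A] and [B] to integrals over the whole
    plane. *)
Let h := f \_ (A `*` B).

Let mh : measurable_fun setT h.
Proof.
exact: (measurable_restrictT f (measurableX mA mB)).1 (measurable_funTS mf).
Qed.

Let hE (x t : T) : h (x, t) = if x \in A then ((fun t => f (x, t)) \_ B) t else 0%E.
Proof.
rewrite /h patchE; have [xA|xA] := boolP (x \in A).
  rewrite patchE; have [tB|tB] := boolP (t \in B).
    by rewrite mem_set //; split; exact: set_mem.
  by rewrite memNset // => -[_ /= /mem_set]; apply/negP.
by rewrite memNset // => -[/= /mem_set + _]; apply/negP.
Qed.

Let int_h (x : T) : (\int[mu]_t h (x, t) = ((fun x => \int[mu]_(t in B) f (x, t)) \_ A) x)%E.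
Proof.
rewrite patchE; case: ifPn => xA.
  by rewrite [RHS]integral_mkcond; apply: eq_integral => t _; rewrite hE xA.
by rewrite integral0_eq // => t _; rewrite hE (negbTE xA).
Qed.

Let int_h' (t : T) : (\int[mu]_x h (x, t) = ((fun t => \int[mu]_(x in A) f (x, t)) \_ B) t)%E.
Proof.
rewrite patchE; case: ifPn => tB.
  rewrite [RHS]integral_mkcond; apply: eq_integral => x _.
  by rewrite hE !patchE tB.
by rewrite integral0_eq // => x _; rewrite hE patchE (negbTE tB) if_same.
Qed.

Lemma tonelli_on : (forall z, 0 <= f z)%E ->
  (\int[mu]_(x in A) \int[mu]_(t in B) f (x, t) = \int[mu]_(t in B) \int[mu]_(x in A) f (x, t))%E.
Proof.
move=> f0; rewrite [LHS]integral_mkcond [RHS]integral_mkcond.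
have h0 z : (0 <= h z)%E by rewrite /h patchE; case: ifP.
transitivity (\int[mu]_x \int[mu]_t h (x, t))%E.
  by apply: eq_integral => x _; rewrite -int_h.
rewrite (@fubini_tonelli _ _ T T R mu mu h mh h0).
by apply: eq_integral => t _; rewrite -int_h'.
Qed.

Hypothesis fin : (\int[mu]_(t in B) \int[mu]_(x in A) `|f (x, t)| < +oo)%E.

Let ih : (mu \x mu)%E.-integrable setT h.
Proof.
apply/(integrable21ltyP _ _ mh); apply: le_lt_trans fin.
rewrite [leRHS]integral_mkcond le_eqVlt; apply/orP; left; apply/eqP.
apply: eq_integral => t _; rewrite patchE; case: ifPn => tB.
  rewrite [RHS]integral_mkcond; apply: eq_integral => x _.
  by rewrite hE !patchE tB; case: ifP => _ //; rewrite abse0.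
by rewrite integral0_eq // => x _; rewrite hE patchE (negbTE tB) if_same abse0.
Qed.

Lemma fubini_on_ae : {ae mu, forall x, A x -> mu.-integrable B (fun t => f (x, t))}.
Proof.
have := ae_integrable1 ih; apply: negligibleS => x /= nH H; apply: nH => /mem_set xA.
apply/(integrable_mkcond _ mB); move: H.
by rewrite (_ : (fun t => h (x, t)) = (fun t => f (x, t)) \_ B) //; apply/funext => t; rewrite hE xA.
Qed.

Lemma fubini_on_integrable : mu.-integrable A (fun x => \int[mu]_(t in B) f (x, t))%E.
Proof.
apply/(integrable_mkcond _ mA); have := integrable_fubini_F ih.
by rewrite (_ : fubini_F _ _ = (fun x => \int[mu]_(t in B) f (x, t))%E \_ A) //; apply/funext => x; rewrite -int_h.
Qed.

Lemma fubini_on :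
  (\int[mu]_(x in A) \int[mu]_(t in B) f (x, t) = \int[mu]_(t in B) \int[mu]_(x in A) f (x, t))%E.
Proof.
rewrite [LHS]integral_mkcond [RHS]integral_mkcond.
transitivity (\int[mu \x mu]_z h z)%E.
  rewrite -(integral12_prod_meas1 ih); apply: eq_integral => x _; by rewrite -int_h.
rewrite -(integral21_prod_meas1 ih); apply: eq_integral => x _; by rewrite -int_h'.
Qed.

End fubini_on.

Section measurable_integral_on.
Context {R : realType}.
Local Notation mu := (@lebesgue_measure R).
Local Notation T := (measurableTypeR R).

Lemma measurable_integral_on1 (A : set T) (f : T * T -> \bar R) : measurable A ->
  measurable_fun setT f -> (forall z, 0 <= f z)%E ->
  measurable_fun setT (fun t => \int[mu]_(x in A) f (x, t))%E.
Proof.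
move=> mA mf f0; pose h := f \_ (A `*` setT).
have mh : measurable_fun setT h.
  exact: (measurable_restrictT f (measurableX mA measurableT)).1 (measurable_funTS mf).
have h0 z : (0 <= h z)%E by rewrite /h patchE; case: ifP.
have := @measurable_fun_fubini_tonelli_G _ _ T T R mu h mh h0.
congr measurable_fun; apply/funext => t; rewrite /fubini_G [RHS]integral_mkcond.
apply: eq_integral => x _; rewrite /h !patchE; congr (if _ then _ else _).
by rewrite in_setX in_setT andbT.
Qed.

Lemma measurable_integral_on2 (B : set T) (f : T * T -> \bar R) : measurable B ->
  measurable_fun setT f -> (forall z, 0 <= f z)%E ->
  measurable_fun setT (fun x => \int[mu]_(t in B) f (x, t))%E.
Proof.
move=> mB mf f0; apply: (measurable_integral_on1 B (f \o (fun z => (z.2, z.1)))) => //; last by move=> z; exact: f0.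
by apply: (measurableT_comp mf); apply: measurable_fun_pair; [exact: measurable_snd|exact: measurable_fst].
Qed.

End measurable_integral_on.

Section hoelder_on.
Context {R : realType}.
Local Notation mu := (@lebesgue_measure R).

Lemma hoelder_on (D : set R) (u v : R -> R) (r q : R) : measurable D ->
  measurable_fun setT u -> measurable_fun setT v -> 0 < r -> 0 < q -> r^-1 + q^-1 = 1 ->
  (\int[mu]_(x in D) (`|u x * v x|)%:E <=
   (\int[mu]_(x in D) (`|u x| `^ r)%:E) `^ r^-1 * (\int[mu]_(x in D) (`|v x| `^ q)%:E) `^ q^-1)%E.
Proof.
move=> mD mu_ mv r0 q0 rq.
have mR (w : R -> R) : measurable_fun setT w -> measurable_fun setT (w \_ D).
  by move=> mw; exact: ((measurable_restrictT w mD).1 (measurable_funTS mw)).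
have := @hoelder _ _ _ mu (u \_ D) (v \_ D) r q (mR _ mu_) (mR _ mv) r0 q0 rq.
rewrite Lnorm1 unlock /=.
have E (s : R) (w : R -> R) : 0 < s -> (\int[mu]_x ((`|(w \_ D) x| `^ s)%:E) = \int[mu]_(x in D) (`|w x| `^ s)%:E)%E.
  move=> s0; rewrite [RHS]integral_mkcond; apply: eq_integral => x _.
  by rewrite !patchE; case: ifP => // _; rewrite normr0 powR0 // gt_eqF.
rewrite !E // => H; apply: le_trans H.
rewrite integral_mkcond le_eqVlt; apply/orP; left; apply/eqP.
apply: eq_integral => x _ /=; rewrite !patchE; case: ifP => // _.
by rewrite mulr0 normr0.
Qed.

End hoelder_on.

(** * Young's inequality for convolutions over a period *)

Section convolution.
Context {R : realType}.
Local Notation mu := (@lebesgue_measure R).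
Local Notation T := (measurableTypeR R).
Local Notation I := (`[(- pi)%R, pi%R]%classic : set R).
Variables g phi : R -> R.
Hypothesis pg : periodic2pi g.
Hypothesis mg : measurable_fun setT g.
Hypothesis mphi : measurable_fun setT phi.

Lemma measurable_convolution_integrand :
  measurable_fun [set: T * T] (fun z : T * T => g (z.1 - z.2) * phi z.2).
Proof.
apply: measurable_funM; last by apply: (measurableT_comp mphi); exact: measurable_snd.
by apply: (measurableT_comp mg); apply: measurable_funB; [exact: measurable_fst|exact: measurable_snd].
Qed.

Lemma integral_convolution_comp (F : R -> \bar R) (s t : R) : measurable_fun setT F ->
  (\int[mu]_(x in `[s, (s + 2 * pi)%R]) F (g (x - t)%R) = \int[mu]_(x in I) F (g x))%E.
Proof.
move=> mF; apply: (integral_period_shift (F \o g)) => [|x]; first exact: measurableT_comp.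
by rewrite /= pg.
Qed.

Hypothesis ig : mu.-integrable I (EFin \o g).
Hypothesis iphi : mu.-integrable I (EFin \o phi).

Let conv_ereal (q : R -> R) : measurable_fun setT q ->
  measurable_fun [set: T * T] (fun z : T * T => (g (z.1 - z.2) * phi z.2 * q z.1)%:E).
Proof.
move=> mq; apply/measurable_EFinP; apply: measurable_funM.
  exact: measurable_convolution_integrand.
by apply: (measurableT_comp mq); exact: measurable_fst.
Qed.

(** Integrated first in [x], the shifted [|g|] gives its integral over a period whatever [t] is, and
    integrability of [phi] finishes. The start [s] is free because both [[-pi, pi]] (coefficients)
    and [[0, 2 pi]] (norms) occur. *)
Lemma convolution_abs_lty (s : R) (q : R -> R) : bounded_measurable q ->
  (\int[mu]_(t in I) \int[mu]_(x in `[s, (s + 2 * pi)%R]) `|(g (x - t) * phi t * q x)%:E| < +oo)%E.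
Proof.
move=> [mq [M qM]].
have M0 : 0 <= M by exact: le_trans (normr_ge0 _) (qM 0).
have [N N0 NE] : exists2 N : R, 0 <= N & (\int[mu]_(x in I) (`|g x|%R)%:E = N%:E)%E.
  exists (fine (\int[mu]_(x in I) (`|g x|%R)%:E)); first by apply: fine_ge0; apply: integral_ge0 => x _; rewrite lee_fin.
  rewrite fineK //; apply: (@integrable_fin_num _ _ _ mu I) => //.
  exact: (@integrable_norm _ _ _ mu I g).
have mn : measurable_fun setT (fun y : R => (`|y|%R)%:E).
  by apply/measurable_EFinP; exact: normr_measurable.
have mq' := conv_ereal q mq.
apply: (@le_lt_trans _ _ (\int[mu]_(t in I) (M * N * `|phi t|)%:E)%E); last first.
  have := @integrable_norm _ _ _ mu I phi iphi.
  move=> /(integrable_scale I _ (M * N) (measurable_itv _)) /integrableP[_].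
  apply: le_lt_trans; apply: ge0_le_integral => //.
  - by move=> t _; rewrite lee_fin !mulr_ge0.
  - apply: measurable_funTS; apply/measurable_EFinP; apply: measurable_funM => //.
    by apply: measurableT_comp.
  - apply: measurable_funTS; apply: measurableT_comp => //; apply/measurable_EFinP.
    apply: measurable_funM => //; exact: measurableT_comp.
  - by move=> t _ /=; rewrite lee_fin ler_norm.
apply: ge0_le_integral => //.
- by move=> t _; apply: integral_ge0.
- apply: measurable_funTS.
  apply: (measurable_integral_on1 _ (fun z => `|(g (z.1 - z.2) * phi z.2 * q z.1)%:E|%E)) => //.
  exact: measurableT_comp.
- apply: measurable_funTS; apply/measurable_EFinP; apply: measurable_funM => //.
  by apply: measurableT_comp.
move=> t _.
apply: (@le_trans _ _ (\int[mu]_(x in `[s, (s + 2 * pi)%R]) ((M * `|phi t|)%:E * (`|g (x - t)|%R)%:E))%E).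
  have mgt : measurable_fun setT (fun x : R => g (x - t)).
    by apply: (measurableT_comp mg); apply: measurable_funB.
  apply: ge0_le_integral => //.
  - apply: measurable_funTS; apply: measurableT_comp => //; apply/measurable_EFinP.
    by apply: measurable_funM => //; apply: measurable_funM.
  - apply: measurable_funTS; apply: emeasurable_funM => //; apply/measurable_EFinP.
    exact: measurableT_comp.
  move=> x _ /=; rewrite lee_fin !normrM.
  have := qM x; have := normr_ge0 (g (x - t)); have := normr_ge0 (phi t) => p1 p2 p3.
  rewrite mulrC -mulrA [`|phi t| * _]mulrC.
  by apply: ler_pM => //; exact: mulr_ge0.
rewrite ge0_integralZl_EFin ?mulr_ge0 //; last first.
  apply: measurable_funTS; apply/measurable_EFinP; apply: measurableT_comp => //.
  by apply: (measurableT_comp mg); apply: measurable_funB.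
rewrite (integral_convolution_comp (fun y : R => (`|y|%R)%:E)) // NE -EFinM lee_fin.
by rewrite mulrAC.
Qed.

Lemma convolution_ae (s : R) :
  {ae mu, forall x, x \in `[s, s + 2 * pi] -> mu.-integrable I (fun t => (g (x - t) * phi t)%:E)}.
Proof.
have H := fubini_on_ae `[s, (s + 2 * pi)%R] I _ (measurable_itv _) (measurable_itv _)
  (conv_ereal (fun=> 1) (bounded_measurable_cst 1).1) (convolution_abs_lty s _ (bounded_measurable_cst 1)).
apply: (ae_imp _ _ H) => x /= Hx xs; have := Hx xs.
rewrite (_ : (fun t => _) = (fun t => (g (x - t) * phi t)%:E)) //.
by apply/funext => t; rewrite mulr1.
Qed.

Lemma convolution_integrable (q : R -> R) : bounded_measurable q ->
  mu.-integrable I (fun x => \int[mu]_(t in I) (g (x - t) * phi t * q x)%:E)%E.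
Proof.
move=> bq; have [mq _] := bq.
have H := convolution_abs_lty (- pi) _ bq; rewrite (_ : - pi + 2 * pi = pi) in H; last by ring.
exact: (fubini_on_integrable I I _ (measurable_itv _) (measurable_itv _) (conv_ereal _ mq) H).
Qed.

Lemma convolution_pairing (q : R -> R) : bounded_measurable q ->
  (\int[mu]_(x in I) \int[mu]_(t in I) (g (x - t) * phi t * q x)%:E =
   \int[mu]_(t in I) \int[mu]_(x in I) (g (x - t) * phi t * q x)%:E)%E.
Proof.
move=> bq; have [mq _] := bq.
have H := convolution_abs_lty (- pi) _ bq; rewrite (_ : - pi + 2 * pi = pi) in H; last by ring.
exact: (fubini_on I I _ (measurable_itv _) (measurable_itv _) (conv_ereal _ mq) H).
Qed.

Hypothesis phi1 : (\int[mu]_(t in I) (`|phi t|)%:E <= 1)%E.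

Let mshift (x : R) : measurable_fun setT (fun t : R => g (x - t)).
Proof. by apply: (measurableT_comp mg); apply: measurable_funB. Qed.

Lemma young_oo (M x w : R) : 0 <= M -> {ae mu, forall t, I t -> `|g t| <= M} ->
  w%:E = (\int[mu]_(t in I) (g (x - t) * phi t)%:E)%E -> `|w| <= M.
Proof.
move=> M0 gM wE; rewrite -lee_fin -[`|w|%:E]/(`|w%:E|)%E wE.
have mgp : measurable_fun setT (fun t : R => (g (x - t) * phi t)%:E).
  by apply/measurable_EFinP; exact: measurable_funM.
apply: le_trans (le_abse_integral _ _ _) _; [exact: measurable_itv|exact: measurable_funTS|].
(* The bound [|g| <= M] holds almost everywhere on one period and has to be carried to
   [t => g (x - t)]. The excess [u] has integral 0, this integral is invariant under reflection, and
   a nonnegative function of integral 0 vanishes almost everywhere. *)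
pose u t := Num.max (`|g t| - M) 0.
have mu_ : measurable_fun setT u.
  by apply: measurable_maxr => //; apply: measurable_funB => //; exact: measurableT_comp.
have u0 t : 0 <= u t by rewrite /u le_max lexx orbT.
have iu : (\int[mu]_(t in I) (u t)%:E = 0)%E.
  rewrite -(integral0 mu I); apply: ae_eq_integral => //.
  - by apply: measurable_funTS; apply/measurable_EFinP.
  - apply: (ae_imp _ _ gM) => t /= gt It; congr EFin.
    by apply/max_idPr; rewrite subr_le0 gt.
have iux : (\int[mu]_(t in I) (u (x - t))%:E = 0)%E.
  rewrite -[RHS]iu; apply: (integral_period_reflect (EFin \o u)); first by apply/measurable_EFinP.
  by move=> y; rewrite /= /u pg.
have mux : measurable_fun setT (fun t : R => u (x - t)).
  by apply: (measurableT_comp mu_); apply: measurable_funB.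
have aeu : {ae mu, forall t, I t -> `|g (x - t)| <= M}.
  have := (@ae_eq_integral_abs _ _ _ mu I (measurable_itv _) (fun t => (u (x - t))%:E) _).1.
  move=> /(_ (measurable_funTS ((measurable_EFinP _ _).2 mux))) H.
  have {}H := H _; apply: (ae_imp _ _ (H _)).
    rewrite -[RHS]iux; apply: eq_integral => t _; by rewrite gee0_abs // lee_fin.
  move=> t /= ut It; have [] := ut It.
  by rewrite /u => /eqP; rewrite eq_maxr subr_le0.
apply: (@le_trans _ _ (\int[mu]_(t in I) (M%:E * (`|phi t|)%:E))%E).
  apply: ae_ge0_le_integral => //.
  - by apply: measurable_funTS; exact: measurableT_comp.
  - by move=> t _; rewrite -EFinM lee_fin mulr_ge0.
  - apply: measurable_funTS; apply: emeasurable_funM => //; apply/measurable_EFinP.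
    exact: measurableT_comp.
  - apply: (ae_imp _ _ aeu) => t gt It.
    by rewrite -EFinM /= lee_fin normrM ler_wpM2r // gt.
rewrite ge0_integralZl_EFin //; last first.
  by apply: measurable_funTS; apply/measurable_EFinP; exact: measurableT_comp.
by have := lee_wpmul2l (_ : 0 <= M%:E)%E phi1; rewrite mule1 lee_fin; apply.
Qed.

(** Jensen's inequality for the weight [|phi|] of mass at most 1, obtained from Hoelder by splitting
    [|phi| = |phi|^(1/r) |phi|^(1/q)]. *)
Lemma young_pointwise (r x w : R) : 1 < r ->
  w%:E = (\int[mu]_(t in I) (g (x - t) * phi t)%:E)%E ->
  ((`|w| `^ r)%:E <= \int[mu]_(t in I) ((`|g (x - t)| `^ r) * `|phi t|)%:E)%E.
Proof.
move=> r1 wE; have r0 : 0 < r by lra.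
pose q := r / (r - 1).
have q0 : 0 < q by rewrite divr_gt0 //; lra.
have rq : r^-1 + q^-1 = 1 by rewrite /q; field; lra.
have mgp : measurable_fun setT (fun t : R => (g (x - t) * phi t)%:E).
  by apply/measurable_EFinP; exact: measurable_funM.
have mabs : measurable_fun setT (fun t : R => `|phi t|) by exact: measurableT_comp.
have mpow s : measurable_fun setT (fun t : R => `|phi t| `^ s).
  by apply: (measurableT_comp (measurable_powR s)).
have H := hoelder_on I (fun t => g (x - t) * `|phi t| `^ r^-1) (fun t => `|phi t| `^ q^-1) r q
  (measurable_itv _) (measurable_funM (mshift x) (mpow _)) (mpow _) r0 q0 rq.
have E1 : (\int[mu]_(t in I) (`|g (x - t) * `|phi t| `^ r^-1 * `|phi t| `^ q^-1|)%:E =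
           \int[mu]_(t in I) `|(g (x - t) * phi t)%:E|)%E.
  apply: eq_integral => t _ /=; rewrite !normrM; congr EFin.
  rewrite -mulrA !(ger0_norm (powR_ge0 _ _)); congr (_ * _).
  have [->|p0] := eqVneq (phi t) 0; first by rewrite normr0 !powR0 ?mulr0 ?invr_neq0 ?gt_eqF.
  by rewrite -powR_add ?normr_gt0 // rq powRr1.
have E2 : (\int[mu]_(t in I) (`|g (x - t) * `|phi t| `^ r^-1| `^ r)%:E =
           \int[mu]_(t in I) ((`|g (x - t)| `^ r) * `|phi t|)%:E)%E.
  apply: eq_integral => t _; congr EFin.
  rewrite normrM powRM // (ger0_norm (powR_ge0 _ _)); congr (_ * _).
  by rewrite -powRrM mulVf ?gt_eqF // powRr1.
have E3 : (\int[mu]_(t in I) (`| (`|phi t| `^ q^-1) | `^ q)%:E = \int[mu]_(t in I) (`|phi t|)%:E)%E.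
  apply: eq_integral => t _; congr EFin.
  by rewrite (ger0_norm (powR_ge0 _ _)) -powRrM mulVf ?gt_eqF // powRr1.
rewrite E1 E2 E3 in H.
set J := (\int[mu]_(t in I) ((`|g (x - t)| `^ r) * `|phi t|)%:E)%E in H *.
have J0 : (0 <= J)%E by apply: integral_ge0 => t _; rewrite lee_fin mulr_ge0 ?powR_ge0.
have P1 : ((\int[mu]_(t in I) (`|phi t|)%:E) `^ q^-1 <= 1)%E.
  rewrite -(poweR1r q^-1); apply: gt0_ler_poweR => //.
  - by rewrite invr_ge0 ltW.
  - by rewrite in_itv /= leey andbT; apply: integral_ge0 => t _; rewrite lee_fin.
  - by rewrite in_itv /= leey andbT.
have wJ : (`|w|%:E <= J `^ r^-1)%E.
  rewrite -[`|w|%:E]/(`|w%:E|)%E wE.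
  apply: le_trans (le_abse_integral _ _ _) _; [exact: measurable_itv|exact: measurable_funTS|].
  apply: (le_trans H); rewrite -[leRHS]mule1.
  by apply: lee_wpmul2l => //; exact: poweR_ge0.
have -> : J = ((J `^ r^-1) `^ r)%E.
  by rewrite -poweRrM mulVf ?gt_eqF // poweRe1.
rewrite -poweR_EFin; apply: gt0_ler_poweR => //; first exact: ltW.
- by rewrite in_itv /= leey andbT lee_fin.
- by rewrite in_itv /= leey andbT poweR_ge0.
Qed.

(** The pointwise bound is integrated in [x]; after Tonelli the inner integral is that of [|g|^r]
    over a period, independent of [t], and [phi] contributes a factor at most 1. *)
Lemma young (r s : R) (w : R -> R) : 1 < r -> measurable_fun setT w ->
  {ae mu, forall x, x \in `[s, s + 2 * pi] -> (w x)%:E = (\int[mu]_(t in I) (g (x - t) * phi t)%:E)%E} ->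
  (\int[mu]_(x in `[s, (s + 2 * pi)%R]) (`|w x| `^ r)%:E <= \int[mu]_(t in I) (`|g t| `^ r)%:E)%E.
Proof.
move=> r1 mw wE.
have mpr' : measurable_fun setT (fun y : R => `|y| `^ r).
  by apply: (measurableT_comp (measurable_powR r)); exact: normr_measurable.
have mpr : measurable_fun setT (fun y : R => (`|y| `^ r)%:E) by apply/measurable_EFinP.
have mF : measurable_fun [set: T * T] (fun z : T * T => ((`|g (z.1 - z.2)| `^ r) * `|phi z.2|)%:E).
  apply/measurable_EFinP; apply: measurable_funM; last first.
    by apply: measurableT_comp => //; apply: (measurableT_comp mphi); exact: measurable_snd.
  apply: (measurableT_comp mpr').
  by apply: (measurableT_comp mg); apply: measurable_funB; [exact: measurable_fst|exact: measurable_snd].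
have F0 (z : T * T) : (0 <= ((`|g (z.1 - z.2)| `^ r) * `|phi z.2|)%:E)%E.
  by rewrite lee_fin mulr_ge0 ?powR_ge0.
apply: (@le_trans _ _ (\int[mu]_(x in `[s, (s + 2 * pi)%R]) \int[mu]_(t in I) ((`|g (x - t)| `^ r) * `|phi t|)%:E)%E).
  apply: ae_ge0_le_integral => //.
  - by apply: measurable_funTS; exact: (measurableT_comp mpr mw).
  - by move=> x _; apply: integral_ge0 => t _; rewrite lee_fin mulr_ge0 ?powR_ge0.
  - apply: measurable_funTS.
    exact: (measurable_integral_on2 _ (fun z : T * T => ((`|g (z.1 - z.2)| `^ r) * `|phi z.2|)%:E) (measurable_itv _) mF F0).
  - by apply: (ae_imp _ _ wE) => x Hx xs; apply: young_pointwise => //; exact: Hx.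
rewrite (tonelli_on _ _ (fun z : T * T => ((`|g (z.1 - z.2)| `^ r) * `|phi z.2|)%:E)) //=.
pose N := (\int[mu]_(t in I) (`|g t| `^ r)%:E)%E; rewrite -/N.
have N0 : (0 <= N)%E by apply: integral_ge0 => t _; rewrite lee_fin powR_ge0.
have E t : (\int[mu]_(x in `[s, (s + 2 * pi)%R]) ((`|g (x - t)| `^ r) * `|phi t|)%:E = (`|phi t|)%:E * N)%E.
  transitivity (\int[mu]_(x in `[s, (s + 2 * pi)%R]) ((`|phi t|)%:E * (`|g (x - t)| `^ r)%:E))%E.
    by apply: eq_integral => x _; rewrite -EFinM mulrC.
  rewrite /N; have <- := integral_convolution_comp (fun y : R => (`|y| `^ r)%:E) s t mpr.
  apply: ge0_integralZl_EFin => //.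
  apply: measurable_funTS; apply: (measurableT_comp mpr).
  by apply: (measurableT_comp mg); apply: measurable_funB.
under eq_integral do rewrite E.
rewrite ge0_integralZr //; last first.
  by apply: measurable_funTS; apply/measurable_EFinP; exact: measurableT_comp.
by rewrite -[leRHS]mul1e; apply: lee_wpmul2r.
Qed.

End convolution.

Lemma fine_affine {R : realType} (u v c : R) (F : \bar R) : F \is a fin_num ->
  (u%:E = v%:E + c%:E * F)%E -> u = v + c * fine F.
Proof. by case: F => // F _; rewrite -EFinM -EFinD => -[]. Qed.

(** * Upper bound *)

Section class_element.
Context {R : realType}.
Local Notation mu := (@lebesgue_measure R).
Local Notation I := (`[(- pi)%R, pi%R]%classic : set R).
Variables (psi : R -> R) (beta : R) (Psi f phi : R -> R) (a0 : R).
Let a (k : nat) := psi k%:R.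
Let th := beta * pi / 2.
Hypothesis hPsi : is_Psi psi beta Psi.
Hypothesis mphi : measurable_fun setT phi.
Hypothesis iphi : mu.-integrable I (EFin \o phi).
Hypothesis mf : measurable_fun setT f.
Hypothesis fE : {ae mu, forall x,
  (f x)%:E = ((a0 / 2)%:E + (pi^-1)%:E * \int[mu]_(t in I) (Psi (x - t) * phi t)%:E)%E}.

Let pPsi : periodic2pi Psi. Proof. by have [] := hPsi. Qed.
Let mPsi : measurable_fun setT Psi. Proof. by have [_ []] := hPsi. Qed.
Let iPsi : mu.-integrable I (EFin \o Psi). Proof. by have [_ [_ []]] := hPsi. Qed.

Let Npi2 : - pi + 2 * pi = pi :> R. Proof. by ring. Qed.

(** Translating by [t] changes the phase [c] of the harmonic into [k t + c], so the coefficient of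
    [Psi] with that phase is what remains. *)
Lemma Psi_shift_coef (k : nat) (c t : R) :
  (\int[mu]_(x in I) (Psi (x - t) * phi t * cos (k%:R * x + c))%:E =
   (phi t * (if (0 < k)%N then a k * (pi * cos (k%:R * t + (th + c))) else 0))%:E)%E.
Proof.
pose h y := Psi y * cos (k%:R * y + (k%:R * t + c)).
have bc := @bounded_measurable_cos R k%:R (k%:R * t + c).
have ih : mu.-integrable I (EFin \o h) by exact: integrable_mul_bounded.
have mh : measurable_fun setT h by apply: measurable_funM => //; case: bc.
have ph x : (EFin \o h) (x + 2 * pi) = (EFin \o h) x.
  by rewrite /h /= pPsi; congr (_ * _)%:E; exact: cosDn2pi.
have := integral_period_shift (EFin \o h) (- t) (- pi) ((measurable_EFinP _ _).2 mh) ph.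
rewrite Npi2 => E.
transitivity (\int[mu]_(x in I) ((phi t)%:E * (EFin \o h) (x + - t)%R))%E.
  apply: eq_integral => x _; rewrite /h /= -EFinM; congr EFin.
  by rewrite (_ : k%:R * (x - t) + (k%:R * t + c) = k%:R * x + c); ring.
have iht : mu.-integrable I (fun x => (EFin \o h) (x + - t)%R).
  apply/integrableP; split.
    apply: measurable_funTS; apply/measurable_EFinP; apply: (measurableT_comp mh).
    by apply: measurable_funD.
  have pah x : (abse \o (EFin \o h)) (x + 2 * pi) = (abse \o (EFin \o h)) x.
    by congr (abse _); exact: ph.
  have mah : measurable_fun setT (abse \o (EFin \o h)).
    by apply: measurableT_comp => //; apply/measurable_EFinP.
  have := integral_period_shift (abse \o (EFin \o h)) (- t) (- pi) mah pah.
  by rewrite Npi2 => ->; have /integrableP[_] := ih.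
rewrite integralZl // E EFinM; congr (_ * _)%E.
rewrite -[LHS]fineK; last by apply: (@integrable_fin_num _ _ _ mu I).
congr EFin; have := is_Psi_coef psi beta Psi k (k%:R * t + c) hPsi.
rewrite /Rintegral /h -/th => ->; case: ifP => // _.
by congr (_ * (_ * cos _)); ring.
Qed.

(** The convolution theorem with a phase: after Fubini the harmonic is integrated against [Psi],
    which multiplies it by [a k] and adds [th] to its phase. *)
Lemma class_pairing (k : nat) (c : R) :
  Rintegral mu I (fun x => f x * cos (k%:R * x + c)) =
  a0 / 2 * Rintegral mu I (fun x => cos (k%:R * x + c)) +
  (if (0 < k)%N then a k * Rintegral mu I (fun t => phi t * cos (k%:R * t + (th + c))) else 0).
Proof.
have pi0 : (pi : R) != 0 by rewrite gt_eqF // pi_gt0.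
pose q x := cos (k%:R * x + c).
have bq : bounded_measurable q by exact: bounded_measurable_cos.
have [mq _] := bq.
have iq : mu.-integrable I (EFin \o q) by exact: bounded_integrable_itv.
have icv := convolution_integrable Psi phi pPsi mPsi mphi iPsi iphi q bq.
have ae1 := convolution_ae Psi phi pPsi mPsi mphi iPsi iphi (- pi).
rewrite Npi2 in ae1.
have E1 : (\int[mu]_(x in I) (f x * q x)%:E =
   \int[mu]_(x in I) ((a0 / 2 * q x)%:E + (pi^-1)%:E * \int[mu]_(t in I) (Psi (x - t) * phi t * q x)%:E))%E.
  apply: ae_eq_integral => //.
  - by apply: measurable_funTS; apply/measurable_EFinP; exact: measurable_funM.
  - apply: emeasurable_funD.
      by apply: measurable_funTS; apply/measurable_EFinP; exact: measurable_funM.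
    apply: emeasurable_funM => //; exact: (measurable_int mu icv).
  apply: (ae_imp2 _ _ _ fE ae1) => x fx ix Ix /=.
  have {}ix := ix Ix.
  have Ff : (\int[mu]_(t in I) (Psi (x - t) * phi t)%:E)%E \is a fin_num.
    exact: (@integrable_fin_num _ _ _ mu I).
  have -> : (\int[mu]_(t in I) (Psi (x - t) * phi t * q x)%:E = (\int[mu]_(t in I) (Psi (x - t) * phi t)%:E) * (q x)%:E)%E.
    by rewrite -(@integralZr _ _ _ mu I (measurable_itv _) _ ix).
  have -> : f x = a0 / 2 + pi^-1 * fine (\int[mu]_(t in I) (Psi (x - t) * phi t)%:E)%E.
    by apply: fine_affine => //; exact: fx.
  by rewrite -[in RHS](fineK Ff) -!EFinM -EFinD; congr EFin; ring.
have isum : mu.-integrable I (fun x => (a0 / 2 * q x)%:E) by exact: (integrable_scale I q (a0 / 2)).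
have iscv := @integrableZl _ _ _ mu I (measurable_itv _) (pi^-1) _ icv.
rewrite /Rintegral -/q E1 integralD //.
rewrite (@integralZl _ _ _ mu I (measurable_itv _) _ icv) (convolution_pairing Psi phi pPsi mPsi mphi iPsi iphi q bq).
have E2 : (\int[mu]_(t in I) \int[mu]_(x in I) (Psi (x - t) * phi t * q x)%:E =
   \int[mu]_(t in I) (phi t * (if (0 < k)%N then a k * (pi * cos (k%:R * t + (th + c))) else 0))%:E)%E.
  by apply: eq_integral => t _; exact: Psi_shift_coef.
rewrite E2.
have -> : (\int[mu]_(x in I) (a0 / 2 * q x)%:E = (a0 / 2 * Rintegral mu I q)%:E)%E.
  rewrite -(@RintegralZl _ _ _ mu I q (a0 / 2) (measurable_itv _) iq) /Rintegral fineK //.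
  exact: (@integrable_fin_num _ _ _ mu I).
case: ifP => k0; last first.
  rewrite (_ : (\int[mu]_(t in I) (phi t * 0)%:E)%E = 0%E) ?mule0 ?adde0 ?addr0 //.
  by rewrite integral0_eq // => t _; rewrite mulr0.
have bc := @bounded_measurable_cos R k%:R (th + c).
have ipc : mu.-integrable I (EFin \o (fun t => phi t * cos (k%:R * t + (th + c)))) by exact: integrable_mul_bounded.
have -> : (\int[mu]_(t in I) (phi t * (a k * (pi * cos (k%:R * t + (th + c)))))%:E =
   (a k * pi * Rintegral mu I (fun t => phi t * cos (k%:R * t + (th + c))))%:E)%E.
  rewrite -(@RintegralZl _ _ _ mu I _ (a k * pi) (measurable_itv _) ipc) /Rintegral fineK.
    by apply: eq_integral => t _; congr EFin; ring.
  by apply: (@integrable_fin_num _ _ _ mu I) => //; exact: (integrable_scale I _ (a k * pi)).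
by rewrite -EFinM -EFinD /=; congr (_ + _); rewrite -mulrA mulrCA mulKf.
Qed.

(** The partial sum of order [n - 1] keeps the frequencies [k < n], so its kernel is the block from
    1 to [n], upper end excluded. *)
Lemma fourier_sum_class (n : nat) (x : R) : (0 < n)%N ->
  fourier_sum n.-1 f x = a0 / 2 + pi^-1 * Rintegral mu I (fun t => cos_block a th 1 n (x - t) * phi t).
Proof.
move=> n0; have pi0 : (pi : R) != 0 by rewrite gt_eqF // pi_gt0.
have fa k : fourier_a f k = pi^-1 * Rintegral mu I (fun x => f x * cos (k%:R * x + 0)).
  by congr (_ * Rintegral _ _ _); apply/funext => y; rewrite addr0.
have fb k : fourier_b f k = pi^-1 * Rintegral mu I (fun x => f x * cos (k%:R * x + - (pi / 2))).
  by congr (_ * Rintegral _ _ _); apply/funext => y; rewrite sin_shift.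
have RC (k : nat) c : Rintegral mu I (fun x => cos (k%:R * x + c)) = if k == 0%N then 2 * pi * cos c else 0.
  exact: (Rintegral_cos k c).
rewrite /fourier_sum prednK //; congr (_ + _).
  rewrite fa class_pairing RC /= cos0 addr0 mulr1.
  by rewrite (_ : a0 / 2 * (2 * pi) = pi * a0) ?mulKf //; field.
have ic k c : mu.-integrable I (EFin \o (fun t => phi t * cos (k%:R * t + c))).
  by apply: integrable_mul_bounded => //; exact: bounded_measurable_cos.
transitivity (pi^-1 * Rintegral mu I (fun t => \sum_(k <- index_iota 1 n)
   (a k * cos (k%:R * x) * (phi t * cos (k%:R * t + th)) +
    a k * sin (k%:R * x) * (phi t * cos (k%:R * t + (th - pi / 2)))))); last first.
  congr (_ * Rintegral _ _ _); apply/funext => t; rewrite /cos_block big_distrl /=.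
  apply: eq_bigr => k _; rewrite addrA -sin_shift.
  have -> : k%:R * (x - t) - th = k%:R * x - (k%:R * t + th) by ring.
  by rewrite cosB; ring.
rewrite Rintegral_sum; last first.
  move=> k; pose u t := a k * cos (k%:R * x) * (phi t * cos (k%:R * t + th)).
  pose v t := a k * sin (k%:R * x) * (phi t * cos (k%:R * t + (th - pi / 2))).
  rewrite (_ : _ \o _ = ((EFin \o u) \+ (EFin \o v))%E) //.
  by apply: integrableD => //; apply: integrable_scale.
rewrite big_distrr /= !big_nat; apply: eq_bigr => k /andP[k1 _].
rewrite fa fb !class_pairing !RC k1 (gtn_eqF k1) mulr0 !add0r addr0.
rewrite RintegralD //; [|exact: integrable_scale|exact: integrable_scale].
by rewrite !RintegralZl //; ring.
Qed.

Lemma class_remainder (n : nat) (s : R) : (0 < n)%N ->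
  {ae mu, forall x, x \in `[s, s + 2 * pi] ->
    (pi * (f x - fourier_sum n.-1 f x))%:E =
    (\int[mu]_(t in I) ((Psi (x - t) - cos_block a th 1 n (x - t)) * phi t)%:E)%E}.
Proof.
move=> n0; have pi0 : (pi : R) != 0 by rewrite gt_eqF // pi_gt0.
have ae1 := convolution_ae Psi phi pPsi mPsi mphi iPsi iphi s.
apply: (ae_imp2 _ _ _ fE ae1) => x fx ix xs; have {}ix := ix xs.
have bb : bounded_measurable (fun t => cos_block a th 1 n (x - t)).
  have [mb [M bM]] := bounded_measurable_block a th 1 n.
  split; last by exists M => t; exact: bM.
  by apply: (measurableT_comp mb); apply: measurable_funB.
have ib : mu.-integrable I (EFin \o (fun t => cos_block a th 1 n (x - t) * phi t)).
  have := integrable_mul_bounded I phi _ (measurable_itv _) iphi bb.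
  rewrite (_ : EFin \o _ = (fun t => (phi t * cos_block a th 1 n (x - t))%:E)) //.
  by apply/funext => t /=; rewrite mulrC.
have E : (\int[mu]_(t in I) ((Psi (x - t) - cos_block a th 1 n (x - t)) * phi t)%:E =
  \int[mu]_(t in I) (Psi (x - t) * phi t)%:E - \int[mu]_(t in I) (cos_block a th 1 n (x - t) * phi t)%:E)%E.
  rewrite -(@integralB _ _ _ mu I (measurable_itv _) _ _ ix ib).
  by apply: eq_integral => t _; rewrite -EFinB; congr EFin; ring.
rewrite E.
have fin1 : (\int[mu]_(t in I) (Psi (x - t) * phi t)%:E)%E \is a fin_num.
  exact: (@integrable_fin_num _ _ _ mu I).
have fin2 : (\int[mu]_(t in I) (cos_block a th 1 n (x - t) * phi t)%:E)%E \is a fin_num.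
  exact: (@integrable_fin_num _ _ _ mu I).
rewrite -(fineK fin1) -(fineK fin2) -EFinB; congr EFin.
rewrite fourier_sum_class // /Rintegral.
have -> : f x = a0 / 2 + pi^-1 * fine (\int[mu]_(t in I) (Psi (x - t) * phi t)%:E)%E.
  by apply: fine_affine => //; exact: fx.
set F1 := fine _; set F2 := fine _.
by rewrite (_ : _ - _ = pi^-1 * (F1 - F2)) ?mulVKf //; ring.
Qed.

End class_element.

(** * From tail bounds to bounds of the approximation errors *)

Section upper_bound.
Context {R : realType}.
Local Notation mu := (@lebesgue_measure R).
Local Notation I := (`[(- pi)%R, pi%R]%classic : set R).

Lemma pi_ge1 : 1 <= pi :> R.
Proof. by have := @pi_ge2 R; lra. Qed.

Lemma pnorm1_le (phi : R -> R) : periodic2pi phi -> measurable_fun setT phi ->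
  (pnorm 1%E phi <= 1)%E -> (\int[mu]_(t in I) (`|phi t|)%:E <= 1)%E.
Proof.
move=> pphi mphi; rewrite /pnorm invr1 poweRe1; last first.
  by apply: integral_ge0 => x _; rewrite lee_fin powR_ge0.
have -> : (\int[mu]_(x in `[0%R, (2 * pi)%R]) (`|phi x| `^ 1)%:E = \int[mu]_(t in I) (`|phi t|)%:E)%E.
  transitivity (\int[mu]_(x in `[0%R, (0 + 2 * pi)%R]) (`|phi x|)%:E)%E.
    by rewrite add0r; apply: eq_integral => x _; rewrite powRr1.
  apply: (integral_period (fun x => (`|phi x|)%:E)).
    by apply/measurable_EFinP; exact: measurableT_comp.
  by move=> x; rewrite pphi.
by [].
Qed.

Lemma measurable_fourier_sum (m : nat) (f : R -> R) : measurable_fun setT (fourier_sum m f).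
Proof.
have bc (k : nat) : bounded_measurable (fun x : R => cos (k%:R * x)).
  by have := @bounded_measurable_cos R k%:R 0; under eq_fun do rewrite addr0.
have bs (k : nat) : bounded_measurable (fun x : R => sin (k%:R * x)).
  by have := @bounded_measurable_sin R k%:R 0; under eq_fun do rewrite addr0.
have [] // : bounded_measurable (fourier_sum m f).
apply: bounded_measurableD; first exact: bounded_measurable_cst.
apply: bounded_measurable_sum => k; apply: bounded_measurableD; apply: bounded_measurableM => //; exact: bounded_measurable_cst.
Qed.

Variables (psi : R -> R) (beta : R) (G : nat -> R -> R).
Let a (k : nat) := psi k%:R.
Let th := beta * pi / 2.
Hypothesis a_dec : forall k, (0 < k)%N -> a k.+1 <= a k.
Hypothesis a_ge0 : forall k, (0 < k)%N -> 0 <= a k.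
Hypothesis a_cvg0 : a @ \oo --> (0 : R).
Hypothesis block_le : forall n m (x : R), (0 < n)%N -> x != 0 -> `|x| <= pi ->
  `|cos_block a th n m x| <= G n x.
Hypothesis iG : mu.-integrable I (EFin \o G 1%N).
Variable n : nat.
Hypothesis n0 : (0 < n)%N.
Hypothesis mG : measurable_fun setT (G n).

Let D Psi x := Psi x - cos_block a th 1 n x.

Let mD Psi : is_Psi psi beta Psi -> measurable_fun setT (D Psi).
Proof.
move=> [_ [mPsi _]]; apply: measurable_funB => //.
by have [] := bounded_measurable_block a th 1 n.
Qed.

Let pD Psi : is_Psi psi beta Psi -> periodic2pi (D Psi).
Proof. by move=> [pPsi _] x; rewrite /D pPsi block_periodic. Qed.

Let normpi (y : R) : `|y| <= `|pi * y|.
Proof. by rewrite normrM ler_peMl // ger0_norm ?pi_ge0 // pi_ge1. Qed.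

Lemma calE_le_fin (r M : R) : 1 < r -> 0 <= M -> (\int[mu]_(x in I) ((G n x) `^ r)%:E <= (M `^ r)%:E)%E ->
  (calE n psi beta r%:E <= M%:E)%E.
Proof.
move=> r1 M0 GM; have r0 : 0 < r by lra.
apply: ub_ereal_sup => _ [f [pf [mf [Psi [hPsi [a0 [phi [pphi [mphi [iphi [_ [phi1 fE]]]]]]]]]]] <-].
have phi1' := pnorm1_le phi pphi mphi phi1.
have rem := class_remainder psi beta Psi f phi a0 hPsi mphi iphi mf fE n 0 n0.
have mS := measurable_fourier_sum n.-1 f.
pose w x := pi * (f x - fourier_sum n.-1 f x).
have mw : measurable_fun setT w.
  by apply: measurable_funM => //; exact: measurable_funB.
have mpr : measurable_fun setT (fun y : R => (`|y| `^ r)%:E).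
  by apply/measurable_EFinP; apply: (measurableT_comp (measurable_powR r)); exact: normr_measurable.
have Y := young (D Psi) phi (pD Psi hPsi) (mD Psi hPsi) mphi phi1' r 0 w r1 mw rem.
have GD : (\int[mu]_(t in I) (`|D Psi t| `^ r)%:E <= \int[mu]_(x in I) ((G n x) `^ r)%:E)%E.
  apply: ae_ge0_le_integral => //.
  - by apply: measurable_funTS; exact: (measurableT_comp mpr (mD Psi hPsi)).
  - by move=> x _; rewrite lee_fin powR_ge0.
  - apply: measurable_funTS; apply/measurable_EFinP.
    exact: (measurableT_comp (measurable_powR r) mG).
  have tail := is_Psi_tail_le psi beta G a_dec a_ge0 a_cvg0 block_le iG Psi n hPsi n0.
  apply: (ae_imp _ _ tail) => x Hx Ix; rewrite lee_fin.
  have H := Hx Ix; apply: ge0_ler_powR; rewrite ?nnegrE //; first exact: ltW.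
  exact: le_trans H.
rewrite /pnorm.
have fin : (\int[mu]_(x in `[0%R, (2 * pi)%R]) (`|(f \- fourier_sum n.-1 f) x| `^ r)%:E <= (M `^ r)%:E)%E.
  apply: le_trans (le_trans GD GM); apply: le_trans Y; rewrite add0r.
  apply: ge0_le_integral => //.
  - by apply: measurable_funTS; apply: (measurableT_comp mpr); exact: measurable_funB.
  - by apply: measurable_funTS; exact: (measurableT_comp mpr mw).
  - by move=> x _; rewrite lee_fin; apply: ge0_ler_powR; rewrite ?nnegrE ?(ltW r0) //; exact: normpi.
have -> : M%:E = ((M `^ r)%:E `^ r^-1)%E.
  by rewrite poweR_EFin -powRrM mulfV ?gt_eqF // powRr1.
apply: gt0_ler_poweR => //.
- by rewrite invr_ge0 ltW.
- by rewrite in_itv /= leey andbT; apply: integral_ge0 => x _; rewrite lee_fin powR_ge0.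
- by rewrite in_itv /= leey andbT lee_fin powR_ge0.
Qed.

Lemma calE_le_oo (M : R) : 0 <= M -> (forall x, G n x <= M) ->
  (calE n psi beta +oo <= M%:E)%E.
Proof.
move=> M0 GM.
apply: ub_ereal_sup => _ [f [pf [mf [Psi [hPsi [a0 [phi [pphi [mphi [iphi [_ [phi1 fE]]]]]]]]]]] <-].
have phi1' := pnorm1_le phi pphi mphi phi1.
have rem := class_remainder psi beta Psi f phi a0 hPsi mphi iphi mf fE n 0 n0.
apply: ereal_inf_lbound => /=.
apply: (ae_imp _ _ rem) => x Hx xI; rewrite add0r in Hx.
have tail := is_Psi_tail_le psi beta G a_dec a_ge0 a_cvg0 block_le iG Psi n hPsi n0.
have DM : {ae mu, forall t, I t -> `|D Psi t| <= M}.
  by apply: (ae_imp _ _ tail) => t Ht It; apply: le_trans (GM t); exact: Ht.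
have := young_oo (D Psi) phi (pD Psi hPsi) (mD Psi hPsi) mphi phi1' M x _ M0 DM (Hx xI).
by rewrite lee_fin; apply: le_trans; exact: normpi.
Qed.

Lemma bestE_le_calE (p : \bar R) : (bestE n psi beta p <= calE n psi beta p)%E.
Proof.
apply: ub_ereal_sup => _ [f hf <-].
apply: (@le_trans _ _ (pnorm p (f \- fourier_sum n.-1 f))); last first.
  by apply: ereal_sup_ubound; exists f.
apply: ereal_inf_lbound; exists (fourier_sum n.-1 f) => //.
exists (fun k => if k == 0%N then fourier_a f 0 / 2 else fourier_a f k), (fourier_b f).
apply/funext => x; rewrite /fourier_sum prednK // -(big_mkord xpredT (fun k =>
  (if k == 0%N then fourier_a f 0 / 2 else fourier_a f k) * cos (k%:R * x) + fourier_b f k * sin (k%:R * x))).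
rewrite [RHS]big_ltn //= mul0r cos0 sin0 mulr1 mulr0 addr0; congr (_ + _).
by rewrite !big_nat; apply: eq_bigr => k /andP[k1 _]; rewrite gtn_eqF.
Qed.

End upper_bound.

(** * Lower bound *)

Section fejer.
Context {R : realType}.
Local Notation mu := (@lebesgue_measure R).
Local Notation I := (`[(- pi)%R, pi%R]%classic : set R).
Variable n : nat.
Hypothesis n0 : (0 < n)%N.

Let nr0 : 0 < n%:R :> R. Proof. by rewrite ltr0n. Qed.

(** This is [|sum_(k < n) e^(i k x)|^2 / n], written with real and imaginary parts so that
    nonnegativity is immediate. *)
Definition fejer (x : R) : R :=
  ((\sum_(i < n) cos (i%:R * x)) ^+ 2 + (\sum_(i < n) sin (i%:R * x)) ^+ 2) / n%:R.

(* The number of representations [m = 2n + i - j] with [i, j < n], i.e. the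
   Fejer weights shifted by [2n]. *)
Definition fejer_count (m : nat) : R :=
  \sum_(i < n) \sum_(j < n) ((2 * n + i - j)%N == m)%:R.

Definition fejer_coef (m : nat) : R := fejer_count m / n%:R.

Lemma fejer_ge0 x : 0 <= fejer x.
Proof. by rewrite divr_ge0 // addr_ge0 ?sqr_ge0. Qed.

Lemma fejerE x : fejer x = (\sum_(i < n) \sum_(j < n) cos ((i%:Z - j%:Z)%:~R * x)) / n%:R.
Proof.
rewrite /fejer; congr (_ / _).
rewrite !expr2 !big_distrl /= -big_split /=; apply: eq_bigr => i _.
rewrite !big_distrr /= -big_split /=; apply: eq_bigr => j _.
by rewrite intrB -!pmulrn mulrBl cosB.
Qed.

Lemma fejer_le x : fejer x <= n%:R.
Proof.
rewrite fejerE ler_pdivrMr //.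
apply: (@le_trans _ _ (\sum_(i < n) \sum_(j < n) 1)).
  by apply: ler_sum => i _; apply: ler_sum => j _; exact: cos_le1.
by rewrite !sumr_const !card_ord -[leLHS]mulr_natr.
Qed.

Lemma sum_eqn_indicator (l h m : nat) (F : nat -> R) : (l <= m < h)%N ->
  \sum_(l <= k < h) (m == k)%:R * F k = F m.
Proof.
move=> lmh; transitivity (\sum_(l <= k < h | k == m) F k); last by rewrite big_nat1_eq lmh.
rewrite [RHS]big_mkcond; apply: eq_bigr => k _; rewrite eq_sym.
by case: eqP => _; rewrite ?mul1r ?mul0r.
Qed.

(** The shift by [2n] is what places all frequencies outside the range [k < n] of the approximating
    polynomials; it also keeps the subtraction in [nat] exact. *)
Lemma fejer_freq_bounds (i j : 'I_n) : (n <= 2 * n + i - j < 3 * n)%N.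
Proof. by have := ltn_ord i; have := ltn_ord j => hj hi; apply/andP; split; lia. Qed.

Lemma fejer_freqE (i j : 'I_n) : (2 * n + i - j)%N%:R = 2 * n%:R + i%:R - j%:R :> R.
Proof. by have := ltn_ord j => hj; rewrite natrB; [rewrite natrD natrM|lia]. Qed.

Lemma fejer_sum (F : nat -> R) :
  \sum_(n <= k < 3 * n) fejer_count k * F k = \sum_(i < n) \sum_(j < n) F (2 * n + i - j)%N.
Proof.
transitivity (\sum_(n <= k < 3 * n) \sum_(i < n) \sum_(j < n) ((2 * n + i - j)%N == k)%:R * F k).
  apply: eq_bigr => k _; rewrite big_distrl /=; apply: eq_bigr => i _.
  by rewrite big_distrl.
rewrite exchange_big /=; apply: eq_bigr => i _.
rewrite exchange_big /=; apply: eq_bigr => j _.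
by rewrite sum_eqn_indicator // fejer_freq_bounds.
Qed.

(** The left side is the real part of [e^(i (2 n x - th))] times [|sum e^(i k x)|^2 / n]; the part
    with [sin A] is antisymmetric in [i] and [j] and cancels. *)
Lemma modulated_fejer (th x : R) :
  cos_block fejer_coef th n (3 * n) x = cos (2 * n%:R * x - th) * fejer x.
Proof.
transitivity ((\sum_(n <= k < 3 * n) fejer_count k * cos (k%:R * x - th)) / n%:R).
  by rewrite /cos_block big_distrl /=; apply: eq_bigr => k _; rewrite mulrAC.
rewrite fejer_sum /fejer mulrA; congr (_ / _).
set A := 2 * n%:R * x - th.
set C := \sum_(i < n) cos _; set S := \sum_(i < n) sin _.
transitivity (\sum_(i < n) \sum_(j < n)
   (cos A * (cos (i%:R * x) * cos (j%:R * x) + sin (i%:R * x) * sin (j%:R * x)) -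
    sin A * (sin (i%:R * x) * cos (j%:R * x) - cos (i%:R * x) * sin (j%:R * x)))).
  apply: eq_bigr => i _; apply: eq_bigr => j _; rewrite fejer_freqE.
  have -> : (2 * n%:R + i%:R - j%:R) * x - th = A + (i%:R * x - j%:R * x) by rewrite /A; ring.
  by rewrite cosD (cosB (i%:R * x)) (sinB (i%:R * x)).
have inner (i : 'I_n) : \sum_(j < n)
   (cos A * (cos (i%:R * x) * cos (j%:R * x) + sin (i%:R * x) * sin (j%:R * x)) -
    sin A * (sin (i%:R * x) * cos (j%:R * x) - cos (i%:R * x) * sin (j%:R * x))) =
   cos (i%:R * x) * (cos A * C + sin A * S) + sin (i%:R * x) * (cos A * S - sin A * C).
  transitivity (\sum_(j < n) ((cos A * cos (i%:R * x) - sin A * sin (i%:R * x)) * cos (j%:R * x) +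
                              (cos A * sin (i%:R * x) + sin A * cos (i%:R * x)) * sin (j%:R * x))).
    by apply: eq_bigr => j _; ring.
  by rewrite big_split /= -!big_distrr /= -/C -/S; ring.
under eq_bigr do rewrite inner.
by rewrite big_split /= -!big_distrl /= -/C -/S; ring.
Qed.

(* Variance bound: the [2n] counts have sum [n^2], hence mean [n/2]. *)
Lemma fejer_count_sq : n%:R ^+ 3 / 2 <= \sum_(n <= k < 3 * n) fejer_count k ^+ 2.
Proof.
have S1 : \sum_(n <= k < 3 * n) fejer_count k = n%:R ^+ 2.
  transitivity (\sum_(n <= k < 3 * n) fejer_count k * 1); first by apply: eq_bigr => k _; rewrite mulr1.
  by rewrite (fejer_sum (fun=> 1)) !sumr_const !card_ord expr2 -[LHS]mulr_natr.
have H : 0 <= \sum_(n <= k < 3 * n) (fejer_count k - n%:R / 2) ^+ 2.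
  by apply: sumr_ge0 => k _; exact: sqr_ge0.
have E : \sum_(n <= k < 3 * n) (fejer_count k - n%:R / 2) ^+ 2 =
   \sum_(n <= k < 3 * n) fejer_count k ^+ 2 - n%:R * (\sum_(n <= k < 3 * n) fejer_count k) +
   \sum_(n <= k < 3 * n) n%:R ^+ 2 / 4.
  rewrite big_distrr /= -sumrB -big_split /=; apply: eq_bigr => k _.
  by rewrite sqrrB; field.
have S3 : \sum_(n <= k < 3 * n) n%:R ^+ 2 / 4 = n%:R ^+ 3 / 2 :> R.
  rewrite sumr_const_nat (_ : 3 * n - n = 2 * n)%N; last by lia.
  by rewrite -[LHS]mulr_natr natrM; field.
rewrite E S1 S3 in H; move: H; rewrite (_ : n%:R * n%:R ^+ 2 = n%:R ^+ 3); last by ring.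
lra.
Qed.

Lemma bounded_measurable_fejer : bounded_measurable fejer.
Proof.
have bc (k : nat) : bounded_measurable (fun x : R => cos (k%:R * x)).
  by have := @bounded_measurable_cos R k%:R 0; under eq_fun do rewrite addr0.
have bs (k : nat) : bounded_measurable (fun x : R => sin (k%:R * x)).
  by have := @bounded_measurable_sin R k%:R 0; under eq_fun do rewrite addr0.
apply: bounded_measurableM; last exact: bounded_measurable_cst.
by apply: bounded_measurableD; apply: bounded_measurableM; apply: bounded_measurable_sum.
Qed.

Lemma fejer_periodic x : fejer (x + 2 * pi) = fejer x.
Proof.
have c (k : nat) : cos (k%:R * (x + 2 * pi)) = cos (k%:R * x).
  by have := cosDn2pi k x 0; rewrite !addr0.
have s (k : nat) : sin (k%:R * (x + 2 * pi)) = sin (k%:R * x).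
  by have := cosDn2pi k x (- (pi / 2)); rewrite -!sin_shift.
by rewrite /fejer; congr ((_ ^+ 2 + _ ^+ 2) / _); apply: eq_bigr => i _.
Qed.

(** Only the [n] diagonal terms of [fejerE] have frequency 0. *)
Lemma integral_fejer : (\int[mu]_(x in I) (fejer x)%:E = (2 * pi)%:E)%E.
Proof.
have ifj : mu.-integrable I (EFin \o fejer) by apply: bounded_integrable_itv; exact: bounded_measurable_fejer.
rewrite -[LHS]fineK; last exact: (@integrable_fin_num _ _ _ mu I).
congr EFin; rewrite -/(Rintegral mu I fejer).
have ic (l : int) : mu.-integrable I (EFin \o (fun x => cos (l%:~R * x))).
  apply: bounded_integrable_itv; have := @bounded_measurable_cos R l%:~R 0.
  by under eq_fun do rewrite addr0.
transitivity (Rintegral mu I (fun x => n%:R^-1 * \sum_(i < n) \sum_(j < n) cos ((i%:Z - j%:Z)%:~R * x))).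
  by congr Rintegral; apply/funext => x; rewrite fejerE mulrC.
have is1 (i : 'I_n) : mu.-integrable I (EFin \o (fun x => \sum_(j < n) cos ((i%:Z - j%:Z)%:~R * x))).
  apply: bounded_integrable_itv; apply: bounded_measurable_sum => j.
  by have := @bounded_measurable_cos R (i%:Z - j%:Z)%:~R 0; under eq_fun do rewrite addr0.
have is2 : mu.-integrable I (EFin \o (fun x => \sum_(i < n) \sum_(j < n) cos ((i%:Z - j%:Z)%:~R * x))).
  apply: bounded_integrable_itv; apply: bounded_measurable_sum => i; apply: bounded_measurable_sum => j.
  by have := @bounded_measurable_cos R (i%:Z - j%:Z)%:~R 0; under eq_fun do rewrite addr0.
rewrite RintegralZl // Rintegral_sum //.
have -> : \sum_(i < n) Rintegral mu I (fun x => \sum_(j < n) cos ((i%:Z - j%:Z)%:~R * x)) =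
  \sum_(i < n) 2 * pi.
  apply: eq_bigr => i _; rewrite Rintegral_sum; last by move=> j; exact: ic.
  rewrite (bigD1 i) //= big1 ?addr0.
    rewrite subrr; have := @Rintegral_cos R 0 0; rewrite eqxx cos0 mulr1 => <-.
    by congr Rintegral; apply/funext => x; rewrite addr0.
  move=> j ji; have := @Rintegral_cos R (i%:Z - j%:Z) 0.
  rewrite subr_eq0 eqz_nat eq_sym (inj_eq val_inj) (negbTE ji) => <-.
  by congr Rintegral; apply/funext => x; rewrite addr0.
by rewrite sumr_const card_ord -[(2 * pi) *+ n]mulr_natl mulKf // gt_eqF.
Qed.

Lemma norm_modulated_fejer (th x : R) : `|cos_block fejer_coef th n (3 * n) x| <= fejer x.
Proof.
rewrite modulated_fejer normrM (ger0_norm (fejer_ge0 x)) ler_piMl ?fejer_ge0 //.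
exact: cos_max.
Qed.

End fejer.

(** * The extremal function and its pairing with the dual function *)

Section lower_bound.
Context {R : realType}.
Local Notation mu := (@lebesgue_measure R).
Local Notation I := (`[(- pi)%R, pi%R]%classic : set R).
Variables (psi : R -> R) (beta : R) (Psi : R -> R) (n : nat).
Let a (k : nat) := psi k%:R.
Let th := beta * pi / 2.
Hypothesis hPsi : is_Psi psi beta Psi.
Hypothesis n0 : (0 < n)%N.
Hypothesis a_ge : forall k, (n <= k < 3 * n)%N -> a (3 * n)%N <= a k.
Hypothesis a3n : 0 < a (3 * n)%N.

Let pi0 : 0 < pi :> R. Proof. exact: pi_gt0. Qed.
Let nr0 : 0 < n%:R :> R. Proof. by rewrite ltr0n. Qed.

(** The factor is the inverse of the integral of the Fejer kernel, which dominates the block. Its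
    phase is 0: the phase of the extremal function comes from [Psi]. *)
Definition test_density (x : R) : R := (2 * pi)^-1 * cos_block (fejer_coef n) 0 n (3 * n) x.
(* [Psi * test_density / pi], see [convolution_test_density]. *)
Definition extremal (x : R) : R :=
  cos_block (fun m => (2 * pi)^-1 * (a m * fejer_coef n m)) th n (3 * n) x.
(** Having the phase of [extremal], it makes the terms of the pairing nonnegative multiples of
    squared coefficients. *)
Definition dual_test (x : R) : R := cos_block (fejer_coef n) th n (3 * n) x.

Lemma convolution_test_density (x : R) :
  (\int[mu]_(t in I) (Psi (x - t) * test_density t)%:E = (pi * extremal x)%:E)%E.
Proof.
have [pPsi [mPsi [iPsi _]]] := hPsi.
pose u t := Psi t * test_density (x - t).
have bt : bounded_measurable (fun t => test_density (x - t)).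
  have [mb [M bM]] := bounded_measurable_block (fejer_coef n) (0 : R) n (3 * n).
  apply: (bounded_measurableM (fun=> (2 * pi)^-1)); first exact: bounded_measurable_cst.
  split; last by exists M => t; exact: bM.
  by apply: (measurableT_comp mb); apply: measurable_funB.
have iu : mu.-integrable I (EFin \o u) by exact: integrable_mul_bounded.
have mu_ : measurable_fun setT (EFin \o u).
  by apply/measurable_EFinP; apply: measurable_funM => //; case: bt.
have pu y : (EFin \o u) (y + 2 * pi) = (EFin \o u) y.
  rewrite /u /= pPsi /test_density -(block_periodic _ _ _ _ (x - (y + 2 * pi))).
  by rewrite (_ : x - (y + 2 * pi) + 2 * pi = x - y) //; ring.
have := integral_period_reflect (EFin \o u) x mu_ pu => E.
transitivity (\int[mu]_(t in I) (EFin \o u) (x - t)%R)%E.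
  by apply: eq_integral => t _; rewrite /u /= (_ : x - (x - t) = t) //; ring.
rewrite E -[LHS]fineK; last exact: (@integrable_fin_num _ _ _ mu I).
congr EFin; rewrite -/(Rintegral mu I u).
transitivity (Rintegral mu I (fun t => \sum_(k <- index_iota n (3 * n))
   (2 * pi)^-1 * fejer_coef n k * (Psi t * cos (k%:R * t + - (k%:R * x))))).
  congr Rintegral; apply/funext => t; rewrite /u /test_density /cos_block !big_distrr /=.
  apply: eq_bigr => k _; rewrite subr0 -[cos (k%:R * (x - t))]cosN.
  rewrite (_ : - (k%:R * (x - t)) = k%:R * t + - (k%:R * x)); first by ring.
  by ring.
have ic (k : nat) : mu.-integrable I (EFin \o (fun t => Psi t * cos (k%:R * t + - (k%:R * x)))).
  by apply: integrable_mul_bounded => //; exact: bounded_measurable_cos.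
rewrite Rintegral_sum; last by move=> k; exact: integrable_scale.
rewrite /extremal /cos_block big_distrr /= !big_nat; apply: eq_bigr => k /andP[nk _].
rewrite RintegralZl // (is_Psi_coef psi beta) // (leq_trans n0 nk) -/th.
rewrite -[cos (k%:R * x - th)]cosN (_ : - (k%:R * x - th) = th + - (k%:R * x)); last by ring.
by rewrite /a; ring.
Qed.

Lemma integral_abs_test_density : (\int[mu]_(x in I) (`|test_density x|)%:E <= 1)%E.
Proof.
have p2 : 0 <= (2 * pi)^-1 :> R by rewrite invr_ge0 mulr_ge0 // ltW.
have [mb _] := bounded_measurable_block (fejer_coef n) (0 : R) n (3 * n).
have [mF _] : bounded_measurable (fejer n : R -> R) by exact: bounded_measurable_fejer.
apply: (@le_trans _ _ (\int[mu]_(x in I) (((2 * pi)^-1)%:E * (fejer n x)%:E))%E).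
  apply: ge0_le_integral => //.
  - apply: measurable_funTS; apply/measurable_EFinP; apply: measurableT_comp => //.
    by apply: measurable_funM => //; exact: measurable_cst.
  - by apply: measurable_funTS; apply: emeasurable_funM => //; apply/measurable_EFinP.
  - move=> x _; rewrite -EFinM lee_fin /test_density normrM (ger0_norm p2) ler_wpM2l //.
    exact: norm_modulated_fejer.
rewrite ge0_integralZl_EFin //; last 2 first.
- by move=> x _; rewrite lee_fin fejer_ge0.
- by apply: measurable_funTS; apply/measurable_EFinP.
by rewrite integral_fejer // -EFinM mulVf // gt_eqF // mulr_gt0.
Qed.

Lemma extremal_in_class : Lpsi1 psi beta extremal.
Proof.
have [mt _] : bounded_measurable test_density.
  apply: bounded_measurableM; [exact: bounded_measurable_cst|exact: bounded_measurable_block].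
have bt : bounded_measurable test_density.
  apply: bounded_measurableM; [exact: bounded_measurable_cst|exact: bounded_measurable_block].
split; first by move=> x; exact: block_periodic.
split; first by have [] := bounded_measurable_block (fun m => (2 * pi)^-1 * (a m * fejer_coef n m)) th n (3 * n).
exists Psi; split => //; exists 0, test_density.
have pt : periodic2pi test_density by move=> x; rewrite /test_density block_periodic.
split=> //; split => //; split; first exact: bounded_integrable_itv.
split.
  rewrite /test_density RintegralZl //; last first.
    by apply: bounded_integrable_itv; exact: bounded_measurable_block.
  (* The mean is the coefficient of frequency 0, absent from the block because [n > 0]. *)
  have := Rintegral_block (fejer_coef n) (0 : R) 0 n (3 * n) 0 n0.
  rewrite leqn0 gtn_eqF //= => E; rewrite -[RHS](mulr0 (2 * pi)^-1); congr (_ * _).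
  by rewrite -[RHS]E; congr Rintegral; apply/funext => x; rewrite mul0r addr0 cos0 mulr1.
split.
  rewrite /pnorm invr1 poweRe1; last by apply: integral_ge0 => x _; rewrite lee_fin powR_ge0.
  apply: le_trans integral_abs_test_density.
  have := integral_period (fun x => (`|test_density x|)%:E) 0 _ _.
  rewrite add0r => <-.
  - by rewrite le_eqVlt; apply/orP; left; apply/eqP; apply: eq_integral => x _; rewrite powRr1.
  - by apply/measurable_EFinP; exact: measurableT_comp.
  - by move=> x; rewrite pt.
apply: aeW => x; rewrite convolution_test_density -EFinM -EFinD mul0r add0r.
by rewrite mulKf // gt_eqF.
Qed.

Lemma dual_pairing_ge (t : R -> R) : trig_pol n t ->
  a (3 * n)%N * n%:R / 4 <= Rintegral mu I (fun x => (extremal x - t x) * dual_test x).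
Proof.
move=> [c [d tE]].
have bh : bounded_measurable dual_test by exact: bounded_measurable_block.
have be : bounded_measurable extremal by exact: bounded_measurable_block.
have bc k e : bounded_measurable (fun x => dual_test x * cos (k%:R * x + e)).
  by apply: bounded_measurableM => //; exact: bounded_measurable_cos.
have ibc k e : mu.-integrable I (EFin \o (fun x => dual_test x * cos (k%:R * x + e))).
  by apply: bounded_integrable_itv; exact: bc.
have bt : bounded_measurable t.
  rewrite tE; apply: bounded_measurable_sum => k; apply: bounded_measurableD; apply: bounded_measurableM.
  - exact: bounded_measurable_cst.
  - by have := @bounded_measurable_cos R k%:R 0; under eq_fun do rewrite addr0.
  - exact: bounded_measurable_cst.
  - by have := @bounded_measurable_sin R k%:R 0; under eq_fun do rewrite addr0.
have E1 : Rintegral mu I (fun x => t x * dual_test x) = 0.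
  transitivity (Rintegral mu I (fun x => \sum_(k <- index_iota 0 n)
    (c k * (dual_test x * cos (k%:R * x + 0)) + d k * (dual_test x * cos (k%:R * x + - (pi / 2)))))).
    congr Rintegral; apply/funext => x; rewrite tE big_distrl /= -(big_mkord xpredT
      (fun k => (c k * cos (k%:R * x) + d k * sin (k%:R * x)) * dual_test x)).
    by apply: eq_bigr => k _; rewrite addr0 sin_shift; ring.
  rewrite Rintegral_sum; last first.
    move=> k; apply: bounded_integrable_itv; apply: bounded_measurableD; apply: bounded_measurableM => //; exact: bounded_measurable_cst.
  rewrite big_nat big1 // => k /andP[_ kn].
  rewrite RintegralD //; [|exact: integrable_scale|exact: integrable_scale].
  by rewrite !RintegralZl // !Rintegral_block // leqNgt kn /= !mulr0 addr0.
have E2 : Rintegral mu I (fun x => extremal x * dual_test x) =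
    2^-1 * \sum_(n <= k < 3 * n) a k * fejer_coef n k ^+ 2.
  transitivity (Rintegral mu I (fun x => \sum_(k <- index_iota n (3 * n))
    (2 * pi)^-1 * (a k * fejer_coef n k) * (dual_test x * cos (k%:R * x + - th)))).
    congr Rintegral; apply/funext => x; rewrite /extremal {1}/cos_block big_distrl /=.
    by apply: eq_bigr => k _; ring.
  rewrite Rintegral_sum; last by move=> k; exact: integrable_scale.
  rewrite big_distrr /= !big_nat; apply: eq_bigr => k kn.
  rewrite RintegralZl // Rintegral_block // kn subrr cos0 mulr1.
  rewrite invfM; rewrite (_ : 2^-1 / pi * (a k * fejer_coef n k) * (fejer_coef n k * pi) =
    pi^-1 * (pi * (2^-1 * (a k * fejer_coef n k ^+ 2)))); last by ring.
  by rewrite mulKf // gt_eqF.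
have -> : Rintegral mu I (fun x => (extremal x - t x) * dual_test x) =
   Rintegral mu I (fun x => extremal x * dual_test x) - Rintegral mu I (fun x => t x * dual_test x).
  rewrite -RintegralB //.
  - by congr Rintegral; apply/funext => x; rewrite mulrBl.
  - by apply: bounded_integrable_itv; exact: bounded_measurableM.
  - by apply: bounded_integrable_itv; exact: bounded_measurableM.
rewrite E1 E2 subr0.
(* The variance bound [n^3/2] divided by the [n^2] from the coefficients gives [n/2]; with the
   factor 1/2 of [E2] this is the [n/4] of the statement. *)
have H : a (3 * n)%N * (n%:R^-1 ^+ 2 * (n%:R ^+ 3 / 2)) <= \sum_(n <= k < 3 * n) a k * fejer_coef n k ^+ 2.
  apply: (@le_trans _ _ (\sum_(n <= k < 3 * n) a (3 * n)%N * fejer_coef n k ^+ 2)); last first.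
    by rewrite !big_nat; apply: ler_sum => k kn; rewrite ler_wpM2r ?sqr_ge0 // a_ge.
  rewrite -big_distrr /= ler_wpM2l ?(ltW a3n) //.
  rewrite (_ : \sum_(n <= k < 3 * n) _ = n%:R^-1 ^+ 2 * \sum_(n <= k < 3 * n) fejer_count n k ^+ 2); last first.
    by rewrite big_distrr /=; apply: eq_bigr => k _; rewrite /fejer_coef exprMn mulrC.
  by rewrite ler_wpM2l ?sqr_ge0 // fejer_count_sq.
have E3 : n%:R^-1 ^+ 2 * (n%:R ^+ 3 / 2) = n%:R / 2 :> R by field; rewrite gt_eqF.
by rewrite E3 in H; lra.
Qed.

End lower_bound.

(** * Lower bounds of the norms by duality *)

Section lower_bound_norm.
Context {R : realType}.
Local Notation mu := (@lebesgue_measure R).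
Local Notation I := (`[(- pi)%R, pi%R]%classic : set R).
Variables (psi : R -> R) (beta : R) (n : nat).
Let a (k : nat) := psi k%:R.
Hypothesis n0 : (0 < n)%N.
Hypothesis a_ge : forall k, (n <= k < 3 * n)%N -> a (3 * n)%N <= a k.
Hypothesis a3n : 0 < a (3 * n)%N.

Let pi0 : 0 < pi :> R. Proof. exact: pi_gt0. Qed.
Let nr0 : 0 < n%:R :> R. Proof. by rewrite ltr0n. Qed.

(** The constant [1/(8 pi)] combines the 1/4 of the pairing with the bound [2 pi] from the norm of
    the dual function. *)
Let scale_pi (x y : R) : x / (8 * pi) * y = x * y / 4 / (2 * pi).
Proof. by move: (pi : R) pi0 => P P0; field; rewrite gt_eqF. Qed.

Let h := dual_test beta n.
Let f := extremal psi beta n.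

Let bh : bounded_measurable h. Proof. exact: bounded_measurable_block. Qed.
Let bf : bounded_measurable f. Proof. exact: bounded_measurable_block. Qed.

Lemma bounded_measurable_trig_pol m (t : R -> R) : trig_pol m t -> bounded_measurable t.
Proof.
move=> [c [d ->]].
apply: bounded_measurable_sum => k; apply: bounded_measurableD; apply: bounded_measurableM.
- exact: bounded_measurable_cst.
- by have := @bounded_measurable_cos R k%:R 0; under eq_fun do rewrite addr0.
- exact: bounded_measurable_cst.
- by have := @bounded_measurable_sin R k%:R 0; under eq_fun do rewrite addr0.
Qed.

Lemma trig_pol_periodic m (t : R -> R) : trig_pol m t -> periodic2pi t.
Proof.
move=> [c [d ->]] x; apply: eq_bigr => k _; congr (_ * _ + _ * _).
  by have := cosDn2pi k x 0; rewrite !addr0.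
by have := cosDn2pi k x (- (pi / 2)); rewrite -!sin_shift.
Qed.

Variable t : R -> R.
Hypothesis ht : trig_pol n t.
Let u x := f x - t x.

Let bu : bounded_measurable u.
Proof.
have bt := bounded_measurable_trig_pol _ _ ht.
have := bounded_measurableD _ _ bf (bounded_measurableM _ _ (bounded_measurable_cst (-1)) bt).
by congr bounded_measurable; apply/funext => x; rewrite mulN1r.
Qed.

Let pu : periodic2pi u.
Proof. by move=> x; rewrite /u (trig_pol_periodic _ _ ht) /f /extremal block_periodic. Qed.

Lemma dual_abs_ge : ((a (3 * n)%N * n%:R / 4)%:E <= \int[mu]_(x in I) (`|u x * h x|)%:E)%E.
Proof.
have buh : bounded_measurable (fun x => u x * h x) by exact: bounded_measurableM.
have iuh : mu.-integrable I (EFin \o (fun x => u x * h x)) by exact: bounded_integrable_itv.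
have H := dual_pairing_ge psi beta n n0 a_ge a3n t ht.
apply: (@le_trans _ _ (Rintegral mu I (fun x => u x * h x))%:E); first by rewrite lee_fin.
rewrite /Rintegral fineK; last exact: (@integrable_fin_num _ _ _ mu I).
apply: (le_trans (lee_abs _)).
apply: (le_trans (le_abse_integral mu (measurable_itv _) (measurable_int mu iuh))).
by [].
Qed.

(** Hoelder divides the pairing by the [L_q] norm of [h]. That norm comes from interpolation:
    [|h|^q <= n^(q-1) fejer], where the kernel has sup at most [n] and integral [2 pi]. *)
Lemma pnorm_extremal_ge (r : R) : 1 < r ->
  ((a (3 * n)%N / (8 * pi) * n%:R `^ ((r - 1) / r))%:E <= pnorm r%:E u)%E.
Proof.
move=> r1; have r0 : 0 < r by lra.
pose q := r / (r - 1).
have q0 : 0 < q by rewrite divr_gt0 //; lra.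
have rq : r^-1 + q^-1 = 1 by rewrite /q; field; lra.
have [mu_ _] := bu; have [mh _] := bh.
have H := hoelder_on I u h r q (measurable_itv _) mu_ mh r0 q0 rq.
have q1 : 0 <= q - 1.
  by rewrite (_ : q - 1 = (r - 1)^-1) ?invr_ge0; [lra|rewrite /q; field; lra].
have [mF _] : bounded_measurable (fejer n : R -> R) by exact: bounded_measurable_fejer.
have hq : (\int[mu]_(x in I) (`|h x| `^ q)%:E <= (n%:R `^ (q - 1) * (2 * pi))%:E)%E.
  rewrite EFinM -(integral_fejer n n0) -ge0_integralZl_EFin ?powR_ge0 //; last 2 first.
  - by move=> x _; rewrite lee_fin fejer_ge0.
  - by apply: measurable_funTS; apply/measurable_EFinP.
  apply: ge0_le_integral => //.
  - apply: measurable_funTS; apply/measurable_EFinP; apply: (measurableT_comp (measurable_powR q)).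
    exact: measurableT_comp.
  - by apply: measurable_funTS; apply: emeasurable_funM => //; apply/measurable_EFinP.
  move=> x _; rewrite -EFinM lee_fin.
  have F0 := fejer_ge0 n x.
  have hF : `|h x| <= fejer n x by exact: norm_modulated_fejer.
  apply: (@le_trans _ _ (fejer n x `^ q)).
    by apply: ge0_ler_powR; rewrite ?nnegrE //; exact: ltW.
  move: F0; rewrite le_eqVlt => /predU1P[<-|F0].
    by rewrite powR0 ?mulr0 // gt_eqF.
  rewrite -{1}(subrK 1 q) powR_add // powRr1; last exact: ltW.
  rewrite ler_wpM2r ?(ltW F0) //; apply: ge0_ler_powR; rewrite ?nnegrE ?(ltW F0) //.
  exact: fejer_le.
have hq2 : ((\int[mu]_(x in I) (`|h x| `^ q)%:E) `^ q^-1 <= (2 * pi * n%:R `^ r^-1)%:E)%E.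
  apply: (@le_trans _ _ ((n%:R `^ (q - 1) * (2 * pi))%:E `^ q^-1)%E).
    apply: gt0_ler_poweR => //.
    - by rewrite invr_ge0 ltW.
    - by rewrite in_itv /= leey andbT; apply: integral_ge0 => x _; rewrite lee_fin powR_ge0.
    - by rewrite in_itv /= leey andbT lee_fin mulr_ge0 ?powR_ge0 // mulr_ge0 // ltW.
  rewrite poweR_EFin lee_fin powRM ?powR_ge0 //; last by rewrite mulr_ge0 // ltW.
  rewrite -powRrM (_ : (q - 1) * q^-1 = r^-1); last by rewrite /q; field; lra.
  rewrite mulrC ler_wpM2r ?powR_ge0 //.
  (* [(2 pi)^(1/q)] is replaced by the larger [2 pi], so that the constant is free of the
     exponent. *)
  have p1 : 1 <= 2 * pi :> R by have := @pi_ge2 R; lra.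
  rewrite -[leRHS]powRr1; last by lra.
  by apply: ler_powR => //; rewrite invf_le1 //; lra.
have pnE : pnorm r%:E u = ((\int[mu]_(x in I) (`|u x| `^ r)%:E) `^ r^-1)%E.
  rewrite /pnorm; congr (_ `^ _)%E.
  have := integral_period (fun x => (`|u x| `^ r)%:E) 0 _ _.
  rewrite add0r; apply => [|x]; last by rewrite pu.
  apply/measurable_EFinP; apply: (measurableT_comp (measurable_powR r)).
  exact: measurableT_comp.
have X0 : (0 <= pnorm r%:E u)%E by rewrite pnE; exact: poweR_ge0.
have {}H := le_trans dual_abs_ge H; rewrite -pnE in H.
have {}H := le_trans H (lee_wpmul2l X0 hq2).
case: (pnorm r%:E u) X0 H => [x|_ _|//]; last by rewrite leey.
rewrite lee_fin => x0; rewrite -EFinM !lee_fin => H.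
have N0 : 0 < n%:R `^ r^-1 :> R by rewrite powR_gt0.
rewrite (_ : (r - 1) / r = 1 - r^-1); last by field; lra.
rewrite powR_add // powRr1 ?(ltW nr0) // powRN mulrA ler_pdivrMr //.
rewrite scale_pi.
by rewrite ler_pdivrMr ?mulr_gt0 // (_ : x * n%:R `^ r^-1 * (2 * pi) = x * (2 * pi * n%:R `^ r^-1)) //; ring.
Qed.

Lemma pnorm_oo_extremal_ge : ((a (3 * n)%N / (8 * pi) * n%:R)%:E <= pnorm +oo%E u)%E.
Proof.
have [mu_ _] := bu; have [mh _] := bh.
have [mF _] : bounded_measurable (fejer n : R -> R) by exact: bounded_measurable_fejer.
have key (y : R) : 0 <= y -> {ae mu, forall x, x \in `[0, 2 * pi] -> `|u x| <= y} ->
    a (3 * n)%N / (8 * pi) * n%:R <= y.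
  move=> y0 uy.
  have E : (\int[mu]_(x in I) (`|u x * h x|)%:E = \int[mu]_(x in `[0%R, (2 * pi)%R]) (`|u x * h x|)%:E)%E.
    have := integral_period (fun x => (`|u x * h x|)%:E) 0 _ _.
    rewrite add0r => ->  //.
      by apply/measurable_EFinP; apply: measurableT_comp => //; exact: measurable_funM.
    by move=> x; rewrite pu /h /dual_test block_periodic.
  have EF : (\int[mu]_(x in `[0%R, (2 * pi)%R]) (fejer n x)%:E = (2 * pi)%:E)%E.
    rewrite -(integral_fejer n n0).
    have := integral_period (fun x => (fejer n x : R)%:E) 0 _ _; rewrite add0r; apply.
      by apply/measurable_EFinP.
    by move=> x; rewrite fejer_periodic.
  have L : (\int[mu]_(x in `[0%R, (2 * pi)%R]) (`|u x * h x|)%:E <= (y * (2 * pi))%:E)%E.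
    rewrite EFinM -EF -ge0_integralZl_EFin //; last 2 first.
    - by move=> x _; rewrite lee_fin fejer_ge0.
    - by apply: measurable_funTS; apply/measurable_EFinP.
    apply: ae_ge0_le_integral => //.
    - by apply: measurable_funTS; apply/measurable_EFinP; apply: measurableT_comp => //; exact: measurable_funM.
    - by move=> x _; rewrite -EFinM lee_fin mulr_ge0 ?fejer_ge0.
    - by apply: measurable_funTS; apply: emeasurable_funM => //; apply/measurable_EFinP.
    apply: (ae_imp _ _ uy) => x ux xI; rewrite -EFinM lee_fin normrM ler_pM //.
      exact: ux.
    exact: norm_modulated_fejer.
  have := dual_abs_ge; rewrite E => /le_trans /(_ L).
  rewrite lee_fin => H.
  rewrite scale_pi.
  by rewrite ler_pdivrMr ?mulr_gt0.
(* The essential supremum is an infimum over extended reals. A bound [y < 0], or [-oo], would give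
   [|u| <= 0] almost everywhere and contradict [key] at 0. *)
apply: le_ereal_inf_tmp => y /= uy; case: y uy => [y uy| _|uy].
- rewrite lee_fin; have [y0|y0] := leP 0 y; first by apply: key.
  have := key 0 (lexx 0) _; have H0 : {ae mu, forall x, x \in `[0, 2 * pi] -> `|u x| <= 0}.
    by apply: (ae_imp _ _ uy) => x ux xI; have := ux xI; rewrite lee_fin => /le_trans; apply; exact: ltW.
  move=> /(_ H0); rewrite leNgt => /negP; case.
  by rewrite mulr_gt0 // divr_gt0 // mulr_gt0.
- by rewrite leey.
- have H0 : {ae mu, forall x, x \in `[0, 2 * pi] -> `|u x| <= 0}.
    by apply: (ae_imp _ _ uy) => x ux xI; have := ux xI; rewrite leeNy_eq.
  have := key 0 (lexx 0) H0; rewrite leNgt => /negP; case.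
  by rewrite mulr_gt0 // divr_gt0 // mulr_gt0.
Qed.

End lower_bound_norm.

(** * Orders of magnitude *)

Section assembly.
Context {R : realType}.
Local Notation mu := (@lebesgue_measure R).
Local Notation I := (`[(- pi)%R, pi%R]%classic : set R).

Lemma ge1_natr n : (0 < n)%N -> 1 <= n%:R :> R.
Proof. by move=> n0; rewrite (ler_nat R 1 n). Qed.

(** Doubling twice reaches [4n], and [3n <= 4n] with [psi] nonincreasing; hence [c = K^(-2)]. *)
Lemma classB_triple (psi : R -> R) : classB psi ->
  exists2 c : R, 0 < c & forall n, (0 < n)%N -> c * psi n%:R <= psi (3 * n)%:R.
Proof.
move=> [psi0 [psi_dec [K hK]]].
have K0 : 0 < K.
  by apply: lt_le_trans (hK 1 (lexx _)); rewrite divr_gt0 // psi0 //; lra.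
have dbl t : 1 <= t -> psi t <= K * psi (2 * t).
  by move=> t1; rewrite -ler_pdivrMr ?hK // psi0 //; lra.
exists (K ^+ 2)^-1 => [|n n0]; first by rewrite invr_gt0 exprn_gt0.
have n1 := ge1_natr n n0.
rewrite mulrC ler_pdivrMr ?exprn_gt0 //.
apply: (le_trans (dbl _ n1)).
have d2 : psi (2 * n%:R) <= K * psi (2 * (2 * n%:R)) by apply: dbl; lra.
apply: (le_trans (ler_wpM2l (ltW K0) d2)).
rewrite (_ : K * (K * _) = psi (2 * (2 * n%:R)) * K ^+ 2); last by ring.
apply: ler_wpM2r; first by rewrite exprn_ge0 // ltW.
by apply: psi_dec; rewrite natrM; lra.
Qed.

Definition power_decay (psi : R -> R) (al K : R) : Prop :=
  forall n k, (0 < n)%N -> (n <= k)%N ->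
    psi k%:R <= K * (n%:R `^ al * k%:R `^ (- al)) * psi n%:R.

Lemma classTheta_power_decay (q : R) (psi : R -> R) :
  (forall t, 1 <= t -> 0 < psi t) -> classTheta q psi ->
  exists al K : R, [/\ q^-1 < al, 1 <= K & power_decay psi al K].
Proof.
(* [classTheta] compares distinct points only; the case [k = n] of [power_decay] asks for a constant
   at least 1. *)
move=> psi0 [_ [al [K [qal [K0 hK]]]]]; exists al, (Num.max 1 K).
split => //; first by rewrite le_max lexx.
move=> n k n0 nk.
have n1 := ge1_natr n n0.
have k1 := ge1_natr k (leq_trans n0 nk).
have [nr0 kr0] : 0 < n%:R :> R /\ 0 < k%:R :> R by split; lra.
have {}hK : k%:R `^ al * psi k%:R <= Num.max 1 K * (n%:R `^ al * psi n%:R).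
  have P0 : 0 <= n%:R `^ al * psi n%:R by rewrite mulr_ge0 ?powR_ge0 // ltW // psi0.
  move: nk; rewrite leq_eqVlt => /predU1P[<-|nk].
    by rewrite ler_peMl // le_max lexx.
  apply: (le_trans (hK _ _ n1 _)); first by rewrite ltr_nat.
  by rewrite ler_wpM2r // le_max lexx orbT.
have -> : Num.max 1 K * (n%:R `^ al * k%:R `^ (- al)) * psi n%:R =
    k%:R `^ (- al) * (Num.max 1 K * (n%:R `^ al * psi n%:R)) by ring.
by rewrite powRN -[leLHS](mulKf (lt0r_neq0 (powR_gt0 al kr0))) ler_wpM2l // invr_ge0 powR_ge0.
Qed.

(** Since [n/k <= 1], lowering the exponent weakens the bound. It serves to bring the exponent of
    [Theta] below 1, as the envelope requires. *)
Lemma power_decay_le (psi : R -> R) (al be K : R) : (forall t, 1 <= t -> 0 < psi t) ->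
  0 <= K -> be <= al -> power_decay psi al K -> power_decay psi be K.
Proof.
move=> psi0 K0 ba h n k n0 nk; apply: (le_trans (h n k n0 nk)).
have n1 := ge1_natr n n0; have k1 := ge1_natr k (leq_trans n0 nk).
rewrite ler_wpM2r ?(ltW (psi0 _ n1)) // ler_wpM2l //.
have E (c : R) : n%:R `^ c * k%:R `^ (- c) = (n%:R / k%:R) `^ c.
  by rewrite powRM ?invr_ge0 // -powR_inv1 // -powRrM mulN1r.
rewrite !E; apply: ger_powR => //.
by rewrite divr_gt0 ?(lt_le_trans ltr01) //= ler_pdivrMr ?(lt_le_trans ltr01) // mul1r ler_nat.
Qed.

Lemma power_decay_cvg0 (psi : R -> R) (al K : R) : (forall t, 1 <= t -> 0 < psi t) ->
  0 < al -> 0 < K -> power_decay psi al K -> psi k%:R @[k --> \oo] --> (0 : R).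
Proof.
move=> psi0 al0 K0 h; apply/cvgrPdist_le => e e0.
pose C := K * psi 1.
have C0 : 0 < C by rewrite mulr_gt0 // psi0.
near=> k.
have k0 : (0 < k)%N by near: k; exists 1%N.
have k1 := ge1_natr k k0.
rewrite sub0r normrN gtr0_norm ?psi0 //.
apply: (le_trans (h 1%N k isT k0)).
rewrite powR1 mul1r mulrAC -/C powRN ler_pdivrMr ?powR_gt0 ?(lt_le_trans ltr01) //.
rewrite mulrC -ler_pdivrMr //.
have Ce : 0 <= C / e by rewrite divr_ge0 // ltW.
have -> : C / e = ((C / e) `^ al^-1) `^ al.
  by rewrite -powRrM mulVf ?gt_eqF // powRr1.
apply: ge0_ler_powR; rewrite ?nnegrE ?powR_ge0 ?(ltW al0) //.
by near: k; apply: nbhs_infty_ger.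
Unshelve. all: by end_near. Qed.

(** On a set of finite measure, [f <= 1 + f^r]. *)
Lemma integrable_of_powR (f : R -> R) (r : R) : 1 <= r -> measurable_fun setT f ->
  (forall x, 0 <= f x) -> (\int[mu]_(x in I) (f x `^ r)%:E < +oo)%E ->
  mu.-integrable I (EFin \o f).
Proof.
move=> r1 mf f0 foo.
have mfr : measurable_fun I (fun x => (f x `^ r)%:E).
  apply: measurable_funTS; apply/measurable_EFinP.
  exact: (measurableT_comp (measurable_powR r) mf).
have i1 : mu.-integrable I (fun x : R => (1%R)%:E).
  exact: (bounded_integrable_itv _ _ _ (bounded_measurable_cst 1)).
have ir : mu.-integrable I (fun x => (f x `^ r)%:E).
  apply/integrableP; split => //.
  by under eq_integral do rewrite /= ger0_norm ?powR_ge0 //.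
apply: (@le_integrable _ _ _ mu I (measurable_itv _) _ _ _ _
  (@integrableD _ _ _ mu I (measurable_itv _) _ _ i1 ir)).
  by apply: measurable_funTS; apply/measurable_EFinP.
move=> x _ /=; rewrite lee_fin !ger0_norm ?addr_ge0 ?powR_ge0 //.
have [f1|f1] := leP (f x) 1; first by rewrite (le_trans f1) // lerDl powR_ge0.
apply: (@le_trans _ _ (f x `^ r)); last by rewrite lerDr.
by rewrite -[leLHS]powRr1 //; apply: ler_powR => //; exact: ltW.
Qed.

(** * Two-sided bounds for a fixed [psi] *)

Section fixed_psi.
Variables (psi : R -> R) (c : R).
Hypothesis psi0 : forall t, 1 <= t -> 0 < psi t.
Hypothesis psi_dec : forall t1 t2, 1 <= t1 -> t1 <= t2 -> psi t2 <= psi t1.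
Hypothesis c0 : 0 < c.
Hypothesis psi3 : forall n, (0 < n)%N -> c * psi n%:R <= psi (3 * n)%:R.

Let a (k : nat) := psi k%:R.

Let a_dec k : (0 < k)%N -> a k.+1 <= a k.
Proof. by move=> k0; apply: psi_dec; rewrite ?ge1_natr // ler_nat. Qed.

Let a_gt0 k : (0 < k)%N -> 0 < a k.
Proof. by move=> k0; rewrite /a psi0 // ge1_natr. Qed.

Let a_ge0 k : (0 < k)%N -> 0 <= a k.
Proof. by move=> k0; rewrite ltW // a_gt0. Qed.

Let a_ge n k : (0 < n)%N -> (n <= k < 3 * n)%N -> a (3 * n)%N <= a k.
Proof.
move=> n0 /andP[nk k3]; apply: psi_dec; first by rewrite ge1_natr // (leq_trans n0).
by rewrite ler_nat ltnW.
Qed.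

Lemma bestE_ge (beta : R) (Psi : R -> R) (p : \bar R) (d : R) n : is_Psi psi beta Psi -> (0 < n)%N ->
  (forall t, trig_pol n t ->
    ((a (3 * n)%N / (8 * pi) * d)%:E <= pnorm p (fun x => (extremal psi beta n x - t x)%R))%E) ->
  0 <= d -> ((c / (8 * pi) * psi n%:R * d)%:E <= bestE n psi beta p)%E.
Proof.
move=> hPsi n0 H d0.
apply: (@le_trans _ _ (ereal_inf [set pnorm p (extremal psi beta n \- t) | t in trig_pol n])); last first.
  apply: ereal_sup_ubound; exists (extremal psi beta n) => //.
  exact: extremal_in_class hPsi n0.
apply: le_ereal_inf_tmp => _ [t ht <-].
apply: le_trans (H t ht); rewrite lee_fin ler_wpM2r // mulrAC ler_wpM2r ?psi3 //.
by rewrite invr_ge0 mulr_ge0 // pi_ge0.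
Qed.

Lemma error_bounds_fin (r al K : R) : 1 < r -> (r - 1) / r < al -> al < 1 -> 1 <= K ->
  power_decay psi al K ->
  exists K3 K4 : R, 0 < K3 /\ 0 < K4 /\
    forall (beta : R) (n : nat), (0 < n)%N ->
      ((K4 * psi n%:R * n%:R `^ ((r - 1) / r))%:E <= bestE n psi beta r%:E)%E /\
      (bestE n psi beta r%:E <= calE n psi beta r%:E)%E /\
      (calE n psi beta r%:E <= (K3 * psi n%:R * n%:R `^ ((r - 1) / r))%:E)%E.
Proof.
move=> r1 ral al1 K1 dec.
have r0 : 0 < r by lra.
have al0 : 0 < al by apply: le_lt_trans ral; rewrite divr_ge0; lra.
have alr : 0 < (al - 1) * r + 1 by move: ral; rewrite ltr_pdivrMr //; lra.
(* [C] is the constant of [cos_block_envelope] and [C2] that of [integral_envelope_le]. Neither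
   involves [beta], so the witnesses are chosen before it. *)
pose C := K * (4 / (1 - al) + 4).
pose C2 := 2 * (((al - 1) * r + 1)^-1 + (r - 1)^-1).
have C0 : 0 < C by rewrite mulr_gt0 ?addr_gt0 ?divr_gt0 //; lra.
have C20 : 0 < C2 by rewrite mulr_gt0 ?addr_gt0 ?invr_gt0 //; lra.
exists (C * C2 `^ r^-1), (c / (8 * pi)).
split; first by rewrite mulr_gt0 // powR_gt0.
split; first by rewrite divr_gt0 // mulr_gt0 // pi_gt0.
move=> beta n n0.
pose G (m : nat) (x : R) := C * a m * envelope al m `|x|.
have mG m : measurable_fun setT (G m).
  apply: measurable_funM => //.
  by apply: (measurableT_comp (measurable_envelope al m)); exact: normr_measurable.
have block_le (m l : nat) (x : R) : (0 < m)%N -> x != 0 -> `|x| <= pi ->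
    `|cos_block a (beta * pi / 2) m l x| <= G m x.
  move=> m0 x0 xpi; apply: cos_block_envelope => // k mk.
  - by apply: a_dec; exact: leq_trans mk.
  - by apply: a_ge0; exact: leq_trans mk.
  - exact: dec.
have a_cvg0 : psi k%:R @[k --> \oo] --> (0 : R).
  by apply: (power_decay_cvg0 psi al K) => //; lra.
have Gn (m : nat) : (0 < m)%N -> (\int[mu]_(x in I) (G m x `^ r)%:E <=
    ((C * C2 `^ r^-1 * a m * m%:R `^ ((r - 1) / r)) `^ r)%:E)%E.
  move=> m0.
  have Cam : 0 <= C * a m by rewrite mulr_ge0 ?a_ge0 // ltW.
  have -> : (C * C2 `^ r^-1 * a m * m%:R `^ ((r - 1) / r)) `^ r =
      (C * a m) `^ r * (C2 * m%:R `^ (r - 1)).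
    rewrite (_ : C * _ * _ * _ = C * a m * (C2 `^ r^-1 * m%:R `^ ((r - 1) / r))); last by ring.
    rewrite (powRM r Cam (mulr_ge0 (powR_ge0 _ _) (powR_ge0 _ _))); congr (_ * _).
    rewrite (powRM r (powR_ge0 C2 _) (powR_ge0 _ _)) -!powRrM divfK ?gt_eqF // mulVf ?gt_eqF //.
    by rewrite powRr1 // ltW.
  under eq_integral do rewrite powRM ?envelope_ge0 // EFinM.
  rewrite ge0_integralZl_EFin ?powR_ge0 //; last 2 first.
  - by move=> x _; rewrite lee_fin powR_ge0.
  - apply: measurable_funTS; apply/measurable_EFinP.
    apply: (measurableT_comp (measurable_powR r)).
    by apply: (measurableT_comp (measurable_envelope al m)); exact: normr_measurable.
  rewrite [leRHS]EFinM lee_wpmul2l // ?lee_fin ?powR_ge0 //.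
  exact: integral_envelope_le.
have iG : mu.-integrable I (EFin \o G 1%N).
  apply: (integrable_of_powR _ r) => //; first exact: ltW.
    by move=> x; apply: mulr_ge0 (envelope_ge0 _ _ _); apply: mulr_ge0; [exact: ltW|exact: a_ge0].
  by apply: (le_lt_trans (Gn 1%N isT)); rewrite ltry.
have a3n : 0 < a (3 * n)%N by apply: a_gt0; rewrite muln_gt0.
split; [|split].
- apply: (bestE_ge beta (kernel_sum a (beta * pi / 2))); rewrite ?powR_ge0 //.
    exact: (is_Psi_kernel_sum psi beta G).
  by move=> t ht; apply: pnorm_extremal_ge => // k; exact: a_ge.
- exact: bestE_le_calE.
- apply: (calE_le_fin psi beta G) => //; last exact: Gn.
  apply: mulr_ge0 (powR_ge0 _ _); apply: mulr_ge0; last exact: a_ge0.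
  by apply: mulr_ge0 (powR_ge0 _ _); exact: ltW.
Qed.

(** With [al > 1] the sum of [a k] over [k >= m] is at most a constant times [a m * m], so the
    blocks are bounded uniformly in [x] by absolute values and [G m] is constant. *)
Lemma error_bounds_oo (al K : R) : 1 < al -> 1 <= K -> power_decay psi al K ->
  exists K3 K4 : R, 0 < K3 /\ 0 < K4 /\
    forall (beta : R) (n : nat), (0 < n)%N ->
      ((K4 * psi n%:R * n%:R)%:E <= bestE n psi beta +oo)%E /\
      (bestE n psi beta +oo <= calE n psi beta +oo)%E /\
      (calE n psi beta +oo <= (K3 * psi n%:R * n%:R)%:E)%E.
Proof.
move=> al1 K1 dec.
have al0 : 0 < al by lra.
pose C := K * (2 `^ al / (al - 1)).
have C0 : 0 < C by rewrite mulr_gt0 ?divr_gt0 ?powR_gt0 //; lra.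
exists C, (c / (8 * pi)).
split=> //; split; first by rewrite divr_gt0 // mulr_gt0 // pi_gt0.
move=> beta n n0.
pose G (m : nat) (x : R) := C * a m * m%:R.
have block_le (m l : nat) (x : R) : (0 < m)%N -> x != 0 -> `|x| <= pi ->
    `|cos_block a (beta * pi / 2) m l x| <= G m x.
  move=> m0 _ _; apply: (le_trans (cos_block_abs _ _ _ _ _ _)).
    by move=> k mk; apply: a_ge0; exact: leq_trans mk.
  apply: (@le_trans _ _ (\sum_(m <= k < l) K * m%:R `^ al * a m * k%:R `^ (- al))).
    rewrite !big_nat; apply: ler_sum => k /andP[mk _].
    by apply: (le_trans (dec m k m0 mk)); rewrite le_eqVlt; apply/orP; left; apply/eqP; rewrite /a; ring.
  rewrite -mulr_sumr.
  have mr0 : 0 < m%:R :> R by rewrite ltr0n.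
  have P0 : 0 <= K * m%:R `^ al * a m by rewrite !mulr_ge0 ?powR_ge0 ?a_ge0 //; lra.
  apply: (le_trans (ler_wpM2l P0 (sum_powR_gt1 al m l al1 m0))).
  have E : m%:R `^ al * m%:R `^ (1 - al) = m%:R :> R.
    by rewrite -powR_add // addrC subrK powRr1 // ltW.
  rewrite /G /C -[X in _ <= _ * X]E le_eqVlt; apply/orP; left; apply/eqP.
  by move: (2 `^ al / _) => y; ring.
have a_cvg0 : psi k%:R @[k --> \oo] --> (0 : R).
  by apply: (power_decay_cvg0 psi al K) => //; lra.
have iG : mu.-integrable I (EFin \o G 1%N).
  exact: (bounded_integrable_itv _ _ _ (bounded_measurable_cst _)).
have a3n : 0 < a (3 * n)%N by apply: a_gt0; rewrite muln_gt0.
split; [|split].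
- apply: (bestE_ge beta (kernel_sum a (beta * pi / 2))) => //.
    exact: (is_Psi_kernel_sum psi beta G).
  by move=> t ht; apply: pnorm_oo_extremal_ge => // k; exact: a_ge.
- exact: bestE_le_calE.
- apply: (calE_le_oo psi beta G) => //.
  by apply: mulr_ge0 => //; apply: mulr_ge0; [exact: ltW|exact: a_ge0].
Qed.

End fixed_psi.
End assembly.

Theorem theorem3 (R : realType) (p : \bar R) (psi : R -> R) :
  (1 < p)%E ->
  {within `[1, +oo[, continuous psi} ->
  (forall t, 1 <= t -> 0 < psi t) ->
  classB psi -> classTheta (conj_exp p) psi ->
  ((forall k : nat, (0 < k)%N -> 0 <= Delta2inv psi k) \/
   (forall k : nat, (0 < k)%N -> Delta2inv psi k <= 0)) ->
  exists K3 K4 : R, 0 < K3 /\ 0 < K4 /\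
    forall (beta : R) (n : nat), (0 < n)%N ->
      ((K4 * psi n%:R * n%:R `^ (conj_exp p)^-1)%:E <= bestE n psi beta p)%E /\
      (bestE n psi beta p <= calE n psi beta p)%E /\
      (calE n psi beta p <= (K3 * psi n%:R * n%:R `^ (conj_exp p)^-1)%:E)%E.
Proof.
move=> p1 _ psi0 hB hT _.
have [c c0 psi3] := classB_triple psi hB.
have psi_dec := hB.2.1.
have [al [K [qal K1 dec]]] := classTheta_power_decay _ psi psi0 hT.
have K0 : 0 <= K by lra.
case: p p1 hT qal => [r|//|//] /=; last first.
  move=> _ _; rewrite invr1 => al1.
  have [K3 [K4 [K30 [K40 H]]]] := error_bounds_oo psi c psi0 psi_dec c0 psi3 al K al1 K1 dec.
  exists K3, K4; do 2 split => //.
  by move=> beta n n0; rewrite powRr1 //; exact: H.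
rewrite lte_fin invf_div => r1 _ qal.
have s1 : (r - 1) / r < 1 by rewrite ltr_pdivrMr; lra.
(* The envelope needs an exponent strictly between [1/p' = (r - 1)/r] and 1; the midpoint caps [al]
   from above. *)
pose be := Num.min al (((r - 1) / r + 1) / 2).
apply: (error_bounds_fin psi c psi0 psi_dec c0 psi3 r be K) => //.
- by rewrite lt_min qal /=; lra.
- by rewrite gt_min; apply/orP; right; lra.
- by apply: (power_decay_le psi al be K) => //; rewrite ge_min lexx.
Qed.
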